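(* There are constants $N\in[0,\infty)$ and $h_0>0$ such that for all $h\in(0,h_0]$ the following is true: (i) The finite-difference equation $$\sup_{\alpha\in A}\Big[\sum_{|k|=1}^{d_1}a^\alpha_k(x)\Delta_{h,k}v(x)+\sum_{|k|=1}^{d_1}b^\alpha_k(x)\delta_{h,k}v(x)-c^\alpha(x)v(x)+f^\alpha(x)\Big]=0,\qquad x\in\Omega_h,$$ with boundary condition $v=g$ on $\partial_h\Omega$ has a unique bounded Borel solution $v_h$ on $\mathbb{R}^d$. (ii) On $\mathbb{R}^d$ $$\rho^{-1}|v_h-g|\le N,\qquad |\delta_{h,i}v_h|\le N,\qquad (\rho-6h)\,|\delta_{h,i}\delta_{h,j}v_h|\le N$$ for any $i,j\in\{\pm1,\dots,\pm d_1\}$ (the first inequality being understood as $|v_h-g|\le N\rho$), and for any $x,y\in\mathbb{R}^d$ $$|v_h(x)-v_h(y)|\le N(|x-y|+h).$$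
   Context: Let $A$ be a set, $d,d_1\ge1$ integers, and let $a^\alpha_k(x),b^\alpha_k(x),c^\alpha(x),f^\alpha(x)$ be real-valued functions of $(\alpha,x)\in A\times\mathbb{R}^d$, $k=\pm1,\dots,\pm d_1$, which for each $x$ are bounded with respect to $\alpha\in A$. Let $B=\{x\in\mathbb{R}^d:|x|\le1\}$ and let $l_k\in B$, $k=\pm1,\dots,\pm d_1$, be given vectors. Difference operators: for $\xi\in\mathbb{R}^d$, $h>0$ and a function $\phi$ on $\mathbb{R}^d$, $T_{h,\xi}\phi(x)=\phi(x+h\xi)$, $\delta_{h,\xi}=(T_{h,\xi}-1)/h$, $\Delta_{h,\xi}=(T_{h,\xi}-2+T_{h,-\xi})/h^2$; $\delta_{h,k}=\delta_{h,l_k}$, $\Delta_{h,k}=\Delta_{h,l_k}$. Sums over $|k|=1,\dots,d_1$ are over all $k=\pm1,\dots,\pm d_1$. Assumption on coefficients: a function $g$ on $\mathbb{R}^d$ and constants $\delta,K\in(0,\infty)$ are given such that for all $\alpha\in A$ and all $k$, on $\mathbb{R}^d$, $a^\alpha_k\ge\delta$ and $c^\alpha\ge\delta$; and for $\phi=g,a^\alpha_j,b^\alpha_k,c^\alpha,f^\alpha$ (all $\alpha\in A$, $j,k\in\{\pm1,\dots,\pm d_1\}$) one has $\phi\in C^{1,1}(\mathbb{R}^d)$ and $\|\phi\|_{C^{1,1}(\mathbb{R}^d)}\le K$ ($\phi$ and $D\phi$ are bounded and $D\phi$ is Lipschitz). Assumption on directions: (i) $l_k=-l_{-k}$ and $a^\alpha_k=a^\alpha_{-k}$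 for all $k$. (ii) There is an integer $1\le d_0\le d_1$ such that for $\Lambda=\{l_k:k=\pm1,\dots,\pm d_1\}$ and $\mathcal{L}=\{l_{\pm1},\dots,l_{\pm d_0}\}$ we have $0\in\mathcal{L}$ and $\mathcal{L}+\mathcal{L}\supset\Lambda\supset\{l'+l'':l',l''\in\mathcal{L},\,l'\ne l''\}$. (iii) The coordinates of the $l_k$ are rational numbers and $\mathrm{Span}\,\Lambda=\mathbb{R}^d$. Domain: $\psi\in C^2(\mathbb{R}^d)$ is given such that $\Omega=\{x:\psi(x)>0\}$ is a bounded domain and $|D\psi|\ge1$ on $\partial\Omega$. Put $\Omega_h=\{x\in\Omega:x+hB\subset\Omega\}$, $\partial_h\Omega=\mathbb{R}^d\setminus\Omega_h$, $\Omega^c=\mathbb{R}^d\setminus\Omega$, and $\rho(x)=\mathrm{dist}(x,\Omega^c)$ (so $\rho=0$ on $\Omega^c$). The constants $N,h_0$ do not depend on $h,x,y$. *)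

(* Defs.v *)
From HB Require Import structures.
From mathcomp Require Import all_boot all_order all_algebra.
From mathcomp Require Import all_classical all_reals all_analysis.

Set Implicit Arguments.
Unset Strict Implicit.
Unset Printing Implicit Defensive.

Import Order.TTheory GRing.Theory Num.Theory.
Import numFieldNormedType.Exports.

Local Open Scope classical_set_scope.
Local Open Scope ring_scope.

Section Euclidean.
Context {R : realType} {d : nat}.
Implicit Types (x y : 'rV[R]_d) (f : 'rV[R]_d -> R) (D : set 'rV[R]_d).

(* The library norm on ['rV[R]_d] is the sup norm; it induces the same topology
   and the same bounded sets, but distances below are Euclidean. *)
Definition enorm x : R := Num.sqrt (\sum_(i < d) x 0 i ^+ 2).

Definition unit_ball : set 'rV[R]_d := [set x | enorm x <= 1].

Definition edist_to D x : R := inf [set enorm (x - y) | y in D].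

Definition is_domain D : Prop := [/\ open D, connected D & D !=set0].

Definition topo_boundary D : set 'rV[R]_d := closure D `\` interior D.

Definition partial (i : 'I_d) f : 'rV[R]_d -> R :=
  fun x => 'D_(delta_mx 0 i) f x.

Definition grad f x : 'rV[R]_d := \row_(i < d) partial i f x.

Definition is_C1 f : Prop :=
  (forall x, differentiable f x) /\ (forall i, continuous (partial i f)).

Definition is_C2 f : Prop := is_C1 f /\ (forall i, is_C1 (partial i f)).

Definition is_C11 f : Prop :=
  [/\ forall x, differentiable f x,
      exists M : R, forall x, `|f x| <= M,
      exists M : R, forall x, enorm (grad f x) <= M &
      exists M : R, forall x y,
        enorm (grad f x - grad f y) <= M * enorm (x - y)].

Definition C11_norm f : \bar R :=
  (ereal_sup [set (`|f x|)%:E | x in [set: 'rV[R]_d]]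
   + ereal_sup [set (enorm (grad f x))%:E | x in [set: 'rV[R]_d]]
   + ereal_sup [set (enorm (grad f p.1 - grad f p.2) / enorm (p.1 - p.2))%:E
                 | p in [set p : 'rV[R]_d * 'rV[R]_d | p.1 != p.2]])%E.

Definition borel_fun f : Prop :=
  measurable_fun [set: g_sigma_algebraType (@open 'rV[R]_d)]
    (f : g_sigma_algebraType (@open 'rV[R]_d) -> R).

Definition bounded_on_space f : Prop := exists M : R, forall x, `|f x| <= M.

End Euclidean.

(* [(i, true)] stands for the index [i + 1] and [(i, false)] for [- (i + 1)]. *)
Definition sidx (d1 : nat) : finType := ('I_d1 * bool)%type.

Definition sidx_opp (d1 : nat) (k : sidx d1) : sidx d1 := (k.1, ~~ k.2).

Section Differences.
Context {R : realType} {d : nat}.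
Implicit Types (h : R) (xi : 'rV[R]_d) (phi : 'rV[R]_d -> R).

Definition shiftT h xi phi : 'rV[R]_d -> R := fun x => phi (x + h *: xi).

Definition fdiff h xi phi : 'rV[R]_d -> R :=
  fun x => (shiftT h xi phi x - phi x) / h.

Definition fdiff2 h xi phi : 'rV[R]_d -> R :=
  fun x => (shiftT h xi phi x - 2 * phi x + shiftT h (- xi) phi x) / h ^+ 2.

End Differences.

Section Directions.
Context {R : realType} {d d1 : nat}.
Variable l : sidx d1 -> 'rV[R]_d.

Definition Lambda : set 'rV[R]_d := [set l k | k in [set: sidx d1]].

Definition calL (d0 : nat) : set 'rV[R]_d :=
  [set l k | k in [set k : sidx d1 | (k.1 < d0)%N]].

Definition direction_condition (d0 : nat) : Prop :=
  [/\ calL d0 0,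
      Lambda `<=` [set u + v | u in calL d0 & v in calL d0] &
      [set p.1 + p.2 | p in [set p : 'rV[R]_d * 'rV[R]_d |
         [/\ calL d0 p.1, calL d0 p.2 & p.1 != p.2]]] `<=` Lambda].

Definition spans_space : Prop :=
  (<<[seq l k | k <- enum (sidx d1)]>>%VS = fullv :> {vspace 'rV[R]_d}).

End Directions.

Section Bellman.
Context {R : realType} {d d1 : nat} {A : Type}.
Variables (l : sidx d1 -> 'rV[R]_d).
Variables (a b : A -> sidx d1 -> 'rV[R]_d -> R) (c f : A -> 'rV[R]_d -> R).

Definition bellman (h : R) (v : 'rV[R]_d -> R) (x : 'rV[R]_d) : R :=
  sup [set \sum_(k : sidx d1) a alpha k x * fdiff2 h (l k) v x
           + \sum_(k : sidx d1) b alpha k x * fdiff h (l k) v x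
           - c alpha x * v x + f alpha x
        | alpha in [set: A]].

Definition inner_domain (Omega : set 'rV[R]_d) (h : R) : set 'rV[R]_d :=
  [set x | Omega x /\ [set x + h *: y | y in unit_ball] `<=` Omega].

Definition bounded_borel_solution (Omega : set 'rV[R]_d)
    (g : 'rV[R]_d -> R) (h : R) (v : 'rV[R]_d -> R) : Prop :=
  [/\ bounded_on_space v, borel_fun v,
      forall x, inner_domain Omega h x -> bellman h v x = 0 &
      forall x, ~ inner_domain Omega h x -> v x = g x].

End Bellman.

(* Main.v *)
(** Everything rests on the maximum principle for the monotone form of the scheme (an
    intensity-weighted sum of the differences [u (x + h l_k) - u x]), applied at
    approximate maxima over the whole space. If [alpha] is nearly optimal at [x0], the
    linear expression [L^alpha v - c v + f] is nonpositive throughout the interior and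
    nearly [0] at [x0], so its first and second difference quotients at [x0] are at
    most a small error. Hence differences of [v] are supersolutions of one linear
    operator, up to errors containing one more difference of [v].

    These errors are absorbed by Bernstein's method. Let [m] be the supremum of [- u_k]
    over [k] and [x], for the differences [u_k] under study, and let [w_j] be quantities
    already bounded. At a near maximum of
    [- u_k0 / m + eps sum_k (T - u_k / m)^2 + kap sum_j (N - w_j)^2], with [eps] small
    and [kap] of order [m^-2], the generator of the first square produces all the
    differences of [u_k / m] squared, which absorb the errors, and that of the second
    one produces the differences of [w_j] squared, large because [u_k0] is of size [m].
    This bounds [m]. It is used with [u_k] the first differences and [w] the solution,
    then with [u_k] the pure second differences times a quadratic cutoff on a ball and
    [w_j] the first differences; since [a_k >= delta], the equation turns lower bounds
    of the pure second differences into upper bounds. Polarization gives the mixed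
    second differences. Near the boundary, concave functions of [psi] are barriers;
    existence follows by monotone iteration and uniqueness by comparison. *)
Require Import Defs.
From HB Require Import structures.
From mathcomp Require Import all_boot all_order all_algebra.
From mathcomp Require Import all_classical all_reals all_analysis.
From mathcomp Require Import measurable_realfun ring lra.

Set Implicit Arguments.
Unset Strict Implicit.
Unset Printing Implicit Defensive.

Import Order.TTheory GRing.Theory Num.Theory.
Import numFieldNormedType.Exports.

Local Open Scope classical_set_scope.
Local Open Scope ring_scope.

(** * The Euclidean norm *)

(** The supremum over [A] need not be attained, and a merely Borel function need not have maximum
    points, so both the control and the point are optimal only up to tolerances. These may depend on
    [h]: the total jump rate is of order [h ^- 2], and a tolerance of the inverse order leaves an
    error bounded by one. A single control, nearly optimal at [x0], serves all directions at once;
    this is what lets one generator act on a whole sum of squares.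

    The errors to be absorbed have no small factor and are one order higher than the function
    estimated, so no direct use of the maximum principle closes. The suprema concerned are finite
    beforehand, with bounds that blow up as [h] tends to [0]; this is enough to speak of [m], and a
    value of [m] beyond a threshold free of [h] turns out to be smaller than itself. *)

Section EuclideanNorm.
Context {R : realType} {d : nat}.
Local Notation V := 'rV[R]_d.
Implicit Types (x y z : V).

Definition dotr x y : R := \sum_(i < d) x 0 i * y 0 i.

Lemma dotrC x y : dotr x y = dotr y x.
Proof. by apply: eq_bigr => i _; rewrite mulrC. Qed.

Lemma dotrDl x y z : dotr (x + y) z = dotr x z + dotr y z.
Proof. by rewrite -big_split/=; apply: eq_bigr => i _; rewrite mxE mulrDl. Qed.

Lemma dotrZl (t : R) x y : dotr (t *: x) y = t * dotr x y.
Proof. by rewrite mulr_sumr; apply: eq_bigr => i _; rewrite mxE mulrA. Qed.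

Lemma dotrBl x y z : dotr (x - y) z = dotr x z - dotr y z.
Proof. by rewrite dotrDl -scaleN1r dotrZl mulN1r. Qed.

Lemma dotr_ge0 x : 0 <= dotr x x.
Proof. by apply: sumr_ge0 => i _; rewrite -expr2 sqr_ge0. Qed.

Lemma enormE x : enorm x = Num.sqrt (dotr x x).
Proof. by congr Num.sqrt; apply: eq_bigr => i _; rewrite expr2. Qed.

Lemma enorm_ge0 x : 0 <= enorm x. Proof. exact: sqrtr_ge0. Qed.

Lemma sqr_enorm x : enorm x ^+ 2 = dotr x x.
Proof. by rewrite enormE sqr_sqrtr ?dotr_ge0. Qed.

Lemma enormZ (t : R) x : enorm (t *: x) = `|t| * enorm x.
Proof.
rewrite !enormE dotrZl dotrC dotrZl mulrA -expr2 sqrtrM ?sqr_ge0//.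
by rewrite sqrtr_sqr.
Qed.

Lemma enormN x : enorm (- x) = enorm x.
Proof. by rewrite -scaleN1r enormZ normrN1 mul1r. Qed.

Lemma enormB x y : enorm (x - y) = enorm (y - x).
Proof. by rewrite -enormN opprB. Qed.

Lemma enorm0 : enorm (0 : V) = 0.
Proof. by rewrite -(scale0r (0 : V)) enormZ normr0 mul0r. Qed.

Lemma sqr_enormD x y :
  enorm (x + y) ^+ 2 = enorm x ^+ 2 + 2 * dotr x y + enorm y ^+ 2.
Proof.
rewrite !sqr_enorm dotrDl ![dotr _ (x + y)]dotrC !dotrDl [dotr y x]dotrC; ring.
Qed.

Lemma dotr_le x y : `|dotr x y| <= enorm x * enorm y.
Proof.
have key (u v : V) : dotr u v <= enorm u * enorm v.
  have [/eqP|u0] := eqVneq (enorm u) 0.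
    rewrite enormE sqrtr_eq0 => du.
    have u0 i : u 0 i = 0.
      have /eqP : dotr u u = 0 by apply/le_anti; rewrite du dotr_ge0.
      rewrite psumr_eq0 => [/allP/(_ i)|j _]; last by rewrite -expr2 sqr_ge0.
      by rewrite mem_index_enum -expr2 sqrf_eq0 => /(_ isT)/eqP.
    rewrite /dotr big1 ?mulr_ge0 ?enorm_ge0// => i _.
    by rewrite u0 mul0r.
  have [/eqP|v0] := eqVneq (enorm v) 0.
    rewrite enormE sqrtr_eq0 => dv.
    have v0 i : v 0 i = 0.
      have /eqP : dotr v v = 0 by apply/le_anti; rewrite dv dotr_ge0.
      rewrite psumr_eq0 => [/allP/(_ i)|j _]; last by rewrite -expr2 sqr_ge0.
      by rewrite mem_index_enum -expr2 sqrf_eq0 => /(_ isT)/eqP.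
    rewrite /dotr big1 ?mulr_ge0 ?enorm_ge0// => i _.
    by rewrite v0 mulr0.
  have up : 0 < enorm u by rewrite lt0r u0 enorm_ge0.
  have vp : 0 < enorm v by rewrite lt0r v0 enorm_ge0.
  have := sqr_ge0 (enorm (enorm v *: u - enorm u *: v)).
  rewrite sqr_enormD enormN !enormZ !ger0_norm ?enorm_ge0//.
  rewrite -scaleNr dotrZl dotrC dotrZl [dotr v u]dotrC.
  have -> : (enorm v * enorm u) ^+ 2 + 2 * (enorm v * (- enorm u * dotr u v)) +
    (enorm u * enorm v) ^+ 2 =
     (enorm u * enorm v) * (2 * (enorm u * enorm v - dotr u v)) by ring.
  by rewrite pmulr_rge0 ?mulr_gt0// pmulr_rge0// subr_ge0.
rewrite ler_norml key andbT lerNl -mulN1r -dotrZl scaleN1r.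
by rewrite (le_trans (key _ _))// enormN.
Qed.

Lemma ler_enormD x y : enorm (x + y) <= enorm x + enorm y.
Proof.
rewrite -(@ler_pXn2r _ 2) ?nnegrE ?addr_ge0 ?enorm_ge0//.
have := dotr_le x y; rewrite sqr_enormD ler_norml => /andP[_ h].
by rewrite sqrrD -mulr_natl; lra.
Qed.

Lemma ler_enorm_distD y x z : enorm (x - z) <= enorm (x - y) + enorm (y - z).
Proof. by rewrite (le_trans _ (ler_enormD _ _))// addrA subrK. Qed.

Lemma coord_le_enorm x i : `|x 0 i| <= enorm x.
Proof.
rewrite -sqrtr_sqr ler_wsqrtr// (bigD1 i)//= lerDl sumr_ge0// => j _.
exact: sqr_ge0.
Qed.

Lemma enorm_le_sum x : enorm x <= \sum_i `|x 0 i|.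
Proof.
suff [le ge0] : \sum_(i < d) x 0 i ^+ 2 <= (\sum_i `|x 0 i|) ^+ 2 /\
    0 <= \sum_i `|x 0 i|.
  by rewrite -[leRHS]ger0_norm// -sqrtr_sqr ler_wsqrtr.
apply: (big_ind2 (fun s t : R => s <= t ^+ 2 /\ 0 <= t)).
- by rewrite expr0n.
- by move=> s t s' t' [? ?] [? ?]; split; nra.
- by move=> i _; rewrite real_normK ?num_real.
Qed.

Lemma coord_le_mx x i : `|x 0 i| <= `|x|.
Proof.
rewrite [leRHS]mx_normrE.
exact: (le_bigmax _ (fun ij : 'I_1 * 'I_d => `|x ij.1 ij.2|) (0, i)).
Qed.

Lemma enorm_le_mx x : enorm x <= d%:R * `|x|.
Proof.
apply: (le_trans (enorm_le_sum x)).
have -> : d%:R * `|x| = \sum_(i < d) `|x|.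
  by rewrite sumr_const card_ord mulr_natl.
by apply: ler_sum => i _; exact: coord_le_mx.
Qed.

Lemma mx_le_enorm x : `|x| <= enorm x.
Proof.
rewrite [leLHS]mx_normrE; apply: bigmax_le; first exact: enorm_ge0.
by move=> [j i] _ /=; rewrite ord1 coord_le_enorm.
Qed.

End EuclideanNorm.

(** * Finite sums, Young's inequality and approximate suprema *)

Lemma ler_norm_sumr {R : realType} {I : finType} (F : I -> R) i :
  `|F i| <= \sum_j `|F j|.
Proof.
by rewrite (bigD1 i)//= lerDl sumr_ge0// => j _; exact: normr_ge0.
Qed.

Lemma ler_sum_term {R : realType} {I : finType} (F : I -> R) i :
  (forall j, 0 <= F j) -> F i <= \sum_j F j.
Proof. by move=> F0; rewrite (bigD1 i)//= lerDl sumr_ge0. Qed.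

Lemma sumr_constE {R : realType} {I : finType} (x : R) :
  \sum_(i : I) x = #|I|%:R * x.
Proof. by rewrite sumr_const mulr_natl. Qed.

Lemma ler_sum_const {R : realType} {I : finType} (F : I -> R) (C : R) :
  (forall i, F i <= C) -> \sum_i F i <= #|I|%:R * C.
Proof. by move=> FC; rewrite -sumr_constE; apply: ler_sum => i _. Qed.

Lemma young_sum {R : realType} {I : finType} (C e : R) (F : I -> R) : 0 < e ->
  C * \sum_i `|F i| <= e * \sum_i F i ^+ 2 + #|I|%:R * C ^+ 2 / (4 * e).
Proof.
move=> e0.
have -> : #|I|%:R * C ^+ 2 / (4 * e) = \sum_(i : I) C ^+ 2 / (4 * e).
  by rewrite sumr_constE mulrA.
rewrite !mulr_sumr -big_split/=; apply: ler_sum => i _.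
have -> : F i ^+ 2 = `|F i| ^+ 2 by rewrite real_normK ?num_real.
rewrite -subr_ge0.
have -> : e * `|F i| ^+ 2 + C ^+ 2 / (4 * e) - C * `|F i| =
   (e * `|F i| - C / 2) ^+ 2 / e by field; rewrite gt_eqF.
by rewrite divr_ge0 ?sqr_ge0// ltW.
Qed.

Lemma young_sum2 {R : realType} {I J : finType} (C e : R) (F : I -> J -> R) :
  0 < e -> C * \sum_i \sum_j `|F i j| <=
  e * \sum_i \sum_j F i j ^+ 2 + #|{: I * J}|%:R * C ^+ 2 / (4 * e).
Proof.
move=> /(young_sum C (fun p : I * J => F p.1 p.2)).
by rewrite -(pair_bigA _ (fun i j => `|F i j|)) -(pair_bigA _ (fun i j => F i j ^+ 2)).
Qed.

Lemma approx_max {R : realType} {T : Type} (W : T -> R) (M eta : R) (x : T) :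
  (forall y, W y <= M) -> 0 < eta -> exists x0, forall y, W y <= W x0 + eta.
Proof.
move=> WM eta0; pose S := range W.
have supS : has_sup S by split; [exists (W x), x | exists M => _ [y _ <-]].
have [_ [x0 _ <-] hx0] := sup_adherent eta0 supS.
exists x0 => y; have : W y <= sup S by apply: (ub_le_sup supS.2); exists y.
lra.
Qed.

(** Applied to [m = sup F], the hypothesis makes the supremum at most [7 / 8] of itself. The bound
    [B] only makes the supremum finite and leaves no trace in [M0], so it may depend on [h]. *)
Lemma bound_of_shrink {R : realType} {T : Type} (F : T -> R) (B M0 : R) :
  0 < M0 -> (forall y, F y <= B) ->
  (forall m, M0 <= m -> (forall y, F y <= m) -> forall y, F y <= 7 / 8 * m) ->
  forall y, F y <= M0.
Proof.
move=> M00 FB shrink y; rewrite leNgt; apply/negP => yM0.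
pose S := range F.
have supS : has_sup S by split; [exists (F y), y | exists B => _ [z _ <-]].
have Fs z : F z <= sup S by apply: (ub_le_sup supS.2); exists z.
have M0s : M0 <= sup S by rewrite (le_trans (ltW yM0)).
have : sup S <= 7 / 8 * sup S.
  apply: ge_sup; first by exists (F y), y.
  by move=> _ [z _ <-]; apply: shrink.
lra.
Qed.

(** * Finite differences *)

Section FiniteDifferences.
Context {R : realType} {d : nat}.
Local Notation V := 'rV[R]_d.
Implicit Types (h : R) (xi eta x : V) (u v : V -> R).

Lemma fdiff_fdiff h xi eta u x :
  fdiff h xi (fdiff h eta u) x = fdiff h eta (fdiff h xi u) x.
Proof.
rewrite /fdiff /shiftT [x + h *: xi + _]addrAC.
ring.
Qed.

Lemma fdiff2E h xi u x : h != 0 ->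
  fdiff2 h xi u x = (fdiff h xi u x + fdiff h (- xi) u x) / h.
Proof. by move=> h0; rewrite /fdiff2 /fdiff; field. Qed.

(** A pure second difference is one of the iterated first differences, so squares of differences of
    [fdiff h (l j) v] control it. *)
Lemma fdiff2_mixed h xi u x : h != 0 ->
  fdiff2 h xi u x = - fdiff h (- xi) (fdiff h xi u) x.
Proof.
by move=> h0; rewrite /fdiff2 /fdiff /shiftT scalerN subrK; field.
Qed.

(** Over a symmetric set of directions, this turns a one-sided bound at all points into a two-sided
    one. *)
Lemma fdiffN h xi u x : fdiff h (- xi) u (x + h *: xi) = - fdiff h xi u x.
Proof. by rewrite /fdiff /shiftT scalerN addrK -mulNr opprB. Qed.

Lemma fdiff_fdiff2 h xi eta u x :
  fdiff h xi (fdiff2 h eta u) x = fdiff2 h eta (fdiff h xi u) x.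
Proof.
rewrite /fdiff2 /fdiff /shiftT ![x + h *: xi + _]addrAC; ring.
Qed.

Lemma fdiff2_fdiff2 h xi eta u x :
  fdiff2 h xi (fdiff2 h eta u) x = fdiff2 h eta (fdiff2 h xi u) x.
Proof.
rewrite /fdiff2 /shiftT.
rewrite ![x + h *: xi + _]addrAC ![x + h *: - xi + _]addrAC; ring.
Qed.

Lemma shift_fdiff h xi u x : h != 0 -> u (x + h *: xi) = u x + h * fdiff h xi u x.
Proof. by move=> h0; rewrite /fdiff /shiftT; field. Qed.

Lemma fdiff2M h xi u v x : h != 0 ->
  fdiff2 h xi (fun z => u z * v z) x = u x * fdiff2 h xi v x
   + fdiff h xi u x * fdiff h xi v x + fdiff h (- xi) u x * fdiff h (- xi) v x
   + fdiff2 h xi u x * v x.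
Proof. by move=> h0; rewrite /fdiff2 /fdiff /shiftT; field. Qed.

Lemma fdiffM h xi u v x : h != 0 ->
  fdiff h xi (fun z => u z * v z) x =
   u (x + h *: xi) * fdiff h xi v x + fdiff h xi u x * v x.
Proof. by move=> h0; rewrite /fdiff /shiftT; field. Qed.

End FiniteDifferences.

(** * The maximum principle for jump generators *)

Section Generator.
Context {R : realType} {d : nat} {I : finType}.
Local Notation V := 'rV[R]_d.
Variables (h : R) (l : I -> V) (q : I -> R).
Implicit Types (u : V -> R) (x : V).

(** Generator of a jump process with intensities [q k]. These are numbers: the coefficients are
    evaluated at one point before the generator is formed, so it has constant coefficients. *)
Definition gen u x : R := \sum_k q k * (u (x + h *: l k) - u x).

Lemma gen_le u x eta : (forall k, 0 <= q k) ->
  (forall y, u y <= u x + eta) -> gen u x <= eta * \sum_k q k.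
Proof.
move=> q0 ux; rewrite mulr_sumr; apply: ler_sum => k _.
by rewrite [leRHS]mulrC ler_wpM2l// lerBlDl.
Qed.

Lemma genD u w x : gen (fun y => u y + w y) x = gen u x + gen w x.
Proof. by rewrite /gen -big_split/=; apply: eq_bigr => k _; ring. Qed.

Lemma genZ t u x : gen (fun y => t * u y) x = t * gen u x.
Proof. by rewrite /gen mulr_sumr; apply: eq_bigr => k _; ring. Qed.

Lemma gen_sum (J : finType) (u : J -> V -> R) x :
  gen (fun y => \sum_j u j y) x = \sum_j gen (u j) x.
Proof.
rewrite /gen exchange_big/=; apply: eq_bigr => k _.
by rewrite -sumrB mulr_sumr.
Qed.

(** Chain rule for a square; the last sum is the source of the good quadratic terms in Bernstein's
    method. *)
Lemma gen_sqr T u x : gen (fun y => (T - u y) ^+ 2) x =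
  - 2 * (T - u x) * gen u x + \sum_k q k * (u (x + h *: l k) - u x) ^+ 2.
Proof.
by rewrite /gen mulr_sumr -big_split/=; apply: eq_bigr => k _; ring.
Qed.

Lemma gen_sqr_ge delta T u x : h != 0 -> (forall k, delta / h ^+ 2 <= q k) ->
  - 2 * (T - u x) * gen u x + delta * \sum_k fdiff h (l k) u x ^+ 2 <=
  gen (fun y => (T - u y) ^+ 2) x.
Proof.
move=> h0 hq; rewrite gen_sqr lerD2l mulr_sumr; apply: ler_sum => k _.
rewrite /fdiff /shiftT expr_div_n mulrCA mulrC; apply: ler_wpM2r.
  exact: sqr_ge0.
exact: hq.
Qed.

(* The squares are decreasing and uniformly convex in the [u j] and [w j], so upper
   bounds on the generator of those functions suffice at a near maximum of the sum. *)
Lemma bernstein (J K : finType) delta (u0 : V -> R) (u : J -> V -> R)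
    (w : K -> V -> R) (m T N eps kap e0 eu ew eta : R) x :
  h != 0 -> 0 <= delta -> (forall k, delta / h ^+ 2 <= q k) ->
  0 < m -> 0 <= eps -> 0 <= kap -> 0 <= eu -> 0 <= ew ->
  (forall y, - u0 y / m + eps * (\sum_j (T - u j y / m) ^+ 2)
               + kap * (\sum_j (N - w j y) ^+ 2)
    <= - u0 x / m + eps * (\sum_j (T - u j x / m) ^+ 2)
               + kap * (\sum_j (N - w j x) ^+ 2) + eta) ->
  gen u0 x <= e0 -> (forall j, gen (u j) x <= eu) ->
  (forall j, gen (w j) x <= ew) ->
  (forall j, - m <= u j x <= T * m) -> (forall j, `|w j x| <= N) ->
  eps * (delta * \sum_j \sum_k (fdiff h (l k) (u j) x / m) ^+ 2)
   + kap * (delta * \sum_j \sum_k fdiff h (l k) (w j) x ^+ 2)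
  <= e0 / m + 2 * eps * (T + 1) * #|J|%:R * (eu / m)
     + 4 * kap * N * #|K|%:R * ew + eta * \sum_k q k.
Proof.
move=> h0 delta0 hq m0 eps0 kap0 eu0 ew0 Wle Lu0 Lu Lw ub wb.
have q0 k : 0 <= q k.
  by rewrite (le_trans _ (hq k))// divr_ge0// sqr_ge0.
have := gen_le q0 Wle.
have -> : gen (fun y => - u0 y / m + eps * (\sum_j (T - u j y / m) ^+ 2)
               + kap * (\sum_j (N - w j y) ^+ 2)) x =
  - (gen u0 x / m) + eps * \sum_j gen (fun y => (T - u j y / m) ^+ 2) x +
   kap * \sum_j gen (fun y => (N - w j y) ^+ 2) x.
  rewrite !genD !genZ !gen_sum; congr (_ + _ + _).
  by rewrite /gen mulr_suml -sumrN; apply: eq_bigr => k _; ring.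
have eu_m : 0 <= eu / m by rewrite divr_ge0// ltW.
have A1 : - (e0 / m) <= - (gen u0 x / m).
  by rewrite lerN2 ler_pM2r// invr_gt0.
have A2 : - (2 * (T + 1) * #|J|%:R * (eu / m)) +
     delta * (\sum_j \sum_k (fdiff h (l k) (u j) x / m) ^+ 2) <=
     \sum_j gen (fun y => (T - u j y / m) ^+ 2) x.
  have -> : - (2 * (T + 1) * #|J|%:R * (eu / m)) =
    \sum_(j : J) - (2 * (T + 1) * (eu / m)).
    by rewrite sumr_constE; ring.
  rewrite mulr_sumr -big_split/=; apply: ler_sum => j _.
  apply: le_trans (gen_sqr_ge T (fun y => u j y / m) x h0 hq).
  apply: lerD; last first.
    rewrite ler_wpM2l//; apply: ler_sum => k _.
    by rewrite /fdiff /shiftT -mulrBl [_ / m / h]mulrAC.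
  have /andP[u1 u2] := ub j.
  have := Lu j => Luj.
  have -> : gen (fun y => u j y / m) x = gen (u j) x / m.
    rewrite [RHS]mulrC -genZ; congr gen; apply/funext => y; exact: mulrC.
  have t0 : 0 <= T - u j x / m.
    by rewrite subr_ge0 ler_pdivrMr.
  have t1 : T - u j x / m <= T + 1.
    by rewrite lerD2l lerNl ler_pdivlMr// mulN1r.
  have g1 : gen (u j) x / m <= eu / m by rewrite ler_pM2r// invr_gt0.
  have h1 : (T - u j x / m) * (gen (u j) x / m) <=
            (T - u j x / m) * (eu / m) by rewrite ler_wpM2l.
  have h2 : (T - u j x / m) * (eu / m) <= (T + 1) * (eu / m).
    by rewrite ler_wpM2r.
  by move: h1 h2; rewrite -!mulrA; lra.
have A3 : - (4 * N * #|K|%:R * ew) +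
     delta * (\sum_j \sum_k fdiff h (l k) (w j) x ^+ 2) <=
     \sum_j gen (fun y => (N - w j y) ^+ 2) x.
  have -> : - (4 * N * #|K|%:R * ew) = \sum_(j : K) - (4 * N * ew).
    by rewrite sumr_constE; ring.
  rewrite mulr_sumr -big_split/=; apply: ler_sum => j _.
  apply: le_trans (gen_sqr_ge N (w j) x h0 hq).
  rewrite lerD2r.
  have := wb j; rewrite ler_norml => /andP[u1 u2].
  have t0 : 0 <= N - w j x by lra.
  have h1 : (N - w j x) * gen (w j) x <= (N - w j x) * ew by rewrite ler_wpM2l.
  have h2 : (N - w j x) * ew <= (2 * N) * ew by rewrite ler_wpM2r//; lra.
  by move: h1 h2; rewrite -!mulrA; lra.
have {}A2 := ler_wpM2l eps0 A2.
have {}A3 := ler_wpM2l kap0 A3.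
by move: A1 A2 A3; rewrite !mulrDr !mulrN !mulrA; lra.
Qed.

End Generator.

(** * A quadratic cutoff *)

Section Cutoff.
Context {R : realType} {d : nat}.
Local Notation V := 'rV[R]_d.
Implicit Types (h r : R) (x y xi : V).

(** Scaled so that the value at the centre is [r] while the slope is at most [2] whatever [r]. *)
Definition cutoff y r x : R := Num.max 0 (r - enorm (x - y) ^+ 2 / r).

Lemma cutoff_ge0 y r x : 0 <= cutoff y r x.
Proof. by rewrite /cutoff le_max lexx. Qed.

Lemma cutoff_le y r x : 0 < r -> cutoff y r x <= r.
Proof.
move=> r0; rewrite /cutoff ge_max ltW//= gerBl divr_ge0 ?sqr_ge0//.
exact: ltW.
Qed.

Lemma cutoff_center y r : 0 < r -> cutoff y r y = r.
Proof.
by move=> r0; rewrite /cutoff subrr enorm0 expr0n mul0r subr0 max_r// ltW.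
Qed.

Lemma cutoff_gt0 y r x : 0 < r -> 0 < cutoff y r x ->
  enorm (x - y) < r /\ cutoff y r x = r - enorm (x - y) ^+ 2 / r.
Proof.
move=> r0; rewrite /cutoff.
have [le|lt] := leP 0 (r - enorm (x - y) ^+ 2 / r); last by rewrite ltxx.
move=> gt; split=> //; have := gt; rewrite subr_gt0 ltr_pdivrMr// -expr2.
by rewrite ltr_pXn2r ?nnegrE ?enorm_ge0// ltW.
Qed.

(** One step lowers the quadratic by at most [3 * h], hence by at most half of its value here. The
    truncation at [0] is inactive at both ends and the difference is that of a polynomial. *)
Lemma cutoff_shift y r h xi x : 0 < r -> 0 < h -> enorm xi <= 1 ->
  6 * h <= cutoff y r x ->
  [/\ cutoff y r x / 2 <= cutoff y r (x + h *: xi),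
      `|fdiff h xi (cutoff y r) x| <= 3 &
      fdiff h xi (cutoff y r) x =
        - (2 * dotr (x - y) xi + h * enorm xi ^+ 2) / r].
Proof.
move=> r0 h0 xi1 hx.
have cx0 : 0 < cutoff y r x by apply: lt_le_trans hx; rewrite mulr_gt0.
have [xyr cx] := cutoff_gt0 r0 cx0.
have hr : 6 * h <= r by apply: le_trans hx _; exact: cutoff_le.
pose e := (2 * dotr (x - y) xi + h * enorm xi ^+ 2) / r.
have e3 : `|e| <= 3.
  rewrite /e normrM normfV (gtr0_norm r0) ler_pdivrMr//.
  have xi2 : enorm xi ^+ 2 <= 1 by rewrite expr_le1// enorm_ge0.
  have h2 : 0 <= h * enorm xi ^+ 2 by rewrite mulr_ge0 ?sqr_ge0// ltW.
  have h3 : h * enorm xi ^+ 2 <= h by rewrite ler_piMr// ltW.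
  have dle : `|dotr (x - y) xi| <= r.
    apply: le_trans (dotr_le _ _) _; rewrite -[leRHS]mulr1.
    by rewrite ler_pM ?enorm_ge0// ltW.
  move: dle => /ler_normlP[d1 d2]; apply/ler_normlP; split; lra.
have pE : r - enorm (x + h *: xi - y) ^+ 2 / r = cutoff y r x - h * e.
  rewrite cx /e [x + h *: xi - y]addrAC (sqr_enormD (x - y)) enormZ exprMn real_normK ?num_real//.
  rewrite [dotr _ (h *: xi)]dotrC dotrZl [dotr xi _]dotrC; field.
  by rewrite gt_eqF.
have he : h * e <= 3 * h.
  by rewrite mulrC ler_pM2r// (le_trans (ler_norm _)).
have he2 : cutoff y r x / 2 <= cutoff y r x - h * e by lra.
have cE : cutoff y r (x + h *: xi) = cutoff y r x - h * e.
  by rewrite {1}/cutoff pE max_r//; lra.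
have fE : fdiff h xi (cutoff y r) x = - e.
  by rewrite /fdiff /shiftT cE; field; rewrite gt_eqF.
by split; rewrite ?cE// fE ?normrN// /e mulNr.
Qed.

(** The linear terms cancel. The bound is weaker than [2 / r], but it is expressed by the cutoff
    itself, the scale on which all errors of [second_diff_bound] are measured. *)
Lemma cutoff_fdiff2 y r h xi x : 0 < r -> 0 < h -> enorm xi <= 1 ->
  6 * h <= cutoff y r x ->
  `|fdiff2 h xi (cutoff y r) x| <= 2 / cutoff y r x.
Proof.
move=> r0 h0 xi1 hx.
have cx0 : 0 < cutoff y r x by apply: lt_le_trans hx; rewrite mulr_gt0.
have [_ _ e1] := cutoff_shift r0 h0 xi1 hx.
have xi1' : enorm (- xi) <= 1 by rewrite enormN.
have [_ _ e2] := cutoff_shift r0 h0 xi1' hx.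
rewrite fdiff2E ?gt_eqF// e1 e2 enormN dotrC -(scaleN1r xi) [dotr _ (-1 *: _)]dotrC.
rewrite dotrZl.
have -> : (- (2 * dotr xi (x - y) + h * enorm xi ^+ 2) / r +
  - (2 * (-1 * dotr xi (x - y)) + h * enorm xi ^+ 2) / r) / h =
   - (2 * enorm xi ^+ 2 / r) by field; rewrite !gt_eqF.
rewrite normrN ger0_norm; last first.
  by apply: divr_ge0; [rewrite mulr_ge0 ?sqr_ge0 | exact: ltW].
have xi2 : enorm xi ^+ 2 <= 1 by rewrite expr_le1// enorm_ge0.
apply: (@le_trans _ _ (2 / r)).
  by rewrite ler_pM2r ?invr_gt0// -[leRHS]mulr1 ler_pM2l.
by rewrite ler_pM2l// lef_pV2 ?posrE// cutoff_le.
Qed.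

End Cutoff.

Lemma genM {R : realType} {d : nat} {I : finType} (h : R) (l : I -> 'rV[R]_d)
    (q : I -> R) (u w : 'rV[R]_d -> R) x : h != 0 ->
  gen h l q (fun y => u y * w y) x = u x * gen h l q w x + w x * gen h l q u x
   + \sum_k q k * h ^+ 2 * (fdiff h (l k) u x * fdiff h (l k) w x).
Proof.
move=> h0; rewrite /gen !mulr_sumr -!big_split/=; apply: eq_bigr => k _.
by rewrite /fdiff /shiftT; field.
Qed.

(** What the estimates use of a [C^{1,1}] bound, in a form free of derivatives. *)
Definition smooth_bound {R : realType} {d : nat} (K : R) (phi : 'rV[R]_d -> R) :=
  [/\ forall x, `|phi x| <= K,
      forall x y, `|phi x - phi y| <= K * enorm (x - y) &
      forall h xi x, 0 < h -> `|fdiff2 h xi phi x| <= K * enorm xi ^+ 2].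

Section SumM.
Context {R : realType} {d : nat} {I : finType}.
Local Notation V := 'rV[R]_d.
Implicit Types (h : R) (xi x : V) (p w : I -> V -> R).

Lemma fdiff_sumM h xi p w x : h != 0 ->
  fdiff h xi (fun y => \sum_k p k y * w k y) x =
  \sum_k p k (x + h *: xi) * fdiff h xi (w k) x
  + \sum_k fdiff h xi (p k) x * w k x.
Proof.
move=> h0; rewrite -big_split/= {1}/fdiff /shiftT -sumrB mulr_suml.
by apply: eq_bigr => k _; rewrite -fdiffM.
Qed.

Lemma fdiff2_sumM h xi p w x : h != 0 ->
  fdiff2 h xi (fun y => \sum_k p k y * w k y) x =
  \sum_k p k x * fdiff2 h xi (w k) x
  + \sum_k fdiff h xi (p k) x * fdiff h xi (w k) x
  + \sum_k fdiff h (- xi) (p k) x * fdiff h (- xi) (w k) x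
  + \sum_k fdiff2 h xi (p k) x * w k x.
Proof.
move=> h0; rewrite -!big_split/= {1}/fdiff2 /shiftT.
rewrite mulr_sumr -sumrB -big_split/= mulr_suml.
by apply: eq_bigr => k _; rewrite -fdiff2M.
Qed.

Lemma ler_sumM (C : R) (p w : I -> R) : (forall k, `|p k| <= C) ->
  `|\sum_k p k * w k| <= C * \sum_k `|w k|.
Proof.
move=> pC; rewrite (le_trans (ler_norm_sum _ _ _))// mulr_sumr.
by apply: ler_sum => k _; rewrite normrM ler_wpM2r.
Qed.

End SumM.

(** * A priori estimates for differences of solutions *)

Section Scheme.
Context {R : realType} {d : nat} {I : finType} {A : Type}.
Local Notation V := 'rV[R]_d.
Variables (l : I -> V) (o : I -> I).
Variables (a b : A -> I -> V -> R) (c f : A -> V -> R) (delta K : R).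
Hypotheses (oK : involutive o) (l_o : forall k, l (o k) = - l k)
  (l_le1 : forall k, enorm (l k) <= 1)
  (a_o : forall al k x, a al (o k) x = a al k x)
  (delta_gt0 : 0 < delta) (K_gt0 : 0 < K)
  (a_ge : forall al k x, delta <= a al k x)
  (c_ge : forall al x, delta <= c al x)
  (a_smooth : forall al k, smooth_bound K (a al k))
  (b_smooth : forall al k, smooth_bound K (b al k))
  (c_smooth : forall al, smooth_bound K (c al))
  (f_smooth : forall al, smooth_bound K (f al)).
Ltac linear := clear - oK l_o l_le1 a_o delta_gt0 K_gt0 a_ge c_ge
  a_smooth b_smooth c_smooth f_smooth; lra.
Ltac nonlinear := clear - oK l_o l_le1 a_o delta_gt0 K_gt0 a_ge c_ge
  a_smooth b_smooth c_smooth f_smooth; nra.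

Implicit Types (h : R) (al : A) (u v w : V -> R) (x y z xi : V).

(** Coefficients are read at [z], differences at [x]: inequalities for differences of [v] along
    several directions come with operators read at different points and must be brought to a common
    [z]. *)
Definition frozen h al z u x : R :=
  \sum_k a al k z * fdiff2 h (l k) u x + \sum_k b al k z * fdiff h (l k) u x.

Definition res h al u x : R := frozen h al x u x - c al x * u x + f al x.

(** Intensity of the jump along [l k]; pairing [k] with [o k] in the second differences doubles the
    [a] term. *)
Definition rate h al z k : R := 2 * a al k z / h ^+ 2 + b al k z / h.

Lemma frozen_gen h al z u x : h != 0 ->
  frozen h al z u x = gen h l (rate h al z) u x.
Proof.
move=> h0; rewrite /frozen /gen.
have -> : \sum_k a al k z * fdiff2 h (l k) u x =
  \sum_k a al k z * ((u (x + h *: l k) - u x) / h ^+ 2) +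
  \sum_k a al k z * ((u (x + h *: - l k) - u x) / h ^+ 2).
  rewrite -big_split/=; apply: eq_bigr => k _.
  by rewrite /fdiff2 /shiftT -mulrDr -mulrDl; congr (_ * (_ / _)); ring.
rewrite [X in _ + X + _ = _](reindex_inj (inv_inj oK))/= -!big_split/=.
apply: eq_bigr => k _.
by rewrite l_o opprK a_o /rate /fdiff /shiftT; field.
Qed.

(** Monotonicity of the scheme: for [K * h <= delta] the drift uses up at most half of the diffusion
    [2 * a]. *)
Lemma rate_ge h al z k : 0 < h -> K * h <= delta ->
  delta / h ^+ 2 <= rate h al z k.
Proof.
move=> h0 Kh; have [/(_ z)] := b_smooth al k; rewrite ler_norml => /andP[bK _] _ _.
have -> : rate h al z k = (2 * a al k z + b al k z * h) / h ^+ 2.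
  by rewrite /rate; field; rewrite gt_eqF.
rewrite ler_pM2r ?invr_gt0 ?exprn_gt0//.
have := a_ge al k z.
have : - K * h <= b al k z * h by rewrite ler_pM2r.
lra.
Qed.

Lemma rate_ge0 h al z k : 0 < h -> K * h <= delta -> 0 <= rate h al z k.
Proof.
move=> h0 Kh; apply: le_trans (rate_ge _ _ _ h0 Kh).
by rewrite divr_ge0 ?sqr_ge0// ltW.
Qed.

Lemma rate_le h al z k : 0 < h <= 1 -> rate h al z k <= 3 * K / h ^+ 2.
Proof.
move=> /andP[h0 h1].
have [/(_ z)] := b_smooth al k; rewrite ler_norml => /andP[_ bK] _ _.
have [/(_ z)] := a_smooth al k; rewrite ler_norml => /andP[_ aK] _ _.
have -> : rate h al z k = (2 * a al k z + b al k z * h) / h ^+ 2.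
  by rewrite /rate; field; rewrite gt_eqF.
rewrite ler_pM2r ?invr_gt0 ?exprn_gt0//.
have : b al k z * h <= K * h by rewrite ler_pM2r.
have : K * h <= K * 1 by rewrite ler_pM2l.
lra.
Qed.

Lemma fdiff_le h xi x (phi : V -> R) : 0 < h -> smooth_bound K phi ->
  `|fdiff h xi phi x| <= K * enorm xi.
Proof.
move=> h0 [_ /(_ (x + h *: xi) x) + _].
rewrite addrAC subrr add0r enormZ (gtr0_norm h0) => le.
rewrite /fdiff normrM normfV (gtr0_norm h0) ler_pdivrMr//.
by rewrite (le_trans le)// le_eqVlt; apply/orP; left; apply/eqP; ring.
Qed.

(** The product rule puts the shift on the coefficients, so the operator acting on [fdiff h xi u] is
    frozen at [x + h *: xi] rather than at [x]. *)
Lemma fdiff_res h al u x xi : h != 0 ->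
  fdiff h xi (res h al u) x = frozen h al (x + h *: xi) (fdiff h xi u) x
   + \sum_k fdiff h xi (a al k) x * fdiff2 h (l k) u x
   + \sum_k fdiff h xi (b al k) x * fdiff h (l k) u x
   - c al (x + h *: xi) * fdiff h xi u x - fdiff h xi (c al) x * u x
   + fdiff h xi (f al) x.
Proof.
move=> h0.
have -> : fdiff h xi (res h al u) x =
   fdiff h xi (fun y => \sum_k a al k y * fdiff2 h (l k) u y) x
   + fdiff h xi (fun y => \sum_k b al k y * fdiff h (l k) u y) x
   - fdiff h xi (fun y => c al y * u y) x + fdiff h xi (f al) x.
  by rewrite /fdiff /res /frozen /shiftT; field.
rewrite !fdiff_sumM// fdiffM// /frozen.
under [in RHS]eq_bigr do rewrite -fdiff_fdiff2.
under [X in _ = _ + X + _ + _ - _ - _ + _]eq_bigr do rewrite fdiff_fdiff.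
ring.
Qed.

(** Centred differences leave the operator frozen at [x] itself. The price is first differences of
    [fdiff2 h (l k) u], one order above the quantity studied. *)
Lemma fdiff2_res h al u x xi : h != 0 ->
  fdiff2 h xi (res h al u) x = frozen h al x (fdiff2 h xi u) x
   + (\sum_k fdiff h xi (a al k) x * fdiff h xi (fdiff2 h (l k) u) x
   + \sum_k fdiff h (- xi) (a al k) x * fdiff h (- xi) (fdiff2 h (l k) u) x
   + \sum_k fdiff2 h xi (a al k) x * fdiff2 h (l k) u x)
   + (\sum_k fdiff h xi (b al k) x * fdiff h xi (fdiff h (l k) u) x
   + \sum_k fdiff h (- xi) (b al k) x * fdiff h (- xi) (fdiff h (l k) u) x
   + \sum_k fdiff2 h xi (b al k) x * fdiff h (l k) u x)
   - (c al x * fdiff2 h xi u x + fdiff h xi (c al) x * fdiff h xi u x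
   + fdiff h (- xi) (c al) x * fdiff h (- xi) u x + fdiff2 h xi (c al) x * u x)
   + fdiff2 h xi (f al) x.
Proof.
move=> h0.
have -> : fdiff2 h xi (res h al u) x =
   fdiff2 h xi (fun y => \sum_k a al k y * fdiff2 h (l k) u y) x
   + fdiff2 h xi (fun y => \sum_k b al k y * fdiff h (l k) u y) x
   - fdiff2 h xi (fun y => c al y * u y) x + fdiff2 h xi (f al) x.
  by rewrite /fdiff2 /res /frozen /shiftT; field.
rewrite !fdiff2_sumM// fdiff2M// /frozen.
have -> : \sum_k a al k x * fdiff2 h (l k) (fdiff2 h xi u) x =
  \sum_k a al k x * fdiff2 h xi (fdiff2 h (l k) u) x.
  by apply: eq_bigr => k _; rewrite fdiff2_fdiff2.
have -> : \sum_k b al k x * fdiff h (l k) (fdiff2 h xi u) x =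
  \sum_k b al k x * fdiff2 h xi (fdiff h (l k) u) x.
  by apply: eq_bigr => k _; rewrite fdiff_fdiff2.
ring.
Qed.

Lemma sum_fdiff2_le h u x : 0 < h ->
  h * \sum_k `|fdiff2 h (l k) u x| <= 2 * \sum_k `|fdiff h (l k) u x|.
Proof.
move=> h0.
have -> : 2 * \sum_k `|fdiff h (l k) u x| =
  \sum_k (`|fdiff h (l k) u x| + `|fdiff h (l (o k)) u x|).
  have oI := inv_inj oK.
  rewrite [in LHS](_ : 2 * _ = \sum_k `|fdiff h (l k) u x| +
    \sum_k `|fdiff h (l k) u x|); last by ring.
  by rewrite [X in _ + X = _](reindex_inj oI)/= big_split.
rewrite mulr_sumr; apply: ler_sum => k _.
rewrite fdiff2E ?gt_eqF// normrM normfV (gtr0_norm h0) mulrC divfK ?gt_eqF// -l_o.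
exact: ler_normD.
Qed.

Lemma sum_fdiff2_le_mixed h u x : 0 < h ->
  \sum_k `|fdiff2 h (l k) u x| <=
  \sum_j \sum_k `|fdiff h (l k) (fdiff h (l j) u) x|.
Proof.
move=> h0; apply: ler_sum => j _.
rewrite fdiff2_mixed ?gt_eqF// normrN -l_o.
exact: (ler_norm_sumr (fun k => fdiff h (l k) (fdiff h (l j) u) x)).
Qed.

(** The coefficients change by a multiple of [h], and [h] times a second difference is a sum of two
    first differences. *)
Lemma frozen_shift h al z y u x s : 0 < h <= 1 -> enorm (z - y) <= h * s ->
  `|frozen h al z u x - frozen h al y u x| <=
   3 * K * s * \sum_k `|fdiff h (l k) u x|.
Proof.
move=> /andP[h0 h1] zy.
have s0 : 0 <= s by rewrite -(pmulr_rge0 _ h0) (le_trans (enorm_ge0 _) zy).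
have -> : frozen h al z u x - frozen h al y u x =
  \sum_k (a al k z - a al k y) * fdiff2 h (l k) u x +
  \sum_k (b al k z - b al k y) * fdiff h (l k) u x.
  rewrite /frozen -big_split/= -[X in _ - X]big_split/= -sumrB -big_split/=.
  by apply: eq_bigr => k _; ring.
have Kzy : K * enorm (z - y) <= K * (h * s) by rewrite ler_pM2l.
apply: le_trans (ler_normD _ _) _.
have ha : `|\sum_k (a al k z - a al k y) * fdiff2 h (l k) u x| <=
    K * (h * s) * \sum_k `|fdiff2 h (l k) u x|.
  apply: ler_sumM => k; case: (a_smooth al k) => _ /(_ z y) + _; lra.
have hb : `|\sum_k (b al k z - b al k y) * fdiff h (l k) u x| <=
    K * (h * s) * \sum_k `|fdiff h (l k) u x|.
  apply: ler_sumM => k; case: (b_smooth al k) => _ /(_ z y) + _; lra.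
have Ks : 0 <= K * s by rewrite mulr_ge0// ltW.
have h2 := ler_wpM2l Ks (sum_fdiff2_le u x h0).
have Su : 0 <= K * s * \sum_k `|fdiff h (l k) u x|.
  by rewrite mulr_ge0// sumr_ge0.
have h3 : h * (K * s * \sum_k `|fdiff h (l k) u x|) <=
   K * s * \sum_k `|fdiff h (l k) u x| by rewrite ler_piMl.
by move: ha hb h2 h3; rewrite !mulrA ![K * h * s]mulrAC -!mulrA; lra.
Qed.

(* [al] is nearly optimal at [x], so the residual almost increases to [0] there and
   its difference quotients are at most [eta / h]. The operator may be frozen at a
   third point [z], which costs first differences of the quotient only. *)
Lemma pde_first h al v x z xi eta s s' : 0 < h <= 1 ->
  res h al v (x + h *: xi) <= 0 -> - eta <= res h al v x ->
  enorm xi <= s -> enorm (z - (x + h *: xi)) <= h * s' ->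
  frozen h al z (fdiff h xi v) x <=
    eta / h + c al (x + h *: xi) * fdiff h xi v x
    + K * s * (\sum_k `|fdiff2 h (l k) v x| + \sum_k `|fdiff h (l k) v x|
               + `|v x| + 1)
    + 3 * K * s' * \sum_k `|fdiff h (l k) (fdiff h xi v) x|.
Proof.
move=> h01 r1 r0 xis zx; have /andP[h0 h1] := h01.
have Kxi : K * enorm xi <= K * s by rewrite ler_pM2l.
have dres : fdiff h xi (res h al v) x <= eta / h.
  by rewrite /fdiff /shiftT ler_pM2r ?invr_gt0//; lra.
have /ler_normlP[_ sh] := frozen_shift al (fdiff h xi v) x h01 zx.
have /ler_normlP[ha _] : `|\sum_k fdiff h xi (a al k) x * fdiff2 h (l k) v x| <=
    K * s * \sum_k `|fdiff2 h (l k) v x|.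
  by apply: ler_sumM => k; exact: le_trans (fdiff_le xi x h0 _) Kxi.
have /ler_normlP[hb _] : `|\sum_k fdiff h xi (b al k) x * fdiff h (l k) v x| <=
    K * s * \sum_k `|fdiff h (l k) v x|.
  by apply: ler_sumM => k; exact: le_trans (fdiff_le xi x h0 _) Kxi.
have /ler_normlP[_ hc] : `|fdiff h xi (c al) x * v x| <= K * s * `|v x|.
  rewrite normrM ler_wpM2r//.
  by exact: le_trans (fdiff_le xi x h0 _) Kxi.
have /ler_normlP[hf _] : `|fdiff h xi (f al) x| <= K * s.
  by exact: le_trans (fdiff_le xi x h0 _) Kxi.
have := dres; rewrite fdiff_res ?gt_eqF//.
by rewrite !mulrDr mulr1; lra.
Qed.

Lemma frozen_le h al v x N0 : res h al v x <= 0 -> `|v x| <= N0 ->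
  frozen h al x v x <= K * N0 + K.
Proof.
rewrite /res => r v0.
have [/(_ x) /ler_normlP[f1 _] _ _] := f_smooth al.
have : `|c al x * v x| <= K * N0.
  by rewrite normrM ler_pM//; case: (c_smooth al).
by move=> /ler_normlP[_ hc]; lra.
Qed.

(** The two halves of the statement that the supremum is [0]; the second carries a tolerance because
    the supremum may not be attained. *)
Definition solves h (D : set V) v :=
  (forall x, D x -> forall al, res h al v x <= 0) /\
  (forall x, D x -> forall eta, 0 < eta -> exists al, - eta <= res h al v x).

Local Notation n := (#|I|%:R : R).

Lemma sum_rate_le h al z : 0 < h <= 1 ->
  \sum_k rate h al z k <= n * (3 * K / h ^+ 2).
Proof.
by move=> h01; apply: ler_sum_const => k; exact: rate_le.
Qed.

Lemma fdiff_sup_opp h u m : 0 < h -> (forall k x, - fdiff h (l k) u x <= m) ->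
  forall k x, `|fdiff h (l k) u x| <= m.
Proof.
move=> h0 um k x; apply/ler_normlP; split; first exact: um.
by rewrite -[leLHS]opprK -fdiffN -l_o.
Qed.

(* Bernstein's method with [u j = fdiff h (l j) v] and lower-order function [v]: where
   the first differences are of size [m], the gradient term of [kap * (N0 - v) ^+ 2],
   with [kap] of order [m ^- 2], beats all errors of order one, yet this function
   itself is negligible when [m] is large. *)
Lemma first_diff_bound (N0 Nb : R) : 0 <= N0 -> 0 <= Nb ->
  exists N1 : R, 0 <= N1 /\ forall h (D : set V) v,
    0 < h <= 1 -> K * h <= delta -> solves h D v ->
    (forall x, `|v x| <= N0) ->
    (forall x, (D x /\ forall k, D (x + h *: l k)) \/
               (forall k, `|fdiff h (l k) v x| <= Nb)) ->
    forall k x, `|fdiff h (l k) v x| <= N1.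
Proof.
have K0 := K_gt0; have dl0 := delta_gt0.
move=> N00 Nb0.
(* Small enough that the first sum of squares stays below [1 / 8] and that the prefactor
   [2 * eps * (T + 1) * n] of [bernstein], with [T = 1], is at most one. *)
pose eps : R := (32 * (n + 1))^-1.
pose C1 := K * (1 + n) + K * (N0 + 1) + 1.
pose C2 := (#|{: I * I}|)%:R * (8 * K) ^+ 2 / (4 * (eps * delta)).
(* At the maximum the square of [v] contributes at least [B * delta / 4], which must exceed the
   [C2 + 2 * C1 + 2] that remains of the errors. *)
pose B := 4 * (C2 + 2 * C1 + 3) / delta.
pose ew := K * N0 + K.
(* The summand [2 * Nb] excludes a maximum at a point where the differences are bounded by [Nb]; the
   last two keep the [kap] terms small. *)
pose M0 := 1 + 2 * Nb + 32 * B * N0 ^+ 2 + 4 * B * N0 * ew.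
have n0 : 0 <= n by [].
have eps0 : 0 < eps by rewrite invr_gt0; lra.
have epsn : eps * n <= 1 / 32.
  rewrite /eps mulrC ler_pdivrMr; last lra.
  lra.
have Kn0 : 0 <= K * n by rewrite mulr_ge0// ltW.
have KN0 : 0 <= K * N0 by rewrite mulr_ge0// ltW.
have C10 : 0 <= C1 by rewrite /C1; lra.
have C20 : 0 <= C2.
  apply: divr_ge0; first by rewrite mulr_ge0 ?sqr_ge0.
  by apply: ltW; rewrite !mulr_gt0.
have B0 : 0 < B by rewrite /B divr_gt0//; lra.
have ew0 : 0 <= ew by rewrite /ew; lra.
have BN : 0 <= B * N0 ^+ 2 := mulr_ge0 (ltW B0) (sqr_ge0 _).
have BNe : 0 <= B * N0 * ew := mulr_ge0 (mulr_ge0 (ltW B0) N00) ew0.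
have M01 : 1 <= M0.
  by rewrite /M0 -!mulrA; move: BN BNe; rewrite -!mulrA; lra.
exists M0; split; first lra.
move=> h D v h01 Kh [sub sup] vN0 bdry; have /andP[h0 h1] := h01.
have hn0 : h != 0 by rewrite gt_eqF.
apply: fdiff_sup_opp => // k x.
pose F (p : I * V) := - fdiff h (l p.1) v p.2.
have FB p : F p <= 2 * N0 / h.
  rewrite /F /fdiff /shiftT -mulNr ler_pM2r ?invr_gt0//.
  have /ler_normlP[? ?] := vN0 p.2.
  have /ler_normlP[? ?] := vN0 (p.2 + h *: l p.1); lra.
apply: (@bound_of_shrink _ _ F _ M0 _ FB _ (k, x)); first lra.
move=> {k x} m M0m Fm [k0 x1]; rewrite leNgt; apply/negP => Fk0.
have m1 : 1 <= m by lra.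
have m0 : 0 < m by lra.
have mD : forall k x, `|fdiff h (l k) v x| <= m.
  by apply: fdiff_sup_opp => // k x; exact: (Fm (k, x)).
pose kap := B / m ^+ 2.
have kap0 : 0 <= kap by rewrite divr_ge0 ?sqr_ge0 ?ltW.
have kapm : kap * m ^+ 2 = B by rewrite divfK// expf_neq0// gt_eqF.
have mm2 : m <= m ^+ 2 by move: m1; nonlinear.
have kapN : kap * N0 ^+ 2 <= 1 / 32.
  rewrite /kap mulrAC ler_pdivrMr ?exprn_gt0//.
  move: M0m mm2 Nb0; rewrite /M0 -!mulrA; move: BN BNe; rewrite -!mulrA; linear.
have kapNe : 4 * kap * N0 * ew <= 1.
  have -> : 4 * kap * N0 * ew = (4 * B * N0 * ew) / m ^+ 2 by rewrite /kap; ring.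
  rewrite ler_pdivrMr ?exprn_gt0//.
  move: M0m mm2 Nb0; rewrite /M0 -!mulrA; move: BN BNe; rewrite -!mulrA; linear.
pose W y := - fdiff h (l k0) v y / m
  + eps * (\sum_(j : I) (1 - fdiff h (l j) v y / m) ^+ 2)
  + kap * (\sum_(j : unit) (N0 - v y) ^+ 2).
have tb j y : `|fdiff h (l j) v y / m| <= 1.
  by rewrite normrM normfV (gtr0_norm m0) ler_pdivrMr// mul1r.
have S1 y : 0 <= eps * (\sum_(j : I) (1 - fdiff h (l j) v y / m) ^+ 2) <= 1 / 8.
  rewrite mulr_ge0 ?sumr_ge0//=; [|by rewrite ltW|by move=> *; exact: sqr_ge0].
  apply: (@le_trans _ _ (eps * (n * 4))); last by move: epsn; linear.
  apply: ler_wpM2l; [exact: ltW|apply: ler_sum_const => j].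
  have /ler_normlP[] := tb j y; nonlinear.
have S2 y : 0 <= kap * (\sum_(j : unit) (N0 - v y) ^+ 2) <= 1 / 8.
  rewrite mulr_ge0 ?sumr_ge0//=; last by move=> *; exact: sqr_ge0.
  rewrite sumr_constE card_unit mul1r.
  apply: (@le_trans _ _ (kap * (4 * N0 ^+ 2))); last by move: kapN; linear.
  rewrite ler_wpM2l//; have /ler_normlP[] := vN0 y; nonlinear.
have WB y : W y <= 1 + 1 / 8 + 1 / 8.
  have /andP[_] := S1 y; have /andP[_] := S2 y.
  have /ler_normlP[] := tb k0 y; rewrite /W mulNr; linear.
(* With this inverse of the total jump rate, the near maximum costs [bernstein] at most one. *)
pose eta := (8 + n * (3 * K / h ^+ 2))^-1.
have rr0 : 0 <= n * (3 * K / h ^+ 2).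
  by rewrite mulr_ge0// divr_ge0 ?sqr_ge0//; move: K0; linear.
have eta0 : 0 < eta by rewrite invr_gt0; move: rr0; linear.
have eta1 : eta * (8 + n * (3 * K / h ^+ 2)) = 1.
  by rewrite mulVf// gt_eqF//; move: rr0; linear.
have eta8 : eta <= 1 / 8.
  by have := mulr_ge0 (ltW eta0) rr0; move: eta1; linear.
have [x0 Wx0] := approx_max x1 WB eta0.
(* The value at [x1] is more than [7 / 8]; each of the two sums and [eta] take away at most
   [1 / 8]. *)
have half : m / 2 <= - fdiff h (l k0) v x0.
  have : 7 / 8 < - fdiff h (l k0) v x1 / m by rewrite ltr_pdivlMr.
  have := Wx0 x1; rewrite /W.
  have /andP[_] := S1 x0; have /andP[_] := S2 x0.
  have /andP[+ _] := S1 x1; have /andP[+ _] := S2 x1; move: eta8 => e1 e2 e3 e4 e5 e6 e7.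
  have : 1 / 2 <= - fdiff h (l k0) v x0 / m.
    by move: e1 e2 e3 e4 e5 e6 e7; linear.
  by rewrite ler_pdivlMr//; linear.
have [[Dx0 Dx0k]|/(_ k0)/ler_normlP[nb _]] := bdry x0; last first.
  exfalso; move: M0m half Nb0 nb; rewrite /M0 -!mulrA; move: BN BNe; rewrite -!mulrA; linear.
(* [pde_first] divides the tolerance by [h], so the choice [h] contributes one. *)
have [al alx0] := sup x0 Dx0 h h0.
pose A1 := \sum_j \sum_k `|fdiff h (l k) (fdiff h (l j) v) x0|.
have A10 : 0 <= A1 by apply: sumr_ge0 => j _; apply: sumr_ge0.
pose eu := 4 * K * A1 + C1 * m.
have Leu j : gen h l (rate h al x0) (fdiff h (l j) v) x0 <= eu.
  rewrite -frozen_gen//.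
  have z1 : enorm (x0 - (x0 + h *: l j)) <= h * 1.
    by rewrite opprD addrA subrr add0r enormN enormZ (gtr0_norm h0) ler_pM2l.
  apply: le_trans (pde_first h01 (sub _ (Dx0k j) al) alx0 (l_le1 j) z1) _.
  rewrite divff// !mulr1.
  have b1 : \sum_k `|fdiff2 h (l k) v x0| <= A1 by exact: sum_fdiff2_le_mixed.
  have b2 : \sum_k `|fdiff h (l k) v x0| <= n * m.
    by apply: ler_sum_const.
  have b3 := vN0 x0.
  have b4 : c al (x0 + h *: l j) * fdiff h (l j) v x0 <= K * m.
    apply: le_trans (ler_norm _) _; rewrite normrM ler_pM//.
    by case: (c_smooth al).
  have b5 : \sum_k `|fdiff h (l k) (fdiff h (l j) v) x0| <= A1.
    by apply: ler_sum_term => i; exact: sumr_ge0.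
  have b6 : K * (\sum_k `|fdiff2 h (l k) v x0| + \sum_k `|fdiff h (l k) v x0| +
     `|v x0| + 1) <= K * (A1 + n * m + N0 + 1) by rewrite ler_pM2l//; move: b1 b2 b3; linear.
  have b7 : 3 * K * \sum_k `|fdiff h (l k) (fdiff h (l j) v) x0| <= 3 * K * A1.
    by rewrite ler_wpM2l//; move: K0; linear.
  have b8 : K * (N0 + 1) + 1 <= (K * (N0 + 1) + 1) * m by rewrite ler_peMr//; move: KN0 K0; linear.
  by move: b4 b6 b7 b8; rewrite /eu /C1; linear.
have Lew (j : unit) : gen h l (rate h al x0) v x0 <= ew.
  by rewrite -frozen_gen//; exact: frozen_le (sub _ Dx0 al) (vN0 x0).
have eu0 : 0 <= eu.
  by have := mulr_ge0 (ltW K0) A10; have := mulr_ge0 C10 (ltW m0); rewrite /eu; linear.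
have q_ge k : delta / h ^+ 2 <= rate h al x0 k by exact: rate_ge.
have ub j : - m <= fdiff h (l j) v x0 <= 1 * m.
  by have /ler_normlP[] := mD j x0; linear.
have := bernstein (w := fun=> v) hn0 (ltW delta_gt0) q_ge m0 (ltW eps0) kap0 eu0 ew0 Wx0
  (Leu k0) Leu Lew ub (fun=> vN0 x0).
rewrite card_unit.
have b1 : 2 * eps * (1 + 1) * n * (eu / m) <= eu / m.
  rewrite ler_piMl ?divr_ge0 ?(ltW m0)//; move: epsn; linear.
have b2 : eu / m = 4 * K * (A1 / m) + C1 by rewrite /eu; field; rewrite gt_eqF.
have b3 : eta * \sum_k rate h al x0 k <= 1.
  apply: (@le_trans _ _ (eta * (n * (3 * K / h ^+ 2)))).
    by rewrite ler_pM2l// sum_rate_le.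
  by rewrite mulrDr in eta1; move: eta1 eta0; linear.
have b4 : 8 * K * (A1 / m) <=
   eps * (delta * \sum_j \sum_k (fdiff h (l k) (fdiff h (l j) v) x0 / m) ^+ 2) + C2.
  have yy := young_sum2 (8 * K)
    (fun j k => fdiff h (l k) (fdiff h (l j) v) x0 / m) (mulr_gt0 eps0 dl0).
  apply: le_trans; last by rewrite mulrA; exact: yy.
  rewrite ler_wpM2l//; first by move: K0; linear.
  rewrite /A1 mulr_suml; apply: ler_sum => j _.
  rewrite mulr_suml; apply: ler_sum => k _.
  by rewrite [in leRHS]normrM normfV (gtr0_norm m0).
have b5 : kap * (delta * \sum_(j : unit) \sum_k fdiff h (l k) v x0 ^+ 2) >= B * delta / 4.
  rewrite sumr_constE card_unit mul1r.
  have : (m / 2) ^+ 2 <= \sum_k fdiff h (l k) v x0 ^+ 2.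
    rewrite (bigD1 k0)//=; apply: ler_wpDr; last by move: half m0; nonlinear.
    by apply: sumr_ge0 => *; exact: sqr_ge0.
  have kd : 0 <= kap * delta by rewrite mulr_ge0// ltW.
  by move=> /(ler_wpM2l kd); rewrite -kapm; linear.
have b6 : B * delta / 4 = C2 + 2 * C1 + 3.
  by rewrite /B; field; rewrite gt_eqF.
rewrite mulr1; move: b1 b3 b4 b5 b6 kapNe; rewrite b2 -!mulrA; linear.
Qed.

(* Directions [xi] outside the lattice of the [l k] compare different lattices; here
   the zeroth-order term [c >= delta] controls the maximum, and the first differences
   along the [l k] control the second differences that appear as errors. *)
Lemma vector_diff_bound (N0 N1 Nb C : R) :
  0 <= N0 -> 0 <= N1 -> 0 <= Nb -> 0 <= C ->
  exists N : R, 0 <= N /\ forall h (D : set V) v xi,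
    0 < h <= 1 -> K * h <= delta -> solves h D v ->
    (forall x, `|v x| <= N0) -> (forall k x, `|fdiff h (l k) v x| <= N1) ->
    enorm xi <= C ->
    (forall x, [/\ D x, D (x + h *: xi) & forall k, D (x + h *: l k)] \/
               - fdiff h xi v x <= Nb) ->
    forall x, - fdiff h xi v x <= N.
Proof.
have K0 := K_gt0; have dl0 := delta_gt0.
move=> N00 N10 Nb0 C0.
pose C1 := K * C + 4 * N1 * n * (K + 3 * K * (C + 1)).
pose C2 := (#|{: I * I}|)%:R * C1 ^+ 2 / (4 * delta).
pose C3 := 2 + K * C * (n * N1 + N0 + 1) +
  4 * N1 * n * (1 + K * N1 + K * (n * N1 + N0 + 1)) + C2.
have n0 : 0 <= n by [].
have nN1 : 0 <= n * N1 by rewrite mulr_ge0.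
have C30 : 0 <= C3.
  have KC : 0 <= K * C by rewrite mulr_ge0// ltW.
  have e1 : 0 <= K * C * (n * N1 + N0 + 1) by rewrite mulr_ge0//; lra.
  have e2 : 0 <= K * (n * N1 + N0 + 1) by rewrite mulr_ge0//; lra.
  have e3 : 0 <= K * N1 by rewrite mulr_ge0// ltW.
  have e4 : 0 <= 4 * N1 * n * (1 + K * N1 + K * (n * N1 + N0 + 1)).
    by apply: mulr_ge0; [rewrite -mulrA mulr_ge0// mulrC | lra].
  have e5 : 0 <= C2.
    by apply: divr_ge0; [rewrite mulr_ge0 ?sqr_ge0 | lra].
  by rewrite /C3; lra.
have C3d : 0 <= C3 / delta by rewrite divr_ge0// ltW.
have nN2 : 0 <= n * (4 * N1 ^+ 2).
  by rewrite mulr_ge0// mulr_ge0// sqr_ge0.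
exists (Nb + C3 / delta + n * (4 * N1 ^+ 2) + 1); split; first lra.
move=> h D v xi h01 Kh [sub sup] vN0 vN1 xiC bdry y; have /andP[h0 h1] := h01.
have hn0 : h != 0 by rewrite gt_eqF.
(* The first family of [bernstein] is switched off ([eps = 0], zero functions): only squares of the
   [fdiff h (l j) v] are present. *)
pose W y := - fdiff h xi v y / 1 + 0 * (\sum_(j : unit) (1 - 0 / 1) ^+ 2)
  + 1 * (\sum_j (N1 - fdiff h (l j) v y) ^+ 2).
have S y' : 0 <= \sum_j (N1 - fdiff h (l j) v y') ^+ 2 <= n * (4 * N1 ^+ 2).
  rewrite sumr_ge0/=; last by move=> *; exact: sqr_ge0.
  apply: ler_sum_const => j; have /ler_normlP[] := vN1 j y'; nonlinear.
have WB y' : W y' <= 2 * N0 / h + n * (4 * N1 ^+ 2).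
  rewrite /W !divr1 mul0r addr0 mul1r lerD//; last by have /andP[] := S y'.
    rewrite /fdiff /shiftT -mulNr ler_pM2r ?invr_gt0//.
  have /ler_normlP[] := vN0 y'.
  have /ler_normlP[] := vN0 (y' + h *: xi); linear.
pose eta := (1 + n * (3 * K / h ^+ 2))^-1.
have rr0 : 0 <= n * (3 * K / h ^+ 2).
  by rewrite mulr_ge0// divr_ge0 ?sqr_ge0//; move: K0; linear.
have eta0 : 0 < eta by rewrite invr_gt0; move: rr0; linear.
have eta1 : eta * (1 + n * (3 * K / h ^+ 2)) = 1.
  by rewrite mulVf// gt_eqF//; move: rr0; linear.
have etar : eta * (n * (3 * K / h ^+ 2)) <= 1.
  by move: eta1 eta0; rewrite mulrDr; linear.
have etale1 : eta <= 1.
  by have := mulr_ge0 (ltW eta0) rr0; move: eta1; rewrite mulrDr; linear.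
have [x0 Wx0] := approx_max y WB eta0.
suff x0b : - fdiff h xi v x0 <= Nb + C3 / delta.
  have := Wx0 y; rewrite /W !divr1 !mul0r !addr0 !mul1r.
  have /andP[_] := S x0; have /andP[+ _] := S y; move: x0b etale1; linear.
have [[Dx0 Dx0xi Dx0k]|nb] := bdry x0; last first.
  by move: nb C3d; linear.
have [al alx0] := sup x0 Dx0 h h0.
pose A1 := \sum_j \sum_k `|fdiff h (l k) (fdiff h (l j) v) x0|.
have A10 : 0 <= A1 by apply: sumr_ge0 => j _; apply: sumr_ge0.
(* Freezing here leaves no shift error for [fdiff h xi v], whose further differences no square would
   absorb. The displacement is charged to the [fdiff h (l j) v], whose further differences are
   absorbed. *)
pose z := x0 + h *: xi.
have b1 : \sum_k `|fdiff2 h (l k) v x0| <= A1 by exact: sum_fdiff2_le_mixed.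
have b2 : \sum_k `|fdiff h (l k) v x0| <= n * N1 by apply: ler_sum_const.
have b3 := vN0 x0.
pose G := A1 + n * N1 + N0 + 1.
have G0 : 0 <= G by move: A10 nN1 N00; rewrite /G; linear.
have bG : \sum_k `|fdiff2 h (l k) v x0| + \sum_k `|fdiff h (l k) v x0| +
     `|v x0| + 1 <= G by move: b1 b2 b3; rewrite /G; linear.
pose e0 := 1 + c al z * fdiff h xi v x0 + K * C * G.
have Le0 : gen h l (rate h al z) (fdiff h xi v) x0 <= e0.
  rewrite -frozen_gen//.
  have z1 : enorm (z - (x0 + h *: xi)) <= h * 0 by rewrite subrr enorm0 mulr0.
  apply: le_trans (pde_first h01 (sub _ Dx0xi al) alx0 xiC z1) _.
  rewrite divff// mulr0 mul0r addr0 lerD2l ler_wpM2l//.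
  by rewrite mulr_ge0// ltW.
pose ew := 1 + K * N1 + K * G + 3 * K * (C + 1) * A1.
have KC1 : 0 <= 3 * K * (C + 1).
  by apply: mulr_ge0; [move: K0; linear | move: C0; linear].
have Lew j : gen h l (rate h al z) (fdiff h (l j) v) x0 <= ew.
  rewrite -frozen_gen//.
  have z1 : enorm (z - (x0 + h *: l j)) <= h * (C + 1).
    rewrite /z opprD addrACA subrr add0r -scalerBr enormZ (gtr0_norm h0) ler_pM2l//.
    by rewrite (le_trans (ler_enormD _ _))// enormN lerD.
  apply: le_trans (pde_first h01 (sub _ (Dx0k j) al) alx0 (l_le1 j) z1) _.
  rewrite divff// !mulr1 /ew.
  have b4 : c al (x0 + h *: l j) * fdiff h (l j) v x0 <= K * N1.
    apply: le_trans (ler_norm _) _; rewrite normrM ler_pM//.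
    by case: (c_smooth al).
  have b5 : \sum_k `|fdiff h (l k) (fdiff h (l j) v) x0| <= A1.
    by apply: ler_sum_term => i; exact: sumr_ge0.
  have b6 := ler_wpM2l (ltW K0) bG.
  have b7 := ler_wpM2l KC1 b5.
  by move: b4 b6 b7; linear.
have ew0 : 0 <= ew.
  have := mulr_ge0 (ltW K0) N10; have := mulr_ge0 (ltW K0) G0.
  by have := mulr_ge0 KC1 A10; rewrite /ew; linear.
have q_ge k : delta / h ^+ 2 <= rate h al z k by exact: rate_ge.
have L0 (j : unit) : gen h l (rate h al z) (fun=> 0) x0 <= 0.
  by rewrite /gen big1// => k _; rewrite subrr mulr0.
have ub (j : unit) : - 1 <= (0 : R) <= 1 * 1 by rewrite mulr1 oppr_le0 ler01.
have := bernstein (u := fun=> (fun=> 0)) hn0 (ltW delta_gt0) q_ge ltr01 (lexx 0) ler01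
  (lexx 0) ew0 Wx0 Le0 L0 Lew ub (fun j => vN1 j x0).
have b3' : eta * \sum_k rate h al z k <= 1.
  by apply: le_trans etar; rewrite ler_pM2l// sum_rate_le.
have := young_sum2 C1 (fun j k => fdiff h (l k) (fdiff h (l j) v) x0) dl0.
rewrite -/A1 -/C2 => y1 y2.
have : - (c al z * fdiff h xi v x0) <= C3.
  have E1 : e0 + 4 * N1 * n * ew = c al z * fdiff h xi v x0 + C3 - C2 - 1 + C1 * A1.
    by rewrite /e0 /ew /C3 /C1 /G; ring.
  by move: y1 y2 b3' E1; linear.
have [u0|u0] := leP 0 (fdiff h xi v x0).
  by move=> _; move: u0 Nb0 C3d; linear.
move=> cC3.
have : delta * - fdiff h xi v x0 <= C3.
  apply: le_trans cC3; rewrite -[leRHS]mulrN ler_wpM2r// oppr_ge0; exact: ltW.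
rewrite -ler_pdivlMl// mulrC => Cd.
by move: Cd Nb0; linear.
Qed.

Lemma pde_second h al v x k eta N0 N1 : 0 < h <= 1 ->
  res h al v (x + h *: l k) <= 0 -> res h al v (x + h *: - l k) <= 0 ->
  - eta <= res h al v x -> `|v x| <= N0 ->
  (forall j, `|fdiff h (l j) v x| <= N1) ->
  frozen h al x (fdiff2 h (l k) v) x <= 2 * eta / h ^+ 2
    + K * (2 * (\sum_i \sum_j `|fdiff h (l j) (fdiff2 h (l i) v) x|)
           + 4 * (\sum_i \sum_j `|fdiff h (l j) (fdiff h (l i) v) x|)
           + n * N1 + 2 * N1 + N0 + 1).
Proof.
have K0 := K_gt0.
move=> /andP[h0 h1] r1 r2 r0 vN0 vN1.
have hn0 : h != 0 by rewrite gt_eqF.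
pose Q := \sum_i \sum_j `|fdiff h (l j) (fdiff2 h (l i) v) x|.
pose A1 := \sum_i \sum_j `|fdiff h (l j) (fdiff h (l i) v) x|.
have dres : fdiff2 h (l k) (res h al v) x <= 2 * eta / h ^+ 2.
  rewrite /fdiff2 /shiftT ler_pM2r ?invr_gt0 ?exprn_gt0//.
  by move: r1 r2 r0; linear.
have D1 j (phi : V -> R) : smooth_bound K phi -> `|fdiff h (l j) phi x| <= K.
  move=> sphi; apply: le_trans (fdiff_le (l j) x h0 sphi) _.
  by rewrite -[leRHS]mulr1 ler_pM2l.
have D2 j (phi : V -> R) : smooth_bound K phi -> `|fdiff2 h (l j) phi x| <= K.
  move=> [_ _ /(_ h (l j) x h0)] le; apply: le_trans le _.
  by rewrite -[leRHS]mulr1 ler_pM2l// expr_le1// enorm_ge0.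
have Qle j : \sum_i `|fdiff h (l j) (fdiff2 h (l i) v) x| <= Q.
  apply: ler_sum => i _.
  exact: (ler_norm_sumr (fun j => fdiff h (l j) (fdiff2 h (l i) v) x)).
have Ale j : \sum_i `|fdiff h (l j) (fdiff h (l i) v) x| <= A1.
  apply: ler_sum => i _.
  exact: (ler_norm_sumr (fun j => fdiff h (l j) (fdiff h (l i) v) x)).
have Ple : \sum_i `|fdiff2 h (l i) v x| <= A1 by exact: sum_fdiff2_le_mixed.
have DDk : `|fdiff2 h (l k) v x| <= A1.
  by apply: le_trans Ple; exact: (ler_norm_sumr (fun i => fdiff2 h (l i) v x)).
have Dsum : \sum_i `|fdiff h (l i) v x| <= n * N1 by exact: ler_sum_const.
have a1 : `|\sum_i fdiff h (l k) (a al i) x * fdiff h (l k) (fdiff2 h (l i) v) x| <= K * Q.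
  apply: le_trans (ler_sumM _ (fun i => D1 k _ (a_smooth al i))) _.
  by rewrite ler_wpM2l// ltW.
have a2 : `|\sum_i fdiff h (- l k) (a al i) x * fdiff h (- l k) (fdiff2 h (l i) v) x| <= K * Q.
  rewrite -l_o; apply: le_trans (ler_sumM _ (fun i => D1 (o k) _ (a_smooth al i))) _.
  by rewrite ler_wpM2l// ltW.
have a3 : `|\sum_i fdiff2 h (l k) (a al i) x * fdiff2 h (l i) v x| <= K * A1.
  apply: le_trans (ler_sumM _ (fun i => D2 k _ (a_smooth al i))) _.
  by rewrite ler_wpM2l// ltW.
have b1 : `|\sum_i fdiff h (l k) (b al i) x * fdiff h (l k) (fdiff h (l i) v) x| <= K * A1.
  apply: le_trans (ler_sumM _ (fun i => D1 k _ (b_smooth al i))) _.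
  by rewrite ler_wpM2l// ltW.
have b2 : `|\sum_i fdiff h (- l k) (b al i) x * fdiff h (- l k) (fdiff h (l i) v) x| <= K * A1.
  rewrite -l_o; apply: le_trans (ler_sumM _ (fun i => D1 (o k) _ (b_smooth al i))) _.
  by rewrite ler_wpM2l// ltW.
have b3 : `|\sum_i fdiff2 h (l k) (b al i) x * fdiff h (l i) v x| <= K * (n * N1).
  apply: le_trans (ler_sumM _ (fun i => D2 k _ (b_smooth al i))) _.
  by rewrite ler_wpM2l// ltW.
have c1 : `|c al x * fdiff2 h (l k) v x| <= K * A1.
  by rewrite normrM ler_pM//; case: (c_smooth al).
have c2 : `|fdiff h (l k) (c al) x * fdiff h (l k) v x| <= K * N1.
  by rewrite normrM ler_pM// D1.
have c3 : `|fdiff h (- l k) (c al) x * fdiff h (- l k) v x| <= K * N1.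
  by rewrite -l_o normrM ler_pM// D1.
have c4 : `|fdiff2 h (l k) (c al) x * v x| <= K * N0.
  by rewrite normrM ler_pM// D2.
have f1 : `|fdiff2 h (l k) (f al) x| <= K by exact: D2.
move: a1 a2 a3 b1 b2 b3 => /ler_normlP[a1 _] /ler_normlP[a2 _] /ler_normlP[a3 _]
  /ler_normlP[b1 _] /ler_normlP[b2 _] /ler_normlP[b3 _].
move: c1 c2 c3 c4 f1 => /ler_normlP[_ c1] /ler_normlP[_ c2] /ler_normlP[_ c3]
  /ler_normlP[_ c4] /ler_normlP[f1 _].
move: dres; rewrite fdiff2_res// -/Q -/A1.
move: a1 a2 a3 b1 b2 b3 c1 c2 c3 c4 f1; rewrite !mulrDr; linear.
Qed.

(** This crude bound makes suprema finite and settles the layer where the distance to the boundary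
    is comparable to [h]. *)
Lemma fdiff2_le h v x k N1 : 0 < h -> (forall j, `|fdiff h (l j) v x| <= N1) ->
  `|fdiff2 h (l k) v x| <= 2 * N1 / h.
Proof.
move=> h0 vN1; rewrite fdiff2E ?gt_eqF// normrM normfV (gtr0_norm h0).
rewrite ler_pM2r ?invr_gt0// -l_o (le_trans (ler_normD _ _))//.
by have := vN1 k; have := vN1 (o k); linear.
Qed.

(* The sum of the [a k * fdiff2 h (l k) v x] is bounded above by the equation and
   [a k >= delta], so a lower bound for all pure second differences bounds each of
   them from above. *)
Lemma fdiff2_upper N0 N1 r h al v x s m j : 0 <= N1 -> 0 <= s <= r ->
  res h al v x <= 0 -> `|v x| <= N0 -> (forall k, `|fdiff h (l k) v x| <= N1) ->
  1 <= m -> (forall k, - (s * fdiff2 h (l k) v x) <= m) ->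
  s * fdiff2 h (l j) v x <=
    ((r * (K * (n * N1) + K * N0 + K) + K * n) / delta) * m.
Proof.
have K0 := K_gt0; have dl0 := delta_gt0.
move=> N10 /andP[s0 sr] r0 vN0 vN1 m1 um.
have N00 : 0 <= N0 by apply: le_trans vN0.
pose C0 := K * (n * N1) + K * N0 + K.
have C00 : 0 <= C0 by rewrite /C0 !addr_ge0 ?mulr_ge0 ?(ltW K0).
have hb : `|\sum_k b al k x * fdiff h (l k) v x| <= K * (n * N1).
  apply: (@le_trans _ _ (K * \sum_k `|fdiff h (l k) v x|)).
    by apply: ler_sumM => k; case: (b_smooth al k).
  by rewrite ler_wpM2l ?(ltW K0)//; exact: ler_sum_const.
have hf : `|f al x| <= K by case: (f_smooth al).
have hc : `|c al x * v x| <= K * N0.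
  by rewrite normrM ler_pM//; case: (c_smooth al).
have ha : \sum_k a al k x * fdiff2 h (l k) v x <= C0.
  move: r0 hb hf hc; rewrite /res /frozen /C0.
  by move=> + /ler_normlP[+ _] /ler_normlP[+ _] /ler_normlP[_ +]; linear.
have [u0|u0] := leP (s * fdiff2 h (l j) v x) 0.
  apply: le_trans u0 _; apply: mulr_ge0; last by move: m1; linear.
  apply: divr_ge0; last exact: ltW.
  apply: addr_ge0; last by rewrite mulr_ge0 ?(ltW K0).
  by apply: mulr_ge0 => //; exact: le_trans sr.
suff : delta * (s * fdiff2 h (l j) v x) <= (r * C0 + K * n) * m.
  by rewrite mulrC -ler_pdivlMr// => le; rewrite mulrAC.
apply: (@le_trans _ _ (a al j x * (s * fdiff2 h (l j) v x))).
  by rewrite ler_pM2r.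
have : \sum_(k | k != j) - (a al k x * (s * fdiff2 h (l k) v x)) <= K * n * m.
  apply: (@le_trans _ _ (\sum_(k | k != j) K * m)).
    apply: ler_sum => k _; rewrite -mulrN.
    have [/(_ x) /ler_normlP[_ aK] _ _] := a_smooth al k.
    have [w0|w0] := leP 0 (- (s * fdiff2 h (l k) v x)).
      by rewrite ler_pM// (le_trans _ (a_ge al k x))// ltW.
    apply: (@le_trans _ _ 0); last by rewrite mulr_ge0 ?(ltW K0)//; move: m1; linear.
    by rewrite mulr_ge0_le0 ?(ltW w0)// (le_trans _ (a_ge al k x))// ltW.
  apply: (@le_trans _ _ (\sum_(k : I) K * m)).
    rewrite [leRHS](bigD1 j)//= lerDr mulr_ge0 ?(ltW K0)//; move: m1; linear.
  by rewrite sumr_constE; move: (lexx (n * (K * m))); linear.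
have : s * \sum_k a al k x * fdiff2 h (l k) v x <= r * C0 * m.
  apply: (@le_trans _ _ (s * C0)); first by rewrite ler_wpM2l.
  have e1 : s * C0 <= r * C0 by rewrite ler_wpM2r.
  apply: le_trans e1 _; rewrite ler_peMr// mulr_ge0//; exact: le_trans sr.
rewrite mulr_sumr (bigD1 j)//= sumrN.
have -> : \sum_(i | i != j) s * (a al i x * fdiff2 h (l i) v x) =
  \sum_(i | i != j) a al i x * (s * fdiff2 h (l i) v x).
  by apply: eq_bigr => i _; rewrite mulrCA.
by rewrite mulrCA mulrDl; linear.
Qed.

(* The same method one level up, with [u k] the second differences times a cutoff and
   with the first differences as lower-order functions. Only a lower bound for [u k]
   has to be improved, by [fdiff2_upper]. As [fdiff2 h (l k) v] is [O(1 / h)], the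
   cutoff is at least a large multiple of [h] at the maximum when [m] is large. *)
Lemma second_diff_bound (N0 N1 Rm : R) : 0 <= N0 -> 0 <= N1 -> 0 <= Rm ->
  exists N : R, 0 <= N /\ forall h (D : set V) v y r,
    0 < h <= 1 -> K * h <= delta -> solves h D v ->
    (forall x, `|v x| <= N0) -> (forall k x, `|fdiff h (l k) v x| <= N1) ->
    0 < r <= Rm ->
    (forall x, enorm (x - y) < r -> D x /\ forall k, D (x + h *: l k)) ->
    forall k, r * `|fdiff2 h (l k) v y| <= N.
Proof.
have K0 := K_gt0; have dl0 := delta_gt0.
move=> N00 N10 Rm0.
have n0 : 0 <= n by [].
have nN1 : 0 <= n * N1 by rewrite mulr_ge0.
(* Ratio of the upper to the lower bounds for the [U k], from [fdiff2_upper]. *)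
pose T' := (Rm * (K * (n * N1) + K * N0 + K) + K * n) / delta.
have T'0 : 0 <= T'.
  have e1 := mulr_ge0 (ltW K0) nN1; have e2 := mulr_ge0 (ltW K0) N00.
  have e3 := mulr_ge0 (ltW K0) n0.
  have e4 : 0 <= Rm * (K * (n * N1) + K * N0 + K).
    by apply: mulr_ge0 => //; move: e1 e2 K0; linear.
  by rewrite /T' divr_ge0 ?(ltW dl0)//; move: e3 e4; linear.
pose T := T' + 1.
have T1 : 1 <= T by move: T'0; rewrite /T; linear.
pose TT := (T + 1) ^+ 2.
have TT1 : 1 <= TT by rewrite /TT; move: T1; nonlinear.
have TTT : T + 1 <= TT by rewrite /TT; move: T1; nonlinear.
pose eps : R := (16 * (n + 1) * TT)^-1.
have epsd : 0 < 16 * (n + 1) * TT.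
  by apply: mulr_gt0; [move: n0; linear | move: TT1; linear].
have eps0 : 0 < eps by rewrite invr_gt0.
have epsn : eps * (n * TT) <= 1 / 16.
  rewrite /eps mulrC ler_pdivrMr//; move: TT1; linear.
pose C' := n * N1 + 2 * N1 + N0 + 1.
have C'0 : 0 <= C' by move: nN1 N10 N00; rewrite /C'; linear.
have KC'0 : 0 <= K * C' := mulr_ge0 (ltW K0) C'0.
pose C4 := 2 * K * (2 * Rm + 9).
have C40 : 0 <= C4.
  by apply: mulr_ge0; [move: K0 | move: Rm0]; linear.
pose C5 := T * (K * n * (2 + 3 * Rm)) + 3 * n ^+ 2 * T * C4.
have C50 : 0 <= C5.
  have t0 : 0 <= T by move: T1; linear.
  have e1 : 0 <= 2 + 3 * Rm by move: Rm0; linear.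
  have e2 := mulr_ge0 t0 (mulr_ge0 (mulr_ge0 (ltW K0) n0) e1).
  have e3 := mulr_ge0 (mulr_ge0 (sqr_ge0 n) t0) C40.
  by rewrite /C5; move: e2 e3; linear.
pose C6 := C5 + Rm * Rm ^+ 2 * (1 + K * C').
have RmK : 0 <= Rm * Rm ^+ 2 * (1 + K * C').
  apply: mulr_ge0; last by move: KC'0; linear.
  exact: mulr_ge0 Rm0 (sqr_ge0 _).
have C60 : 0 <= C6 by move: C50 RmK; rewrite /C6; linear.
pose C7 := 1 + K * N1 + K * (n * N1 + N0 + 1).
have C70 : 0 <= C7.
  have e1 := mulr_ge0 (ltW K0) N10.
  have e2 : 0 <= n * N1 + N0 + 1 by move: nN1 N00; linear.
  have e3 := mulr_ge0 (ltW K0) e2.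
  by rewrite /C7; move: e1 e3; linear.
pose C8 := (#|{: I * I}|)%:R * (2 * C4) ^+ 2 / (4 * (eps * delta)).
have C80 : 0 <= C8.
  apply: divr_ge0; first by rewrite mulr_ge0 ?sqr_ge0.
  by apply: ltW; rewrite !mulr_gt0.
pose C9 := (#|{: I * I}|)%:R * (8 * K * Rm + 1) ^+ 2 / (2 * delta).
have C90 : 0 <= C9.
  apply: divr_ge0; first by rewrite mulr_ge0 ?sqr_ge0.
  by apply: ltW; rewrite !mulr_gt0.
(* All errors will be compared with [z ^- 2], where [z] is the cutoff at the maximum;
   [B * delta / 8] has to beat the sum of their coefficients. *)
pose B := 8 * (2 * C6 + C8 + (C9 + 2) * Rm ^+ 2 + 1) / delta + 1.
have Bnum : 0 <= 2 * C6 + C8 + (C9 + 2) * Rm ^+ 2 + 1.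
  have e1 : 0 <= (C9 + 2) * Rm ^+ 2.
    by apply: mulr_ge0; [move: C90; linear | exact: sqr_ge0].
  by move: e1 C60 C80; linear.
have B1 : 1 <= B.
  rewrite /B lerDr divr_ge0 ?(ltW dl0)//; move: Bnum; linear.
have B0 : 0 < B by move: B1; linear.
have nN2 : 0 <= n * N1 ^+ 2 := mulr_ge0 n0 (sqr_ge0 _).
have BnN2 : 0 <= B * (n * N1 ^+ 2) := mulr_ge0 (ltW B0) nN2.
have BnNK : 0 <= B * (n * N1 * K) := mulr_ge0 (ltW B0) (mulr_ge0 nN1 (ltW K0)).
have BnNC : 0 <= B * (n * N1 * C7) := mulr_ge0 (ltW B0) (mulr_ge0 nN1 C70).
pose M0 := 1 + 25 * N1 + 32 * (B * (n * N1 ^+ 2)) + 16 * (B * (n * N1 * K))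
  + 4 * (B * (n * N1 * C7)).
have M01 : 1 <= M0 by move: N10 BnN2 BnNK BnNC; rewrite /M0; linear.
have TM0 : M0 <= T * M0.
  by rewrite ler_peMl//; move: M01; linear.
exists (T * M0); split; first by move: M01 TM0; linear.
move=> h D v y r h01 Kh [sub sup] vN0 vN1 /andP[r0 rRm] ball; have /andP[h0 h1] := h01.
have hn0 : h != 0 by rewrite gt_eqF.
pose zt := cutoff y r.
have zt0 x : 0 <= zt x by exact: cutoff_ge0.
have ztr x : zt x <= r by exact: cutoff_le.
have ztRm x : zt x <= Rm by exact: le_trans (ztr x) rRm.
pose U k x := zt x * fdiff2 h (l k) v x.
have Uupper m : 1 <= m -> (forall k x, - U k x <= m) -> forall k x, U k x <= T * m.
  move=> m1 Um k x.
  have [zx|zx] := leP (zt x) 0.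
    have -> : U k x = 0 by rewrite /U (_ : zt x = 0) ?mul0r//; apply/le_anti; rewrite zx zt0.
    by apply: mulr_ge0; [move: T1 | move: m1]; linear.
  have [xy _] := cutoff_gt0 r0 zx.
  have [Dx _] := ball x xy.
  (* Any control will do, since only [res <= 0] is used; the tolerance is arbitrary. *)
  have [al _] := sup x Dx 1 ltr01.
  have zz : 0 <= zt x <= Rm by rewrite zt0 ztRm.
  have := fdiff2_upper k N10 zz (sub x Dx al) (vN0 x) (vN1^~ x) m1 (Um^~ x).
  rewrite -/(U k x) -/T' => le; apply: le_trans le _.
  by rewrite ler_wpM2r// /T; [move: m1|]; linear.
suff low : forall p : I * V, - U p.1 p.2 <= M0.
  move=> k; have low' k' x := low (k', x).
  have := low (k, y); have := Uupper M0 M01 low' k y.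
  rewrite /U/= {1 2}/zt cutoff_center// => e1 e2.
  have [u0|u0] := leP 0 (fdiff2 h (l k) v y); first by rewrite ger0_norm.
  by rewrite ltr0_norm// mulrN; move: e2 TM0; linear.
have DD x k : `|fdiff2 h (l k) v x| <= 2 * N1 / h by exact: fdiff2_le.
pose F (p : I * V) := - U p.1 p.2.
have FB p : F p <= Rm * (2 * N1 / h).
  rewrite /F /U -mulrN.
  apply: (@le_trans _ _ (zt p.2 * (2 * N1 / h))).
    by rewrite ler_wpM2l//; have /ler_normlP[] := DD p.2 p.1.
  by rewrite ler_wpM2r// (le_trans _ (DD y p.1)).
apply: (@bound_of_shrink _ _ F _ M0 _ FB); first by move: M01; linear.
move=> m M0m Fm [k0 x1]; rewrite leNgt; apply/negP => Fk0.
have m1 : 1 <= m by exact: le_trans M0m.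
have m0 : 0 < m by exact: lt_le_trans m1.
have mne : m != 0 by rewrite gt_eqF.
have Um k x : - U k x <= m by exact: (Fm (k, x)).
have UT k x : U k x <= T * m by exact: Uupper.
have mm2 : m <= m ^+ 2 by move: m1; nonlinear.
have m20 : 0 < m ^+ 2 by rewrite exprn_gt0.
pose kap := B / m ^+ 2.
have kap0 : 0 < kap by rewrite divr_gt0.
have kapm : kap * m ^+ 2 = B by rewrite divfK// gt_eqF.
have kapN : kap * (n * N1 ^+ 2) <= 1 / 32.
  rewrite /kap mulrAC ler_pdivrMr//.
  by move: M0m mm2 N10 BnN2 BnNK BnNC; rewrite /M0; linear.
have kapNK : 16 * (kap * (n * N1 * K)) <= 1 / m.
  have -> : 16 * (kap * (n * N1 * K)) = (16 * (B * (n * N1 * K)) / m) / m.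
    by rewrite /kap; field.
  rewrite ler_pM2r ?invr_gt0// ler_pdivrMr//.
  by move: M0m mm2 N10 BnN2 BnNK BnNC; rewrite /M0; linear.
have kapNC : 4 * (kap * (n * N1 * C7)) <= 1.
  have -> : 4 * (kap * (n * N1 * C7)) = (4 * (B * (n * N1 * C7))) / m ^+ 2.
    by rewrite /kap; ring.
  rewrite ler_pdivrMr//.
  by move: M0m mm2 N10 BnN2 BnNK BnNC; rewrite /M0; linear.
pose W x := - U k0 x / m + eps * (\sum_j (T - U j x / m) ^+ 2)
  + kap * (\sum_j (N1 - fdiff h (l j) v x) ^+ 2).
have Um' j x : -1 <= U j x / m <= T.
  by rewrite ler_pdivlMr// ler_pdivrMr// UT andbT mulN1r lerNl.
have S1 x : 0 <= eps * (\sum_j (T - U j x / m) ^+ 2) <= 1 / 8.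
  rewrite mulr_ge0 ?sumr_ge0//=; [|by rewrite ltW|by move=> *; exact: sqr_ge0].
  apply: (@le_trans _ _ (eps * (n * TT))); last by move: epsn; linear.
  apply: ler_wpM2l; [exact: ltW|apply: ler_sum_const => j].
  have /andP[] := Um' j x; rewrite /TT; move: T1; nonlinear.
have S2 x : 0 <= kap * (\sum_j (N1 - fdiff h (l j) v x) ^+ 2) <= 1 / 8.
  rewrite mulr_ge0 ?sumr_ge0//=; [|by rewrite ltW|by move=> *; exact: sqr_ge0].
  apply: (@le_trans _ _ (kap * (n * (4 * N1 ^+ 2)))); last by move: kapN; linear.
  apply: ler_wpM2l; [exact: ltW|apply: ler_sum_const => j].
  have /ler_normlP[] := vN1 j x; nonlinear.
have WB x : W x <= 1 + 1 / 8 + 1 / 8.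
  have /andP[_] := S1 x; have /andP[_] := S2 x.
  have /andP[+ _] := Um' k0 x; rewrite /W mulNr; linear.
pose eta := (8 + n * (3 * K / h ^+ 2))^-1.
have rr0 : 0 <= n * (3 * K / h ^+ 2).
  by rewrite mulr_ge0// divr_ge0 ?sqr_ge0//; move: K0; linear.
have eta0 : 0 < eta by rewrite invr_gt0; move: rr0; linear.
have eta1 : eta * (8 + n * (3 * K / h ^+ 2)) = 1.
  by rewrite mulVf// gt_eqF//; move: rr0; linear.
have eta8 : eta <= 1 / 8.
  by have := mulr_ge0 (ltW eta0) rr0; move: eta1; linear.
have [x0 Wx0] := approx_max x1 WB eta0.
have half : m / 2 <= - U k0 x0.
  have : 7 / 8 < - U k0 x1 / m by rewrite ltr_pdivlMr.
  have := Wx0 x1; rewrite /W.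
  have /andP[_] := S1 x0; have /andP[_] := S2 x0.
  have /andP[+ _] := S1 x1; have /andP[+ _] := S2 x1; move: eta8 => e1 e2 e3 e4 e5 e6 e7.
  have : 1 / 2 <= - U k0 x0 / m.
    by move: e1 e2 e3 e4 e5 e6 e7; linear.
  by rewrite ler_pdivlMr//; linear.
pose z := zt x0.
(* Since second differences are at most [2 * N1 / h], a smaller cutoff would give [m <= 24 * N1];
   hence the [25 * N1] in [M0]. *)
have h6 : 6 * h <= z.
  have e1 : - U k0 x0 <= z * (2 * N1 / h).
    by rewrite /U -mulrN ler_wpM2l//; have /ler_normlP[] := DD x0 k0.
  have : m / 2 * h <= z * (2 * N1).
    by rewrite -ler_pdivlMr// -mulrA; exact: le_trans half e1.
  move=> e2; rewrite leNgt; apply/negP => e3.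
  have e4 : z * (2 * N1) <= 6 * h * (2 * N1).
    by apply: ler_wpM2r; [move: N10; linear | exact: ltW].
  have e5 : 25 * N1 + 1 <= m.
    by move: M0m BnN2 BnNK BnNC; rewrite /M0; linear.
  have e6 : (25 * N1 + 1) * h <= m * h by rewrite ler_pM2r.
  have e7 : 0 <= N1 * h by rewrite mulr_ge0// ltW.
  by move: h0 e2 e4 e6 e7; linear.
have z0 : 0 < z by apply: lt_le_trans h6; rewrite mulr_gt0.
have zne : z != 0 by rewrite gt_eqF.
have zRm : z <= Rm by exact: ztRm.
have [x0y _] := cutoff_gt0 r0 z0.
have [Dx0 Dx0k] := ball x0 x0y.
have Dx0N k : D (x0 + h *: - l k) by rewrite -l_o.
have eh0 : 0 < h ^+ 2 / 2 by rewrite divr_gt0// exprn_gt0.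
(* This tolerance contributes one in [pde_second]. *)
have [al alx0] := sup x0 Dx0 (h ^+ 2 / 2) eh0.
pose L := gen h l (rate h al x0).
pose A1 := \sum_j \sum_k `|fdiff h (l k) (fdiff h (l j) v) x0|.
pose Q := \sum_j \sum_k `|fdiff h (l k) (fdiff2 h (l j) v) x0|.
pose G := \sum_j \sum_k `|fdiff h (l k) (U j) x0 / m|.
have A10 : 0 <= A1 by apply: sumr_ge0 => j _; apply: sumr_ge0.
have Q0 : 0 <= Q by apply: sumr_ge0 => j _; apply: sumr_ge0.
have G0 : 0 <= G by apply: sumr_ge0 => j _; apply: sumr_ge0.
have Tm0 : 0 <= T * m by apply: mulr_ge0; [move: T1|move: m1]; linear.
have mTm : m <= T * m by rewrite ler_peMl// ltW.
have Dk k : `|fdiff2 h (l k) v x0| <= T * m / z.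
  rewrite ler_pdivlMr// -[X in _ * X](gtr0_norm z0) -normrM mulrC.
  by apply/ler_normlP; split; [exact: le_trans (Um k x0) mTm | exact: UT].
(* The product rule expresses third differences of [v], weighted by the cutoff at the neighbour,
   through differences of [U j], whose squares are available; the neighbour's cutoff is at least
   [z / 2]. *)
have zQ : z * Q <= 2 * (G * m) + 6 * n ^+ 2 * (T * m / z).
  have -> : 2 * (G * m) + 6 * n ^+ 2 * (T * m / z) =
    \sum_(j : I) \sum_(k : I) (2 * `|fdiff h (l k) (U j) x0| + 6 * (T * m / z)).
    under eq_bigr do rewrite big_split/= sumr_constE -mulr_sumr.
    rewrite big_split/= sumr_constE -mulr_sumr /G mulr_suml.
    congr (2 * _ + _); last by ring.
    apply: eq_bigr => j _; rewrite mulr_suml; apply: eq_bigr => k _.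
    by rewrite (@normrM _ (fdiff h (l k) (U j) x0)) normfV (gtr0_norm m0) divfK.
  rewrite mulr_sumr; apply: ler_sum => j _.
  rewrite mulr_sumr; apply: ler_sum => k _.
  have [c1 c2 _] := cutoff_shift r0 h0 (l_le1 k) h6.
  have e1 : z / 2 * `|fdiff h (l k) (fdiff2 h (l j) v) x0| <=
     `|zt (x0 + h *: l k) * fdiff h (l k) (fdiff2 h (l j) v) x0|.
    by rewrite [in leRHS]normrM ler_wpM2r// (le_trans c1)// ler_norm.
  have e2 : zt (x0 + h *: l k) * fdiff h (l k) (fdiff2 h (l j) v) x0 =
     fdiff h (l k) (U j) x0 - fdiff h (l k) zt x0 * fdiff2 h (l j) v x0.
    by rewrite /U fdiffM// addrK.
  have e3 : `|fdiff h (l k) zt x0 * fdiff2 h (l j) v x0| <= 3 * (T * m / z).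
    by rewrite [leLHS]normrM ler_pM.
  have := ler_normB (fdiff h (l k) (U j) x0) (fdiff h (l k) zt x0 * fdiff2 h (l j) v x0).
  by rewrite -e2; move: e1 e3; linear.
(* The first three terms come from [pde_second], the fourth from the operator acting on the cutoff,
   the last from the cross term of the product rule. *)
pose eu := z * (1 + K * C') + 2 * K * (z * Q) + 4 * K * (z * A1)
  + (T * m / z) * (K * n * (2 / z + 3)) + 9 * K * Q.
have zfr : `|frozen h al x0 zt x0| <= K * n * (2 / z + 3).
  apply: le_trans (ler_normD _ _) _.
  have e1 : `|\sum_k a al k x0 * fdiff2 h (l k) zt x0| <= K * (n * (2 / z)).
    have aK k : `|a al k x0| <= K by case: (a_smooth al k).
    apply: le_trans (ler_sumM _ aK) _.
    rewrite ler_wpM2l ?(ltW K0)//; apply: ler_sum_const => k.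
    exact: cutoff_fdiff2.
  have e2 : `|\sum_k b al k x0 * fdiff h (l k) zt x0| <= K * (n * 3).
    have bK k : `|b al k x0| <= K by case: (b_smooth al k).
    apply: le_trans (ler_sumM _ bK) _.
    rewrite ler_wpM2l ?(ltW K0)//; apply: ler_sum_const => k.
    by have [] := cutoff_shift r0 h0 (l_le1 k) h6.
  by move: e1 e2; linear.
have Leu k : L (U k) x0 <= eu.
  rewrite /L /U genM// -!frozen_gen//.
  have e1 := pde_second h01 (sub _ (Dx0k k) al) (sub _ (Dx0N k) al) alx0 (vN0 x0) (vN1^~ x0).
  have {}e1 := ler_wpM2l (ltW z0) e1.
  rewrite -/Q -/A1 in e1.
  have e2 : z * (2 * (h ^+ 2 / 2) / h ^+ 2 +
     K * (2 * Q + 4 * A1 + n * N1 + 2 * N1 + N0 + 1)) =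
     z * (1 + K * C') + 2 * K * (z * Q) + 4 * K * (z * A1).
    by rewrite /C'; field.
  rewrite e2 in e1.
  have e3 : fdiff2 h (l k) v x0 * frozen h al x0 zt x0 <=
      (T * m / z) * (K * n * (2 / z + 3)).
    by apply: le_trans (ler_norm _) _; rewrite normrM ler_pM.
  have e4 : \sum_i rate h al x0 i * h ^+ 2 *
     (fdiff h (l i) zt x0 * fdiff h (l i) (fdiff2 h (l k) v) x0) <= 9 * K * Q.
    apply: (@le_trans _ _ (\sum_i 9 * K * `|fdiff h (l i) (fdiff2 h (l k) v) x0|)).
      apply: ler_sum => i _.
      have [_ c2 _] := cutoff_shift r0 h0 (l_le1 i) h6.
      have q1 : 0 <= rate h al x0 i * h ^+ 2 by rewrite mulr_ge0 ?sqr_ge0// rate_ge0.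
      have q2 : rate h al x0 i * h ^+ 2 <= 3 * K.
        by rewrite -ler_pdivlMr ?exprn_gt0//; exact: rate_le.
      apply: le_trans (ler_norm _) _.
      rewrite normrM (ger0_norm q1).
      have -> : 9 * K * `|fdiff h (l i) (fdiff2 h (l k) v) x0| =
        3 * K * (3 * `|fdiff h (l i) (fdiff2 h (l k) v) x0|) by ring.
      by rewrite ler_pM// [leLHS]normrM ler_wpM2r.
    rewrite -mulr_sumr ler_wpM2l//; first by move: K0; linear.
    apply: (ler_sum_term (F := fun j => \sum_i `|fdiff h (l i) (fdiff2 h (l j) v) x0|)).
    by move=> j; exact: sumr_ge0.
  by rewrite /eu; move: e1 e3 e4; rewrite /z; linear.
have Lu0 : 0 <= eu.
  have zz : 0 <= 2 / z + 3 by rewrite addr_ge0// divr_ge0// ltW.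
  have p1 : 0 <= z * (1 + K * C') by rewrite mulr_ge0 ?(ltW z0)// addr_ge0.
  have p2 : 0 <= 2 * K * (z * Q) by rewrite !mulr_ge0 ?(ltW z0) ?(ltW K0).
  have p3 : 0 <= 4 * K * (z * A1) by rewrite !mulr_ge0 ?(ltW z0) ?(ltW K0).
  have p4 : 0 <= (T * m / z) * (K * n * (2 / z + 3)).
    apply: mulr_ge0; first exact: divr_ge0 Tm0 (ltW z0).
    exact: mulr_ge0 (mulr_ge0 (ltW K0) n0) zz.
  have p5 : 0 <= 9 * K * Q by rewrite !mulr_ge0 ?(ltW K0).
  by rewrite /eu; move: p1 p2 p3 p4 p5; linear.
pose ew := C7 + 4 * K * A1.
have Lew j : L (fdiff h (l j) v) x0 <= ew.
  rewrite /L -frozen_gen//.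
  have z1 : enorm (x0 - (x0 + h *: l j)) <= h * 1.
    by rewrite opprD addrA subrr add0r enormN enormZ (gtr0_norm h0) ler_pM2l.
  apply: le_trans (pde_first h01 (sub _ (Dx0k j) al) alx0 (l_le1 j) z1) _.
  have e0 : h ^+ 2 / 2 / h <= 1.
    have -> : h ^+ 2 / 2 / h = h / 2 by field.
    by move: h1 h0; linear.
  rewrite !mulr1.
  have b1 : \sum_k `|fdiff2 h (l k) v x0| <= A1 by exact: sum_fdiff2_le_mixed.
  have b2 : \sum_k `|fdiff h (l k) v x0| <= n * N1 by apply: ler_sum_const.
  have b3 := vN0 x0.
  have b4 : c al (x0 + h *: l j) * fdiff h (l j) v x0 <= K * N1.
    apply: le_trans (ler_norm _) _; rewrite normrM ler_pM//.
    by case: (c_smooth al).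
  have b5 : \sum_k `|fdiff h (l k) (fdiff h (l j) v) x0| <= A1.
    by apply: ler_sum_term => i; exact: sumr_ge0.
  have b6 : K * (\sum_k `|fdiff2 h (l k) v x0| + \sum_k `|fdiff h (l k) v x0| +
     `|v x0| + 1) <= K * (A1 + n * N1 + N0 + 1).
    by rewrite ler_pM2l//; move: b1 b2 b3; linear.
  have b7 : 3 * K * \sum_k `|fdiff h (l k) (fdiff h (l j) v) x0| <= 3 * K * A1.
    by rewrite ler_wpM2l//; move: K0; linear.
  by move: e0 b4 b6 b7; rewrite /ew /C7; linear.
have ew0 : 0 <= ew.
  by have := mulr_ge0 (ltW K0) A10; move: C70; rewrite /ew; linear.
have q_ge k : delta / h ^+ 2 <= rate h al x0 k by exact: rate_ge.
have ub j : - m <= U j x0 <= T * m by rewrite UT andbT lerNl Um.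
have := bernstein hn0 (ltW delta_gt0) q_ge m0 (ltW eps0) (ltW kap0) Lu0 ew0 Wx0
  (Leu k0) Leu Lew ub (fun j => vN1 j x0).
pose S := \sum_j \sum_k fdiff h (l k) (fdiff h (l j) v) x0 ^+ 2.
pose SU := \sum_j \sum_k (fdiff h (l k) (U j) x0 / m) ^+ 2.
rewrite -/S -/SU => main.
(* As [z <= Rm], constants and first powers of [iz] are bounded by multiples of [E], the scale of
   the good term. *)
pose iz := z^-1; pose E := iz ^+ 2.
have iz0 : 0 < iz by rewrite invr_gt0.
have E0 : 0 < E by rewrite exprn_gt0.
have Rmiz : 1 <= Rm * iz by rewrite ler_pdivlMr// mul1r.
have RmE : 1 <= Rm ^+ 2 * E by rewrite /E -exprMn exprn_ege1.
have eum : eu / m <= 4 * K * Rm * (A1 / m) + C6 * E + C4 * (G * iz).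
  have -> : eu / m = z * (1 + K * C') / m + K * (2 * z + 9) * iz * (z * Q) / m
      + 4 * K * z * (A1 / m) + T * iz * (K * n * (2 * iz + 3)).
    rewrite /eu /iz; field; rewrite mne zne//.
  have p1 : z * (1 + K * C') / m <= Rm * Rm ^+ 2 * (1 + K * C') * E.
    apply: (@le_trans _ _ (z * (1 + K * C'))).
      rewrite ler_pdivrMr// ler_peMr// mulr_ge0 ?(ltW z0)// addr_ge0//.
    apply: (@le_trans _ _ (Rm * (1 + K * C'))).
      by rewrite ler_wpM2r// addr_ge0.
    have -> : Rm * Rm ^+ 2 * (1 + K * C') * E = Rm * (1 + K * C') * (Rm ^+ 2 * E) by ring.
    by rewrite ler_peMr// mulr_ge0// addr_ge0.
  have p2 : K * (2 * z + 9) * iz * (z * Q) / m <=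
     C4 * (G * iz) + 3 * n ^+ 2 * T * C4 * E.
    have -> : C4 * (G * iz) + 3 * n ^+ 2 * T * C4 * E =
      K * (2 * Rm + 9) * iz * (2 * (G * m) + 6 * n ^+ 2 * (T * m / z)) / m.
      by rewrite /C4 /E /iz; field; rewrite mne zne.
    have t1 : 0 <= 2 * z + 9 by move: z0; linear.
    have t2 : 2 * z + 9 <= 2 * Rm + 9 by move: zRm; linear.
    rewrite ler_pM2r ?invr_gt0// ler_pM ?mulr_ge0 ?(ltW K0) ?(ltW iz0) ?(ltW z0)//.
    by rewrite ler_pM2r// ler_pM2l.
  have p3 : 4 * K * z * (A1 / m) <= 4 * K * Rm * (A1 / m).
    rewrite ler_wpM2r ?divr_ge0 ?(ltW m0)// ler_wpM2l//; move: K0; linear.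
  have p4 : T * iz * (K * n * (2 * iz + 3)) <= T * (K * n * (2 + 3 * Rm)) * E.
    have -> : T * (K * n * (2 + 3 * Rm)) * E =
      T * iz * (K * n * (2 * iz + 3 * (Rm * iz))) by rewrite /E; ring.
    have t0 : 0 <= T by move: T1; linear.
    rewrite ler_wpM2l ?mulr_ge0 ?(ltW iz0)// ler_wpM2l ?mulr_ge0 ?(ltW K0)//.
    by move: Rmiz; linear.
  by rewrite /C6 /C5; move: p1 p2 p3 p4; linear.
have eum0 : 0 <= eu / m by rewrite divr_ge0 ?(ltW m0).
have b1 : 2 * eps * (T + 1) * n * (eu / m) <= eu / m.
  rewrite ler_piMl//.
  have : eps * (n * (T + 1)) <= eps * (n * TT).
    by rewrite ler_wpM2l ?(ltW eps0)// ler_wpM2l.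
  by move: epsn; linear.
have b2 : eta * \sum_k rate h al x0 k <= 1.
  apply: (@le_trans _ _ (eta * (n * (3 * K / h ^+ 2)))).
    by rewrite ler_pM2l// sum_rate_le.
  by rewrite mulrDr in eta1; move: eta1 eta0; linear.
have y1 := young_sum2 (2 * C4 * iz)
  (fun j k => fdiff h (l k) (U j) x0 / m) (mulr_gt0 eps0 dl0).
rewrite -/G -/SU in y1.
have {}y1 : 2 * C4 * iz * G <= eps * delta * SU + C8 * E.
  apply: le_trans y1 _; rewrite lerD2l /C8 /E.
  rewrite le_eqVlt; apply/orP; left; apply/eqP; rewrite /iz; field.
  by rewrite zne !gt_eqF.
(* One half of the lower-order squares absorbs the terms in [A1]; the other half gives the good
   term. *)
have kd2 : 0 < kap * delta / 2 by rewrite divr_gt0// mulr_gt0.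
have y2 := young_sum2 ((8 * K * Rm + 1) / m)
  (fun j k => fdiff h (l k) (fdiff h (l j) v) x0) kd2.
rewrite -/A1 -/S in y2.
have {}y2 : (8 * K * Rm + 1) / m * A1 <= kap * delta / 2 * S + C9.
  apply: le_trans y2 _; rewrite lerD2l.
  have -> : (#|{: I * I}|)%:R * ((8 * K * Rm + 1) / m) ^+ 2 / (4 * (kap * delta / 2))
     = C9 / B.
    by rewrite /C9 /kap; field; rewrite mne !gt_eqF.
  by rewrite ler_pdivrMr// ler_peMr.
have b3 : 16 * (kap * (n * N1 * K)) * A1 <= 1 / m * A1 by rewrite ler_wpM2r.
(* The second difference along [l k0] has size at least [m / (2 * z)] and is an iterated first
   difference; [kap] cancels the [m ^+ 2] in its square. *)
have b4 : B * delta / 8 * E <= kap * delta / 2 * S.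
  have -> : B * delta / 8 * E = kap * delta / 2 * (m / 2 * iz) ^+ 2.
    by rewrite -kapm /E; field.
  rewrite ler_wpM2l ?(ltW kd2)//.
  have d1 : m / 2 * iz <= - fdiff2 h (l k0) v x0.
    have half' : m / 2 <= - (z * fdiff2 h (l k0) v x0) := half.
    by rewrite ler_pdivrMr//; move: half'; linear.
  have d2 : (m / 2 * iz) ^+ 2 <= (- fdiff2 h (l k0) v x0) ^+ 2.
    by rewrite ler_pXn2r// nnegrE ?(le_trans _ d1)// mulr_ge0 ?divr_ge0 ?(ltW m0) ?(ltW iz0).
  apply: le_trans d2 _; rewrite fdiff2_mixed// opprK -l_o.
  apply: (@le_trans _ _ (\sum_k fdiff h (l k) (fdiff h (l k0) v) x0 ^+ 2)).
    apply: (ler_sum_term (F := fun k => fdiff h (l k) (fdiff h (l k0) v) x0 ^+ 2)).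
    by move=> k; exact: sqr_ge0.
  apply: (ler_sum_term (F := fun j => \sum_k fdiff h (l k) (fdiff h (l j) v) x0 ^+ 2)).
  by move=> j; apply: sumr_ge0 => k _; exact: sqr_ge0.
have b5 : C9 + 2 <= (C9 + 2) * Rm ^+ 2 * E.
  by rewrite -mulrA ler_peMr// addr_ge0.
have b6 : B * delta / 8 * E =
   (2 * C6 + C8 + (C9 + 2) * Rm ^+ 2 + 1) * E + delta / 8 * E.
  by rewrite /B; field; rewrite gt_eqF.
have dE : 0 < delta / 8 * E by rewrite mulr_gt0// divr_gt0.
have b7 : 4 * kap * N1 * n * ew =
  4 * (kap * (n * N1 * C7)) + 16 * (kap * (n * N1 * K)) * A1.
  by rewrite /ew; ring.
have b8 : (8 * K * Rm + 1) / m * A1 = 2 * (4 * K * Rm * (A1 / m)) + 1 / m * A1.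
  by field.
rewrite b7 in main; rewrite b8 in y2; rewrite b6 in b4.
move: main eum b1 b2 y1 y2 b3 b4 b5 kapNC dE E0.
clear - oK l_o l_le1 a_o delta_gt0 K_gt0 a_ge c_ge a_smooth b_smooth c_smooth f_smooth.
move=> main eum b1 b2 y1 y2 b3 b4 b5 kapNC dE E0; lra.
Qed.

End Scheme.

(** * Solvability of the difference equation *)

Lemma enorm_lipschitz_continuous {R : realType} {d : nat} (K : R)
    (phi : 'rV[R]_d -> R) :
  (forall x y, `|phi x - phi y| <= K * enorm (x - y)) -> continuous phi.
Proof.
move=> lip x; apply/(@cvgrPdist_le _ _ _ _ (nbhs_filter x)) => e e0.
have D1 : 0 < `|K| * d%:R + 1 by rewrite ltr_wpDl// mulr_ge0.
pose dl := e / (`|K| * d%:R + 1).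
have dl0 : 0 < dl by rewrite divr_gt0.
apply/nbhs_ballP; exists dl => //= y; rewrite -ball_normE/= => xy.
apply: le_trans (lip _ _) _.
have h1 : K * enorm (x - y) <= `|K| * enorm (x - y).
  by rewrite ler_wpM2r ?enorm_ge0// ler_norm.
apply: le_trans h1 _.
have h2 : `|K| * enorm (x - y) <= `|K| * (d%:R * `|x - y|).
  by rewrite ler_wpM2l// enorm_le_mx.
apply: le_trans h2 _; rewrite mulrA.
have h3 : `|K| * d%:R * `|x - y| <= `|K| * d%:R * dl.
  by rewrite ler_wpM2l ?mulr_ge0// ltW.
apply: le_trans h3 _.
have -> : e = (`|K| * d%:R + 1) * dl by rewrite /dl mulrCA divff ?gt_eqF// mulr1.
by rewrite ler_wpM2r ?(ltW dl0)// lerDl.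
Qed.

(** * Borel functions: shifts and sums *)

Section Borel.
Context {R : realType} {d : nat}.
Local Notation V := 'rV[R]_d.
Local Notation T := (g_sigma_algebraType (@open V)).
Implicit Types (u w : V -> R).

Lemma continuous_borel u : continuous u -> borel_fun u.
Proof.
move=> /continuousP cu; rewrite /borel_fun => mT.
apply: (measurability _ (RGenOpens.measurableE R)) => //.
move=> _ [_ [a [b ->] <-]]; rewrite setTI; apply: sub_sigma_algebra.
exact/cu/interval_open.
Qed.

Lemma measurable_shift (xi : V) : measurable_fun [set: T] ((fun x => x + xi) : T -> T).
Proof.
move=> mT; apply: (@measurability _ _ T T setT _ (@open V)) => //.
move=> _ [B oB <-]; rewrite setTI; apply: sub_sigma_algebra.
have /continuousP c : continuous (fun x : V => x + xi).
  by move=> x; apply: continuousD; [exact: cvg_id|exact: cst_continuous].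
exact: (c _ oB).
Qed.

Lemma borel_shift (xi : V) u : borel_fun u -> borel_fun (fun x => u (x + xi)).
Proof.
move=> mu mT B mB; have := measurable_shift xi mT (mu mT B mB).
by rewrite !setTI.
Qed.

Lemma borel_sum (I : finType) (u : I -> V -> R) :
  (forall i, borel_fun (u i)) -> borel_fun (fun x => \sum_i u i x).
Proof.
move=> mu; elim: (index_enum I) => [|i s IH].
  by under eq_fun do rewrite big_nil; exact: measurable_cst.
under eq_fun do rewrite big_cons; exact: (measurable_funD (mu i) IH).
Qed.

End Borel.

(** * Families of functions equicontinuous in the control *)

Section Equicontinuity.
Context {R : realType} {A : Type} {J : finType}.
Implicit Types (F G : A -> (J -> R) -> R) (z : J -> R).

(** Boundedness is included because uniform continuity in [al] alone is not stable under
    products. *)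
Definition equicont F := forall z, (exists M, forall al, `|F al z| <= M) /\
  forall e, 0 < e -> exists dl, 0 < dl /\ forall z',
    (forall j, `|z j - z' j| < dl) -> forall al, `|F al z - F al z'| <= e.

Lemma equicont_coord j : equicont (fun _ z => z j).
Proof.
move=> z; split; first by exists `|z j|.
by move=> e e0; exists e; split=> // z' zz' _; exact/ltW.
Qed.

Lemma equicontD F G : equicont F -> equicont G ->
  equicont (fun al z => F al z + G al z).
Proof.
move=> eF eG z; have [[M1 F1] F2] := eF z; have [[M2 G1] G2] := eG z; split.
  exists (M1 + M2) => al; rewrite (le_trans (ler_normD _ _))// lerD//.
move=> e e0; have e20 : 0 < e / 2 by rewrite divr_gt0.
have [d1 [d10 H1]] := F2 _ e20; have [d2 [d20 H2]] := G2 _ e20.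
exists (Num.min d1 d2); split; first by rewrite lt_min d10.
move=> z' zz' al.
have -> : F al z + G al z - (F al z' + G al z') =
  (F al z - F al z') + (G al z - G al z') by ring.
rewrite (le_trans (ler_normD _ _))// [leRHS]splitr lerD//.
  by apply: H1 => j; have := zz' j; rewrite lt_min => /andP[].
by apply: H2 => j; have := zz' j; rewrite lt_min => /andP[].
Qed.

Lemma equicontM F G : equicont F -> equicont G ->
  equicont (fun al z => F al z * G al z).
Proof.
move=> eF eG z; have [[M1 F1] F2] := eF z; have [[M2 G1] G2] := eG z.
have [al0|nA] := pselect (exists al : A, True); last first.
  split; first by exists 0 => al; case: nA; exists al.
  by move=> e _; exists 1; split=> // z' _ al; case: nA; exists al.
have [al0' _] := al0.
have M10 : 0 <= M1 := le_trans (normr_ge0 _) (F1 al0').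
have M20 : 0 <= M2 := le_trans (normr_ge0 _) (G1 al0').
split; first by exists (M1 * M2) => al; rewrite normrM ler_pM.
move=> e e0.
pose e1 := e / (2 * (M2 + e + 1)); pose e2 := Num.min e (e / (2 * (M1 + 1))).
have e10 : 0 < e1 by rewrite divr_gt0//; lra.
have e20 : 0 < e2 by rewrite lt_min e0 divr_gt0//; lra.
have [d1 [d10 H1]] := F2 _ e10; have [d2 [d20 H2]] := G2 _ e20.
exists (Num.min d1 d2); split; first by rewrite lt_min d10.
move=> z' zz' al.
have h1 : `|F al z - F al z'| <= e1.
  by apply: H1 => j; have := zz' j; rewrite lt_min => /andP[].
have h2 : `|G al z - G al z'| <= e2.
  by apply: H2 => j; have := zz' j; rewrite lt_min => /andP[].
have -> : F al z * G al z - F al z' * G al z' =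
  F al z * (G al z - G al z') + (F al z - F al z') * G al z' by ring.
have h3 : `|G al z'| <= M2 + e.
  have -> : G al z' = G al z - (G al z - G al z') by ring.
  rewrite (le_trans (ler_normB _ _))// lerD// (le_trans h2)//.
  by rewrite ge_min lexx.
have h4 : `|F al z * (G al z - G al z')| <= M1 * e2 by rewrite normrM ler_pM.
have h5 : `|(F al z - F al z') * G al z'| <= e1 * (M2 + e) by rewrite normrM ler_pM.
have h6 : M1 * e2 <= e / 2.
  have : e2 <= e / (2 * (M1 + 1)) by rewrite ge_min lexx orbT.
  move=> /(ler_wpM2l M10) h; apply: le_trans h _.
  rewrite mulrA ler_pdivrMr; [nra|lra].
have h7 : e1 * (M2 + e) <= e / 2.
  rewrite /e1 mulrAC ler_pdivrMr; [nra|lra].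
by apply: le_trans (ler_normD _ _) _; lra.
Qed.

Lemma equicont_cst (t : R) : equicont (fun _ _ => t).
Proof.
move=> z; split; first by exists `|t|.
by move=> e e0; exists 1; split=> // z' _ _; rewrite subrr normr0 ltW.
Qed.

Lemma equicont_sum (I : finType) (F : I -> A -> (J -> R) -> R) :
  (forall i, equicont (F i)) -> equicont (fun al z => \sum_i F i al z).
Proof.
move=> eF; elim: (index_enum I) => [|i s IH].
  rewrite (_ : (fun _ _ => _) = (fun _ _ => 0)); first exact: equicont_cst.
  by apply/funext => al; apply/funext => z; rewrite big_nil.
rewrite (_ : (fun _ _ => _) = (fun al z => F i al z + \sum_(i0 <- s) F i0 al z)).
  exact: equicontD.
by apply/funext => al; apply/funext => z; rewrite big_cons.
Qed.

(* [A] may be uncountable: this is what makes the supremum over [A] Borel. *)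
Lemma equicont_countable F : inhabited A -> equicont F ->
  exists s : nat -> A, forall z al t, t < F al z -> exists k, t < F (s k) z.
Proof.
move=> [al0] eF.
(* For each rational point and rational level, one control exceeding the level there is recorded, if
   any exists; such pairs are countable. *)
pose P (p : {ffun J -> rat} * rat) al :=
  ratr p.2 < F al (fun j => ratr (p.1 j)).
pose g p : A := if pselect (exists al, P p al) is left ex
  then projT1 (cid ex) else al0.
have gP p al : P p al -> P p (g p).
  move=> Pal; rewrite /g; case: pselect => [ex|]; last by case; exists al.
  exact: (projT2 (cid ex)).
exists (fun k => if unpickle k is Some p then g p else al0) => z al t tF.
(* The gap covers two moves by [e] between [z] and a rational point, and a rational level between
   [t + e] and [t + 2 * e]. *)
pose e := (F al z - t) / 4.
have e0 : 0 < e by rewrite divr_gt0// subr_gt0.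
have [_ /(_ e e0)[dl [dl0 H]]] := eF z.
have qz j : exists q : rat, `|z j - ratr q| < dl.
  have lt : z j - dl < z j + dl by rewrite ltrD2l gt0_cp.
  have [q] := rat_in_itvoo lt; rewrite in_itv/= => /andP[q1 q2].
  by exists q; rewrite ltr_distlC; apply/andP; split.
have [q zq] := choice qz.
have Hq be := H (fun j => ratr (q j)) zq be.
have lt2 : t + e < t + 2 * e by rewrite ltrD2l ltr_pMl// ltr1n.
have [r] := rat_in_itvoo lt2; rewrite in_itv/= => /andP[r1 r2].
pose p := ([ffun j => q j], r).
have qE : (fun j => ratr (p.1 j)) = (fun j => ratr (q j) : R).
  by apply/funext => j; rewrite ffunE.
have Pp : P p al.
  rewrite /P qE /=; have := Hq al; rewrite ler_norml => /andP[_ h].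
  rewrite /e in r2 h; lra.
exists (pickle p); rewrite pickleK.
have := gP _ _ Pp; rewrite {1}/P qE /= => h1.
have := Hq (g p); rewrite ler_norml => /andP[h2 _].
lra.
Qed.

End Equicontinuity.

(** * Comparison and monotone iteration *)

Section Solvability.
Context {R : realType} {d : nat} {I : finType} {A : Type}.
Local Notation V := 'rV[R]_d.
Variables (l : I -> V) (o : I -> I).
Variables (a b : A -> I -> V -> R) (c f : A -> V -> R) (delta K : R).
Hypotheses (oK : involutive o) (l_o : forall k, l (o k) = - l k)
  (a_o : forall al k x, a al (o k) x = a al k x)
  (delta_gt0 : 0 < delta) (K_gt0 : 0 < K)
  (a_ge : forall al k x, delta <= a al k x)
  (c_ge : forall al x, delta <= c al x)
  (a_smooth : forall al k, smooth_bound K (a al k))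
  (b_smooth : forall al k, smooth_bound K (b al k))
  (c_smooth : forall al, smooth_bound K (c al))
  (f_smooth : forall al, smooth_bound K (f al)).
Implicit Types (h : R) (al : A) (u v w : V -> R) (x y z xi : V).

Local Notation n := (#|I|%:R : R).
Local Notation res := (res l a b c f).
Local Notation rate := (rate a b).
Local Notation rate_max h := (3 * K / h ^+ 2).

Lemma resE h al u x : h != 0 ->
  res h al u x = gen h l (rate h al x) u x - c al x * u x + f al x.
Proof. by move=> h0; rewrite -(frozen_gen b oK l_o a_o). Qed.

Lemma rate_bound h al x k : 0 < h <= 1 -> K * h <= delta ->
  0 <= rate h al x k <= rate_max h.
Proof.
move=> h01 Kh; have /andP[h0 _] := h01.
by rewrite (rate_ge0 delta_gt0 a_ge b_smooth)// (rate_le K_gt0 a_smooth b_smooth).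
Qed.

Lemma sum_rate_bound h al x : 0 < h <= 1 ->
  \sum_k rate h al x k <= n * rate_max h.
Proof. exact: (sum_rate_le K_gt0 a_smooth b_smooth). Qed.

(** At a near maximum of [u - w] the generator of the difference is at most a tolerance, while
    [c >= delta] makes the zeroth-order term strictly negative. The control is nearly optimal for
    [u]; [w] satisfies its inequality for every control. *)
Lemma comparison h (D : set V) u w M : 0 < h <= 1 -> K * h <= delta ->
  (forall x, `|u x| <= M) -> (forall x, `|w x| <= M) ->
  (forall x, ~ D x -> u x <= w x) ->
  (forall x, D x -> forall eta, 0 < eta -> exists al, - eta <= res h al u x) ->
  (forall x, D x -> forall al, res h al w x <= 0) ->
  forall x, u x <= w x.
Proof.
have K0 := K_gt0; have dl0 := delta_gt0.
move=> h01 Kh uM wM bdry sub sup y; have /andP[h0 h1] := h01.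
have hn0 : h != 0 by rewrite gt_eqF.
rewrite leNgt; apply/negP; rewrite -subr_gt0 => t0.
set t := u y - w y in t0.
pose X := n * rate_max h.
have X0 : 0 <= X by rewrite mulr_ge0// divr_ge0 ?sqr_ge0//; lra.
(* The tolerances in the equation and at the maximum cost together at most [delta * t / 4], half of
   what the term in [c] yields. *)
pose eta := Num.min (t / 2) (delta * t / (4 * (1 + X))).
have eta0 : 0 < eta by rewrite lt_min !divr_gt0 ?mulr_gt0//; lra.
have eta1 : eta <= t / 2 by rewrite ge_min lexx.
have eta2 : eta * (1 + X) <= delta * t / 4.
  have : eta <= delta * t / (4 * (1 + X)) by rewrite ge_min lexx orbT.
  have X1 : 0 < 1 + X by lra.
  move=> /(ler_wpM2r (ltW X1)) le; apply: le_trans le _.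
  rewrite le_eqVlt; apply/orP; left; apply/eqP; field; lra.
have WM x : u x - w x <= 2 * M.
  have /ler_normlP[_] := uM x; have /ler_normlP[] := wM x; lra.
have [x0 Wx0] := approx_max y WM eta0.
have Wt : t / 2 <= u x0 - w x0 by have := Wx0 y; rewrite -/t; lra.
have [Dx0|nD] := pselect (D x0); last by have := bdry x0 nD; lra.
have [al alx0] := sub x0 Dx0 eta eta0.
have := sup x0 Dx0 al; move: alx0; rewrite !resE// => r1 r2.
have q0 k : 0 <= rate h al x0 k by have /andP[] := rate_bound al x0 k h01 Kh.
have g1 := gen_le h l q0 Wx0.
rewrite genD (_ : gen h l (rate h al x0) (fun y => - w y) x0 =
  - gen h l (rate h al x0) w x0) in g1; last first.
  by rewrite /gen -sumrN; apply: eq_bigr => k _; ring.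
have g2 : eta * \sum_k rate h al x0 k <= eta * X.
  by rewrite ler_pM2l// sum_rate_bound.
have g3 : delta * (t / 2) <= c al x0 * (u x0 - w x0).
  by rewrite ler_pM//; lra.
have : 0 < delta * t by rewrite mulr_gt0.
lra.
Qed.

Lemma res_bound h al u x M : 0 < h <= 1 -> K * h <= delta ->
  (forall y, `|u y| <= M) ->
  `|res h al u x| <= n * (rate_max h * (2 * M)) + K * M + K.
Proof.
move=> h01 Kh uM; have /andP[h0 _] := h01.
rewrite resE ?gt_eqF// (le_trans (ler_normD _ _))//.
apply: lerD; last by case: (f_smooth al).
rewrite (le_trans (ler_normB _ _))//; apply: lerD.
  apply: le_trans (ler_norm_sum _ _ _) _; apply: ler_sum_const => k.
  have /andP[q0 q1] := rate_bound al x k h01 Kh.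
  rewrite normrM (ger0_norm q0) ler_pM// (le_trans (ler_normB _ _))//.
  by rewrite mulr_natl mulr2n lerD.
by rewrite normrM ler_pM//; case: (c_smooth al).
Qed.

Definition bell h u x := sup [set res h al u x | al in [set: A]].

Hypothesis A_inh : inhabited A.

Lemma has_sup_res h u x M : 0 < h <= 1 -> K * h <= delta ->
  (forall y, `|u y| <= M) -> has_sup [set res h al u x | al in [set: A]].
Proof.
move=> h01 Kh uM; have [al0] := A_inh; split; first by exists (res h al0 u x), al0.
exists (n * (rate_max h * (2 * M)) + K * M + K) => _ [al _ <-].
by rewrite (le_trans (ler_norm _))// res_bound.
Qed.

Lemma res_le_bell h u x M al : 0 < h <= 1 -> K * h <= delta ->
  (forall y, `|u y| <= M) -> res h al u x <= bell h u x.
Proof.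
move=> h01 Kh uM; apply: (ub_le_sup (has_sup_res x h01 Kh uM).2).
by exists al.
Qed.

Lemma bell_le h u x B : (forall al, res h al u x <= B) -> bell h u x <= B.
Proof.
move=> uB; have [al0] := A_inh; apply: ge_sup; first by exists (res h al0 u x), al0.
by move=> _ [al _ <-].
Qed.

Lemma bell_solves h (D : set V) v M : 0 < h <= 1 -> K * h <= delta ->
  (forall y, `|v y| <= M) -> (forall x, D x -> bell h v x = 0) ->
  solves l a b c f h D v.
Proof.
move=> h01 Kh vM bv; split=> x Dx.
  by move=> al; rewrite -(bv x Dx) (res_le_bell _ _ h01 Kh vM).
move=> eta eta0.
have [_ [al _ <-]] := sup_adherent eta0 (has_sup_res x h01 Kh vM).
rewrite -/(bell h v x) (bv x Dx) sub0r => /ltW le; by exists al.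
Qed.

(** For fixed [h] the operator is Lipschitz in the finitely many values it reads. The constant, of
    order [h ^- 2], only serves the passage to the limit. *)
Lemma bell_dist h u w x M e : 0 < h <= 1 -> K * h <= delta ->
  (forall y, `|u y| <= M) -> (forall y, `|w y| <= M) ->
  `|u x - w x| <= e -> (forall k, `|u (x + h *: l k) - w (x + h *: l k)| <= e) ->
  `|bell h u x - bell h w x| <= (n * (rate_max h * 2) + K) * e.
Proof.
move=> h01 Kh uM wM ex ek; have /andP[h0 _] := h01.
have key al : `|res h al u x - res h al w x| <= (n * (rate_max h * 2) + K) * e.
  rewrite !resE ?gt_eqF//.
  have -> : gen h l (rate h al x) u x - c al x * u x + f al x -
    (gen h l (rate h al x) w x - c al x * w x + f al x) =
    \sum_k rate h al x k *
      ((u (x + h *: l k) - w (x + h *: l k)) - (u x - w x)) - c al x * (u x - w x).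
    have -> : \sum_k rate h al x k *
      ((u (x + h *: l k) - w (x + h *: l k)) - (u x - w x)) =
      gen h l (rate h al x) u x - gen h l (rate h al x) w x.
      by rewrite /gen -sumrB; apply: eq_bigr => k _; ring.
    ring.
  rewrite (le_trans (ler_normB _ _))// mulrDl; apply: lerD.
    apply: le_trans (ler_norm_sum _ _ _) _; rewrite -mulrA; apply: ler_sum_const => k.
    have /andP[q0 q1] := rate_bound al x k h01 Kh.
    rewrite normrM (ger0_norm q0) -mulrA ler_pM// (le_trans (ler_normB _ _))//.
    by rewrite mulr_natl mulr2n lerD.
  by rewrite normrM ler_pM//; case: (c_smooth al).
rewrite ler_distl; apply/andP; split.
  rewrite lerBlDr; apply: bell_le => al.
  have := key al; rewrite ler_distl => /andP[h1 _].
  have := res_le_bell x al h01 Kh uM; lra.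
apply: bell_le => al.
have := key al; rewrite ler_distl => /andP[_ h1].
have := res_le_bell x al h01 Kh wM; lra.
Qed.

(** Stability of an explicit time step: the condition on [s] keeps the weight remaining on [u x],
    one minus [s] times the total rate plus [c], nonnegative for every control. *)
Lemma bell_mono h u w x M s : 0 < h <= 1 -> K * h <= delta ->
  (forall y, `|u y| <= M) -> (forall y, `|w y| <= M) -> (forall y, u y <= w y) ->
  0 < s -> s * (n * rate_max h + K) <= 1 ->
  u x + s * bell h u x <= w x + s * bell h w x.
Proof.
move=> h01 Kh uM wM uw s0 s1; have /andP[h0 _] := h01.
suff : bell h u x <= (w x - u x) / s + bell h w x.
  move=> /(ler_wpM2l (ltW s0)); rewrite mulrDr mulrCA divff ?gt_eqF// mulr1; lra.
apply: bell_le => al.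
suff : res h al u x <= (w x - u x) / s + res h al w x.
  by have := res_le_bell x al h01 Kh wM; lra.
rewrite !resE ?gt_eqF//.
have g1 : gen h l (rate h al x) u x - gen h l (rate h al x) w x <=
    (\sum_k rate h al x k) * (w x - u x).
  rewrite /gen -sumrB mulr_suml; apply: ler_sum => k _.
  rewrite -mulrBr ler_wpM2l//; last by have := uw (x + h *: l k); lra.
  by have /andP[] := rate_bound al x k h01 Kh.
have wu : 0 <= w x - u x by rewrite subr_ge0.
have cK : c al x <= K by case: (c_smooth al) => /(_ x) /ler_normlP[].
have sr := sum_rate_bound al x h01.
have g2 : (\sum_k rate h al x k + c al x) * (w x - u x) <= (w x - u x) / s.
  rewrite mulrC ler_wpM2l// -[leRHS]mul1r ler_pdivlMr// mulrC.
  by apply: le_trans s1; rewrite ler_pM2l//; lra.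
by move: g1 g2; rewrite mulrDl; lra.
Qed.

(** The residual is a function, equicontinuous in the control, of finitely many numbers: the
    coordinates of [x] and the values of [u] at [x] and its neighbours. Countably many controls
    therefore give the supremum at every [x]. *)
Lemma bell_borel h u M : 0 < h <= 1 -> K * h <= delta ->
  (forall y, `|u y| <= M) -> borel_fun u -> borel_fun (bell h u).
Proof.
have K0 := K_gt0; have dl0 := delta_gt0.
move=> h01 Kh uM mu; have /andP[h0 _] := h01.
have hn0 : h != 0 by rewrite gt_eqF.
pose J := ('I_d + option I)%type.
pose X (z : J -> R) : V := \row_i z (inl i).
pose H al (z : J -> R) := \sum_k (2 / h ^+ 2 * a al k (X z) + 1 / h * b al k (X z)) *
    (z (inr (Some k)) + -1 * z (inr None)) + -1 * c al (X z) * z (inr None)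
    + f al (X z).
have eX (phi : A -> V -> R) : (forall al, smooth_bound K (phi al)) ->
    equicont (fun al (z : J -> R) => phi al (X z)).
  move=> sphi z; split; first by exists K => al; case: (sphi al).
  move=> e e0; pose dl := e / (K * (d%:R + 1)).
  have d1 : 0 < d%:R + 1 :> R by rewrite ltr_wpDl.
  exists dl; split; first by rewrite divr_gt0// mulr_gt0.
  move=> z' zz' al; case: (sphi al) => _ /(_ (X z) (X z')) le _; apply: le_trans le _.
  have : enorm (X z - X z') <= d%:R * dl.
    apply: le_trans (enorm_le_sum _) _; rewrite -[d in d%:R]card_ord.
    by apply: ler_sum_const => i; rewrite !mxE; exact/ltW.
  move=> /(ler_wpM2l (ltW K0)) le; apply: le_trans le _.
  have -> : e = K * ((d%:R + 1) * dl) by rewrite /dl; field; rewrite !gt_eqF.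
  rewrite ler_pM2l// ler_wpM2r//; last by rewrite lerDl.
  by rewrite divr_ge0 ?(ltW e0)// mulr_ge0 ?(ltW K0)// ltW.
have eH : equicont H.
  apply: equicontD; last exact: eX.
  apply: equicontD; last first.
    apply: equicontM; last exact: equicont_coord.
    by apply: equicontM; [exact: equicont_cst | exact: eX].
  have cst := @equicont_cst R A J.
  have coord := @equicont_coord R A J.
  apply: equicont_sum => k.
  have e1 := equicontM (cst (2 / h ^+ 2)) (eX (a^~ k) (a_smooth^~ k)).
  have e2 := equicontM (cst (1 / h)) (eX (b^~ k) (b_smooth^~ k)).
  have e3 := equicontD (coord (inr (Some k))) (equicontM (cst (-1)) (coord (inr None))).
  exact: equicontM (equicontD e1 e2) e3.
have [s sH] := equicont_countable A_inh eH.
pose Z x (j : J) : R := match j with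
  | inl i => x 0 i | inr (Some k) => u (x + h *: l k) | inr None => u x end.
have XZ x : X (Z x) = x by apply/rowP => i; rewrite mxE.
have HZ al x : H al (Z x) = res h al u x.
  rewrite resE// /H XZ /gen /=; congr (_ + _ + _); last by ring.
  by apply: eq_bigr => k _; rewrite /rate; field.
have mres k : borel_fun (res h (s k) u).
  have cont phi : smooth_bound K phi -> borel_fun phi.
    move=> [_ lip _]; apply: continuous_borel; exact: enorm_lipschitz_continuous lip.
  have -> : res h (s k) u = (fun x => \sum_i
      (2 / h ^+ 2 * a (s k) i x + 1 / h * b (s k) i x) *
        (u (x + h *: l i) + -1 * u x) + -1 * c (s k) x * u x + f (s k) x).
    by apply/funext => x; rewrite -HZ /H XZ.
  have mc (t : R) : borel_fun (fun _ : V => t) by exact: measurable_cst.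
  have mM (p q : V -> R) : borel_fun p -> borel_fun q -> borel_fun (fun x => p x * q x).
    by move=> ? ?; exact: measurable_funM.
  have mD (p q : V -> R) : borel_fun p -> borel_fun q -> borel_fun (fun x => p x + q x).
    by move=> ? ?; exact: measurable_funD.
  apply: (mD); last exact: cont.
  apply: (mD); last by apply: (mM) => //; apply: (mM) => //; exact: cont.
  apply: borel_sum => i; apply: (mM).
    by apply: (mD); apply: (mM) => //; apply: cont.
  by apply: (mD); [exact: borel_shift | apply: (mM)].
rewrite (_ : bell h u = fun x => sups (fun k => res h (s k) u x) 0).
  apply: measurable_fun_sups => // x _.
  exists (n * (rate_max h * (2 * M)) + K * M + K) => _ [k _ <-].
  by rewrite (le_trans (ler_norm _))// res_bound.
apply/funext => x; apply/le_anti/andP; split.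
  apply: bell_le => al; rewrite leNgt; apply/negP => lt.
  rewrite -HZ in lt; have [k] := sH _ _ _ lt; rewrite HZ ltNge => /negP; apply.
  apply: ub_le_sup; last by exists k.
  exists (n * (rate_max h * (2 * M)) + K * M + K) => _ [j _ <-].
  by rewrite (le_trans (ler_norm _))// res_bound.
apply: ge_sup; first by exists (res h (s 0%N) u x), 0%N.
by move=> _ [k _ <-]; exact: (res_le_bell _ _ h01 Kh uM).
Qed.

Lemma borel_if (D : set V) u w : open D -> borel_fun u -> borel_fun w ->
  borel_fun (fun x => if `[<D x>] then u x else w x).
Proof.
move=> oD mu mw; apply: measurable_fun_ifT => //.
apply: (measurable_fun_bool true) => //=; rewrite setTI.
apply: sub_sigma_algebra; rewrite (_ : _ @^-1` _ = D)//.
by apply/seteqP; split => x /=; [move/asboolP | move=> Dx; apply/asboolP].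
Qed.

(** Explicit time stepping from [- M] inside [D] increases and stays below [M]. The equation at a
    point reads finitely many values, so pointwise convergence suffices, and it preserves Borel
    measurability. *)
Lemma exists_solution h (D : set V) (g : V -> R) :
  0 < h <= 1 -> K * h <= delta -> open D -> (forall x, `|g x| <= K) ->
  borel_fun g -> exists v, [/\ forall x, `|v x| <= K + K / delta, borel_fun v,
    forall x, D x -> bell h v x = 0 & forall x, ~ D x -> v x = g x].
Proof.
have K0 := K_gt0; have dl0 := delta_gt0.
move=> h01 Kh oD gK mg; have /andP[h0 _] := h01.
have hn0 : h != 0 by rewrite gt_eqF.
(* Then [c * M >= K >= |f|], so the constants [M] and [- M] are a super- and a subsolution; and
   [M >= K] bounds [g]. *)
pose M := K + K / delta.
have M0 : 0 <= M by rewrite addr_ge0 ?divr_ge0 ?(ltW K0)// ltW.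
have dM : delta * M = delta * K + K by rewrite /M; field; rewrite gt_eqF.
have KM : K <= M by rewrite lerDl divr_ge0// ltW.
pose X := n * rate_max h + K.
have X0 : 0 < X.
  rewrite ltr_wpDl// mulr_ge0// divr_ge0 ?sqr_ge0//; lra.
pose s := X^-1.
have s0 : 0 < s by rewrite invr_gt0.
have s1 : s * (n * rate_max h + K) <= 1 by rewrite mulVf ?gt_eqF.
pose step u x := if `[<D x>] then u x + s * bell h u x else g x.
pose u_ k := iter k step (fun x => if `[<D x>] then - M else g x).
have cM (t : R) : `|t| <= M -> forall x : V, `|t| <= M by [].
have res_cst (t : R) al x : res h al (fun=> t) x = - (c al x * t) + f al x.
  by rewrite resE// /gen big1 ?sub0r// => k _; rewrite subrr mulr0.
have fK al x : `|f al x| <= K by case: (f_smooth al).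
have dK : 0 <= delta * K by rewrite mulr_ge0 ?(ltW K0)// ltW.
have cMd al x : delta * M <= c al x * M by rewrite ler_wpM2r.
have NM : `|- M| <= M by rewrite normrN ger0_norm.
have PM : `|M| <= M by rewrite ger0_norm.
have bM x : bell h (fun=> M) x <= 0.
  apply: bell_le => al; rewrite res_cst.
  by have /ler_normlP[_] := fK al x; have := cMd al x; lra.
have bNM x : 0 <= bell h (fun=> - M) x.
  have [al0] := A_inh.
  apply: le_trans (res_le_bell x al0 h01 Kh (cM _ NM)).
  rewrite res_cst mulrN opprK.
  by have /ler_normlP[+ _] := fK al0 x; have := cMd al0 x; lra.
have uM k x : `|u_ k x| <= M.
  elim: k x => [|k IH] x /=.
    by case: ifP => // _; exact: le_trans (gK x) KM.
  rewrite {1}/step; case: ifP => _; last exact: le_trans (gK x) KM.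
  rewrite ler_norml; apply/andP; split.
    apply: (@le_trans _ _ (- M + s * bell h (fun=> - M) x)).
      by rewrite lerDl mulr_ge0// ltW.
    apply: (bell_mono _ h01 Kh (cM _ NM) IH) => // y.
    by have := IH y; rewrite ler_norml => /andP[].
  apply: (@le_trans _ _ (M + s * bell h (fun=> M) x)).
    apply: (bell_mono _ h01 Kh IH (cM _ PM)) => // y.
    by have := IH y; rewrite ler_norml => /andP[].
  by rewrite gerDl mulr_ge0_le0// ltW.
have uS k x : u_ k x <= u_ k.+1 x.
  elim: k x => [|k IH] x.
    have := uM 1%N x; rewrite /u_/= /step; case: ifP => // _.
    by rewrite ler_norml => /andP[].
  rewrite -[leRHS]/(step (u_ k.+1) x) -[leLHS]/(step (u_ k) x) /step.
  by case: ifP => // _; exact: (bell_mono _ h01 Kh (uM k) (uM k.+1)).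
have mu k : borel_fun (u_ k).
  elim: k => [|k IH]; first by apply: borel_if => //; exact: measurable_cst.
  apply: borel_if => //; apply: measurable_funD => //.
  apply: measurable_funM; first exact: measurable_cst.
  exact: bell_borel h01 Kh (uM k) IH.
pose v x := sup (range (fun k => u_ k x)).
have uv x : (fun k => u_ k x) @ \oo --> v x.
  apply: nondecreasing_cvgn.
    by apply/nondecreasing_seqP => k; exact: uS.
  exists M => _ [k _ <-]; by have := uM k x; rewrite ler_norml => /andP[].
have vM x : `|v x| <= M.
  rewrite ler_norml; apply/andP; split.
    apply: (@le_trans _ _ (u_ 0%N x)).
      by have := uM 0%N x; rewrite ler_norml => /andP[].
    apply: ub_le_sup; last by exists 0%N.
    exists M => _ [k _ <-]; by have := uM k x; rewrite ler_norml => /andP[].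
  apply: ge_sup; first by exists (u_ 0%N x), 0%N.
  move=> _ [k _ <-]; by have := uM k x; rewrite ler_norml => /andP[].
exists v; split=> //.
- exact: (@measurable_fun_cvg _ (g_sigma_algebraType (@open V)) R setT u_ v mu
    (fun x _ => uv x)).
- move=> x Dx.
  have uE k : u_ k.+1 x = u_ k x + s * bell h (u_ k) x.
    by rewrite -[LHS]/(step (u_ k) x) /step asboolT.
  apply/eqP; rewrite -normr_le0; apply/ler_addgt0Pr => e e0; rewrite add0r.
  pose C := n * (rate_max h * 2) + K.
  have C0 : 0 < C.
    rewrite ltr_wpDl// mulr_ge0// mulr_ge0// divr_ge0 ?sqr_ge0//; lra.
  (* The first entry controls the change of the operator from [u_ k] to [v], the second its value at
     [u_ k], read off from one time step. *)
  pose e1 := Num.min (e / (2 * C)) (e * s / 4).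
  have e10 : 0 < e1 by rewrite lt_min !divr_gt0 ?mulr_gt0.
  have near1 y : \forall k \near \oo, `|v y - u_ k y| <= e1.
    by move: (uv y) => /cvgrPdist_le; exact.
  have near2 := filter_forall eventually_filter (fun k => near1 (x + h *: l k)).
  have nearS : \forall k \near \oo, `|v x - u_ k.+1 x| <= e1.
    have /cvgrPdist_le := uv x => /(_ e1 e10) [N _ HN].
    by exists N => // k Nk; exact: (HN k.+1 (leqW Nk)).
  near \oo => k.
  have h1 : `|v x - u_ k x| <= e1 by near: k; exact: near1.
  have h2 : `|v x - u_ k.+1 x| <= e1 by near: k.
  have h3 : forall j, `|v (x + h *: l j) - u_ k (x + h *: l j)| <= e1.
    by near: k; exact: near2.
  have h4 := bell_dist h01 Kh vM (uM k) h1 h3.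
  have h5 : `|bell h (u_ k) x| <= e / 2.
    have -> : bell h (u_ k) x = ((v x - u_ k x) - (v x - u_ k.+1 x)) / s.
      by rewrite uE; field; rewrite gt_eqF.
    rewrite normrM normfV (gtr0_norm s0) ler_pdivrMr//.
    apply: le_trans (ler_normB _ _) _.
    have : e1 <= e * s / 4 by rewrite ge_min lexx orbT.
    lra.
  have h6 : C * e1 <= e / 2.
    have : e1 <= e / (2 * C) by rewrite ge_min lexx.
    move=> /(ler_wpM2l (ltW C0)) le; apply: le_trans le _.
    rewrite le_eqVlt; apply/orP; left; apply/eqP; field; rewrite gt_eqF//.
  have -> : bell h v x = (bell h v x - bell h (u_ k) x) + bell h (u_ k) x by ring.
  apply: le_trans (ler_normD _ _) _; rewrite -/C in h4; lra.
- move=> x nDx; have uE k : u_ k x = g x.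
    by case: k => [|k]; rewrite /u_/= /step asboolF.
  have := uv x; have -> : (fun k => u_ k x) = (fun=> g x) by apply/funext => k.
  move=> cg; apply: (cvg_unique (@Rhausdorff R) cg); exact: cvg_cst.
Unshelve. all: by end_near.
Qed.

End Solvability.

(** * Mean values and distances *)

Section Calculus.
Context {R : realType} {d : nat}.
Local Notation V := 'rV[R]_d.
Implicit Types (f : V -> R) (x y xi : V).

Lemma derive_grad f x xi : differentiable f x -> 'D_xi f x = dotr (grad f x) xi.
Proof.
move=> df; rewrite deriveE// {1}(row_sum_delta xi) linear_sum.
apply: eq_bigr => i _; rewrite linearZ /= mxE /partial deriveE//.
by rewrite mulrC.
Qed.

Lemma is_derive_line f x xi (s : R) : (forall y, differentiable f y) ->
  is_derive s 1 (fun t => f (x + t *: xi)) (dotr (grad f (x + s *: xi)) xi).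
Proof.
move=> df; pose y := x + s *: xi.
have E : (fun h : R => h^-1 *: (((fun t => f (x + t *: xi)) \o shift s) (h *: 1)
            - (fun t => f (x + t *: xi)) s)) =
    (fun h => h^-1 *: ((f \o shift y) (h *: xi) - f y)).
  apply/funext => h /=; congr (_ *: (f _ - _)).
  by rewrite /y -[h *: 1]/(h * 1) mulr1 scalerDl addrCA.
have der : derivable f y xi by exact: diff_derivable.
apply: DeriveDef.
  by rewrite /derivable E.
by rewrite -derive_grad// /derive E.
Qed.

Lemma line_MVT f x xi : (forall y, differentiable f y) ->
  exists2 t : R, 0 <= t <= 1 &
    f (x + xi) - f x = dotr (grad f (x + t *: xi)) xi.
Proof.
move=> df; pose g t := f (x + t *: xi).
have dg (t : R) : is_derive t 1 g (dotr (grad f (x + t *: xi)) xi).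
  exact: is_derive_line.
have cg : {within `[0, 1], continuous g}.
  apply: continuous_subspaceT => t; apply: differentiable_continuous.
  by apply/derivable1_diffP; have [] := dg t.
have [t] := MVT_segment (@ler01 R) (fun t _ => dg t) cg.
rewrite in_itv/= => t01; rewrite /g scale1r scale0r addr0 subr0 mulr1 => e.
by exists t.
Qed.

End Calculus.

Section C11.
Context {R : realType} {d : nat}.
Local Notation V := 'rV[R]_d.
Implicit Types (f : V -> R) (x y xi : V).

(* Two mean values give the factor [2]: the intermediate points are [2 h |xi|] apart. *)
Lemma fdiff2_le_grad f (C h : R) xi x (S : set V) : 0 < h -> 0 <= C ->
  (forall y, differentiable f y) ->
  (forall t, -1 <= t <= 1 -> S (x + t *: (h *: xi))) ->
  (forall y z, S y -> S z -> enorm (grad f y - grad f z) <= C * enorm (y - z)) ->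
  `|fdiff2 h xi f x| <= 2 * C * enorm xi ^+ 2.
Proof.
move=> h0 C0 df Sx lip.
have [t t01 E1] := line_MVT x (h *: xi) df.
have [s s01 E2] := line_MVT (x + h *: - xi) (h *: xi) df.
rewrite scalerN subrK in E2.
have S1 : S (x + t *: (h *: xi)) by apply: Sx; lra.
have E3 : x - h *: xi + s *: (h *: xi) = x + (s - 1) *: (h *: xi).
  by rewrite scalerBl scale1r -addrA [- _ + _]addrC.
have S2 : S (x - h *: xi + s *: (h *: xi)) by rewrite E3; apply: Sx; lra.
have -> : fdiff2 h xi f x =
   dotr (grad f (x + t *: (h *: xi)) - grad f (x - h *: xi + s *: (h *: xi))) (h *: xi)
     / h ^+ 2.
  by rewrite dotrBl -E1 -E2 /fdiff2 /shiftT scalerN; congr (_ / _); ring.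
rewrite normrM [X in _ * X]ger0_norm ?invr_ge0 ?sqr_ge0//.
rewrite ler_pdivrMr ?exprn_gt0//.
apply: le_trans (dotr_le _ _) _.
have := lip _ _ S1 S2.
rewrite E3 opprD addrACA subrr add0r -scalerBl !enormZ (gtr0_norm h0) => le.
have le2 : C * (`|t - (s - 1)| * (h * enorm xi)) <= C * (2 * (h * enorm xi)).
  rewrite ler_wpM2l// ler_wpM2r ?mulr_ge0 ?enorm_ge0 ?(ltW h0)//.
  rewrite ler_norml; lra.
have := ler_wpM2r (mulr_ge0 (ltW h0) (enorm_ge0 xi)) (le_trans le le2).
by move=> le3; apply: le_trans le3 _; rewrite le_eqVlt; apply/orP; left; apply/eqP; ring.
Qed.

Lemma lip_le_grad f (C : R) x y (S : set V) : (forall y, differentiable f y) ->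
  (forall t, 0 <= t <= 1 -> S (y + t *: (x - y))) ->
  (forall z, S z -> enorm (grad f z) <= C) ->
  `|f x - f y| <= C * enorm (x - y).
Proof.
move=> df Sxy fC; have [t t01 E] := line_MVT y (x - y) df.
rewrite [y + (x - y)]addrC subrK in E; rewrite E; apply: le_trans (dotr_le _ _) _.
by rewrite ler_wpM2r ?enorm_ge0// fC//; exact: Sxy.
Qed.

Lemma C11_smooth_bound f (K : R) : (1 <= d)%N -> 0 < K -> is_C11 f ->
  (C11_norm f <= K%:E)%E -> smooth_bound (2 * K) f.
Proof.
move=> d1 K0 [df _ _ _]; rewrite /C11_norm.
set S1 := [set (`|f x|)%:E | x in [set: V]].
set S2 := [set (enorm (grad f x))%:E | x in [set: V]].
set S3 := [set _ | p in _] => fK.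
have pos1 : (0 <= ereal_sup S1)%E.
  apply: (@le_trans _ _ (`|f 0|)%:E); first by rewrite lee_fin.
  by apply: ereal_sup_ubound; exists 0.
have pos2 : (0 <= ereal_sup S2)%E.
  apply: (@le_trans _ _ (enorm (grad f 0))%:E); first by rewrite lee_fin enorm_ge0.
  by apply: ereal_sup_ubound; exists 0.
(* Positive dimension provides two distinct points; over an empty set of pairs this supremum would
   be [-oo] and the bound on the sum would say nothing. *)
have pos3 : (0 <= ereal_sup S3)%E.
  pose e : V := const_mx 1.
  have e0 : e != 0.
    apply/eqP => /rowP/(_ (Ordinal d1)); rewrite !mxE => /eqP; rewrite oner_eq0//.
  apply: (@le_trans _ _ (enorm (grad f e - grad f 0) / enorm (e - 0))%:E).
    by rewrite lee_fin divr_ge0 ?enorm_ge0.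
  by apply: ereal_sup_ubound; exists (e, 0).
have b1 x : `|f x| <= K.
  rewrite -lee_fin; apply: le_trans fK; apply: (@le_trans _ _ (ereal_sup S1)).
    by apply: ereal_sup_ubound; exists x.
  by rewrite -addeA leeDl// adde_ge0.
have b2 x : enorm (grad f x) <= K.
  rewrite -lee_fin; apply: le_trans fK; apply: (@le_trans _ _ (ereal_sup S2)).
    by apply: ereal_sup_ubound; exists x.
  by rewrite addeAC leeDr// adde_ge0.
have b3 x y : enorm (grad f x - grad f y) <= K * enorm (x - y).
  have [->|xy] := eqVneq x y; first by rewrite !subrr enorm0 mulr0.
  have xy0 : 0 < enorm (x - y).
    by rewrite (lt_le_trans _ (mx_le_enorm _))// normr_gt0 subr_eq0.
  rewrite -ler_pdivrMr// -lee_fin; apply: le_trans fK.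
  apply: (@le_trans _ _ (ereal_sup S3)).
    by apply: ereal_sup_ubound; exists (x, y).
  by rewrite leeDr// adde_ge0.
split.
- by move=> x; apply: le_trans (b1 x) _; lra.
- move=> x y.
  apply: (@le_trans _ _ (K * enorm (x - y))).
    by apply: (lip_le_grad (S := setT)) => // z _; exact: b2.
  by rewrite ler_wpM2r ?enorm_ge0//; lra.
- move=> h xi x h0.
  by apply: (fdiff2_le_grad (S := setT)) => //; exact: ltW.
Qed.

End C11.

(** * Distance to a set and inner domains *)

Section Distance.
Context {R : realType} {d : nat}.
Local Notation V := 'rV[R]_d.
Implicit Types (D : set V) (x y xi : V).

Lemma edist_to_le D x y : D y -> edist_to D x <= enorm (x - y).
Proof.
move=> Dy; apply: ge_inf; last by exists y.
by exists 0 => _ [z _ <-]; exact: enorm_ge0.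
Qed.

Lemma le_edist_to D x (t : R) : D !=set0 ->
  (forall y, D y -> t <= enorm (x - y)) -> t <= edist_to D x.
Proof.
move=> [y0 Dy0] tD; apply: lb_le_inf; first by exists (enorm (x - y0)), y0.
by move=> _ [y Dy <-]; exact: tD.
Qed.

Lemma edist_to_ge0 D x : D !=set0 -> 0 <= edist_to D x.
Proof. by move=> D0; apply: le_edist_to => // y _; exact: enorm_ge0. Qed.

Lemma edist_to_lip D x y : D !=set0 ->
  edist_to D x <= edist_to D y + enorm (x - y).
Proof.
move=> D0; rewrite -lerBlDr; apply: le_edist_to => // z Dz.
by rewrite lerBlDr addrC (le_trans (edist_to_le x Dz))// ler_enorm_distD.
Qed.

Lemma edist_to_shift D x xi (h : R) : D !=set0 -> 0 < h -> enorm xi <= 1 ->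
  edist_to D x - h <= edist_to D (x + h *: xi) <= edist_to D x + h.
Proof.
move=> D0 h0 xi1.
have hxi : enorm (h *: xi) <= h by rewrite enormZ (gtr0_norm h0) ler_piMr// ltW.
have := edist_to_lip x (x + h *: xi) D0; have := edist_to_lip (x + h *: xi) x D0.
rewrite opprD addrA subrr add0r enormN addrAC subrr add0r.
move: hxi => ? ? ?; apply/andP; split; lra.
Qed.

Lemma edist_to_eq0 D x : D !=set0 -> D x -> edist_to D x = 0.
Proof.
move=> D0 Dx; apply/le_anti; rewrite edist_to_ge0// andbT.
by rewrite (le_trans (edist_to_le x Dx))// subrr enorm0.
Qed.

Lemma edist_to_continuous D : D !=set0 -> continuous (edist_to D).
Proof.
move=> D0; apply: (@enorm_lipschitz_continuous _ _ 1) => x y; rewrite mul1r ler_distl.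
have := edist_to_lip x y D0; have := edist_to_lip y x D0; rewrite enormB.
by move=> ? ?; apply/andP; split; lra.
Qed.

Lemma not_inner_edist (Omega : set V) (h : R) x : 0 < h -> (~` Omega) !=set0 ->
  ~ inner_domain Omega h x -> edist_to (~` Omega) x <= h.
Proof.
move=> h0 C0 nin; have [Ox|nOx] := pselect (Omega x); last first.
  by rewrite edist_to_eq0// ltW.
rewrite leNgt; apply/negP => hx; apply: nin; split=> // _ [y y1 <-].
apply: contrapT => nO; have := edist_to_le x (nO : (~` Omega) (x + h *: y)).
rewrite opprD addrA subrr add0r enormN enormZ (gtr0_norm h0) leNgt => /negP; apply.
by apply: le_lt_trans hx; rewrite ler_piMr// ltW.
Qed.

Lemma closed_edist_attained D x : D !=set0 -> closed D ->
  exists2 y, D y & edist_to D x = enorm (x - y).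
Proof.
move=> D0 clD; have [y0 Dy0] := D0.
pose B := D `&` [set y | enorm (x - y) <= enorm (x - y0)].
have cont : continuous (fun y => enorm (x - y)).
  apply: (@enorm_lipschitz_continuous _ _ 1) => y z; rewrite mul1r ler_distl.
  have h1 := ler_enorm_distD z x y; have h2 := ler_enorm_distD y x z.
  rewrite (enormB z y) in h1.
  by apply/andP; split; lra.
have cB : compact B.
  apply: bounded_closed_compact.
    exists (enorm x + enorm (x - y0)); split; first exact: num_real.
    move=> M ltM y [_ /= yx]; apply: le_trans (ltW ltM).
    apply: le_trans (mx_le_enorm y) _.
    have -> : y = x - (x - y) by rewrite subKr.
    by rewrite (le_trans (ler_enormD _ _))// enormN lerD2l.
  apply: closedI => //.
  have -> : [set y | enorm (x - y) <= enorm (x - y0)] =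
     (fun y => enorm (x - y)) @^-1` [set t | t <= enorm (x - y0)] by [].
  apply: closed_comp; first by move=> y _; exact: cont.
  exact: closed_le.
have B0 : B !=set0 by exists y0; split => //=.
have [|y yB ymin] := compact_EVT_min B0 cB (f := fun y => enorm (x - y)).
  by apply: continuous_subspaceT; exact: cont.
move: yB; rewrite inE => -[Dy yy0]; exists y => //.
apply/le_anti; rewrite edist_to_le//=; apply: le_edist_to => // z Dz.
have [zz|zz] := leP (enorm (x - z)) (enorm (x - y0)).
  by apply: ymin; rewrite inE; split.
exact: le_trans yy0 (ltW zz).
Qed.

(** The distance to the closed complement is attained, so the inner domain is exactly where it
    exceeds [h]. Openness makes the iterates Borel. *)
Lemma open_inner (Omega : set V) (h : R) : 0 < h -> (~` Omega) !=set0 ->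
  open Omega -> open (inner_domain Omega h).
Proof.
move=> h0 C0 oO.
have -> : inner_domain Omega h = edist_to (~` Omega) @^-1` [set t | h < t].
  apply/seteqP; split => x /=.
    move=> [Ox xO]; rewrite ltNge; apply/negP => le.
    have [y Cy e] := closed_edist_attained x C0 (open_closedC oO).
    apply: Cy; have : unit_ball (h^-1 *: (y - x)).
      rewrite /unit_ball/= enormZ gtr0_norm ?invr_gt0// mulrC ler_pdivrMr// mul1r.
      by rewrite enormB -e.
    move=> yx; have := xO (x + h *: (h^-1 *: (y - x))).
    rewrite scalerA divff ?gt_eqF// scale1r addrC subrK; apply.
    exists (h^-1 *: (y - x)) => //.
    by rewrite scalerA divff ?gt_eqF// scale1r addrC subrK.
  move=> hx; apply: contrapT => /(not_inner_edist h0 C0); by rewrite leNgt hx.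
have /continuousP := edist_to_continuous C0; apply; exact: open_gt.
Qed.

End Distance.

(** * The boundary barrier *)

(** Decompositions chosen for the basis vectors are extended linearly, which makes the coefficients
    bounded by the norm. *)
Lemma span_coef {R : realType} {d d1 : nat} (l : sidx d1 -> 'rV[R]_d) :
  spans_space l -> exists (T : R) (s : 'rV[R]_d -> sidx d1 -> R), [/\ 0 <= T,
    forall x, x = \sum_k s x k *: l k & forall x k, `|s x k| <= T * enorm x].
Proof.
rewrite /spans_space => span.
pose X := [tuple of [seq l k | k <- enum (sidx d1)]].
have dec (x : 'rV[R]_d) : exists s : sidx d1 -> R, x = \sum_k s k *: l k.
  have : x \in <<X>>%VS by rewrite /= span memvf.
  move/coord_span => xE.
  exists (fun k => coord X (enum_rank k) x).
  rewrite {1}xE (reindex (@enum_rank _))/=; last first.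
    by apply: onW_bij; exact: enum_rank_bij.
  apply: eq_bigr => k _; congr (_ *: _).
  by rewrite (nth_map k) ?nth_enum_rank// -cardE.
have /choice[t te] (i : 'I_d) := dec (delta_mx 0 i).
pose T := \sum_i \sum_k `|t i k|.
exists T, (fun x k => \sum_i x 0 i * t i k); split.
- by apply: sumr_ge0 => i _; exact: sumr_ge0.
- move=> x; under eq_bigr do rewrite scaler_suml.
  rewrite exchange_big/= {1}(row_sum_delta x); apply: eq_bigr => i _.
  rewrite {1}(te i) scaler_sumr; apply: eq_bigr => k _; exact: scalerA.
- move=> x k; apply: le_trans (ler_norm_sum _ _ _) _.
  rewrite /T mulr_suml; apply: ler_sum => i _.
  rewrite normrM mulrC ler_pM// ?coord_le_enorm//.
  exact: ler_norm_sumr.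
Qed.

Lemma sqr_sumr_le {R : realType} {I : finType} (F : I -> R) :
  (\sum_k `|F k|) ^+ 2 <= #|I|%:R * \sum_k F k ^+ 2.
Proof.
have [I0|I0] := posnP #|I|.
  by rewrite I0 mul0r big1 ?expr0n// => k; have := fintype0 k I0.
have n0 : 0 < #|I|%:R :> R by rewrite ltr0n.
set Y := \sum_k `|F k|.
have := @young_sum _ _ (2 * Y / #|I|%:R) 1 F ltr01.
rewrite -/Y mul1r mulr1.
have -> : #|I|%:R * (2 * Y / #|I|%:R) ^+ 2 / 4 = Y ^+ 2 / #|I|%:R.
  by field; rewrite gt_eqF.
have -> : 2 * Y / #|I|%:R * Y = 2 * (Y ^+ 2 / #|I|%:R) by field; rewrite gt_eqF.
move=> h; have : Y ^+ 2 / #|I|%:R <= \sum_k F k ^+ 2 by lra.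
by rewrite ler_pdivrMr// mulrC.
Qed.

(** Expanding one factor of [dotr p p] in the spanning family bounds [enorm p] by the
    [dotr p (l k)]; Cauchy-Schwarz then gives squares. The barrier needs this nondegeneracy. *)
Lemma span_elliptic {R : realType} {d d1 : nat} (l : sidx d1 -> 'rV[R]_d) :
  spans_space l -> exists2 cl : R, 0 < cl &
    forall p, cl * enorm p ^+ 2 <= \sum_k dotr p (l k) ^+ 2.
Proof.
move=> /span_coef[T [s [T0 sE sT]]].
pose n : R := #|sidx d1|%:R.
have D0 : 0 < T ^+ 2 * n + 1 by rewrite ltr_wpDl// mulr_ge0 ?sqr_ge0.
exists (T ^+ 2 * n + 1)^-1; first by rewrite invr_gt0.
move=> p; rewrite mulrC ler_pdivrMr//.
set S := \sum_k _.
have S0 : 0 <= S by apply: sumr_ge0 => k _; exact: sqr_ge0.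
have h1 : enorm p ^+ 2 <= T * enorm p * \sum_k `|dotr p (l k)|.
  rewrite sqr_enorm {2}(sE p).
  have -> : dotr p (\sum_k s p k *: l k) = \sum_k s p k * dotr p (l k).
    rewrite dotrC; elim: (index_enum _) => [|k r IH].
      by rewrite !big_nil /dotr big1// => i _; rewrite mxE mul0r.
    by rewrite !big_cons dotrDl dotrZl IH [dotr (l k) p]dotrC.
  by apply: le_trans (ler_norm _) _; exact: ler_sumM.
have h2 : enorm p <= T * \sum_k `|dotr p (l k)|.
  have [->|p0] := eqVneq (enorm p) 0; first by rewrite mulr_ge0// sumr_ge0.
  have pp : 0 < enorm p by rewrite lt0r p0 enorm_ge0.
  by rewrite -(ler_pM2l pp) -expr2; move: h1; rewrite mulrAC mulrA [enorm p * T]mulrC mulrAC.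
have h3 : enorm p ^+ 2 <= (T * \sum_k `|dotr p (l k)|) ^+ 2.
  by rewrite ler_pXn2r// nnegrE ?enorm_ge0// mulr_ge0// sumr_ge0.
have h4 := ler_wpM2l (sqr_ge0 T) (sqr_sumr_le (fun k => dotr p (l k))).
apply: le_trans h3 _; rewrite exprMn; apply: le_trans h4 _.
by rewrite mulrDr mulr1 -/S -/n mulrA mulrC lerDl.
Qed.

(** * Quantitative properties of the defining function *)

Section DefiningFunction.
Context {R : realType} {d : nat}.
Local Notation V := 'rV[R]_d.
Variable psi : V -> R.
Implicit Types (x y z : V).
Hypotheses (d_ge1 : (1 <= d)%N) (psi_C2 : is_C2 psi).
Let Omega : set V := [set x | 0 < psi x].
Hypotheses (Omega_bdd : bounded_set Omega)
  (psi_grad : forall x, topo_boundary Omega x -> 1 <= enorm (grad psi x)).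

Lemma psi_differentiable x : differentiable psi x.
Proof. by case: psi_C2 => -[]. Qed.

Lemma psi_continuous : continuous psi.
Proof. by move=> x; apply: differentiable_continuous; exact: psi_differentiable. Qed.

Lemma C1_grad_bounded (phi : V -> R) (r : R) : is_C1 phi ->
  exists2 C, 0 <= C & forall x, `|x| <= r -> enorm (grad phi x) <= C.
Proof.
move=> [_ cphi].
have cB : compact [set x : V | `|x| <= r].
  apply: bounded_closed_compact.
    exists r; split; first exact: num_real.
    by move=> M rM x /= xr; exact: le_trans xr (ltW rM).
  have -> : [set x : V | `|x| <= r] = Num.norm @^-1` [set t | t <= r] by [].
  by apply: closed_comp; [move=> y _; exact: norm_continuous | exact: closed_le].
have bi (i : 'I_d) : exists C : R, 0 <= C /\ forall x, `|x| <= r -> `|partial i phi x| <= C.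
  have : compact (partial i phi @` [set x : V | `|x| <= r]).
    apply: continuous_compact => //; apply: continuous_subspaceT; exact: cphi.
  move=> /compact_bounded[M [_ HM]].
  exists (`|M| + 1); split=> [|x xr]; first by rewrite addr_ge0.
  apply: HM; last by exists x.
  by rewrite (le_lt_trans (ler_norm M))// ltrDl.
have [C HC] := choice bi.
exists (\sum_i C i); first by apply: sumr_ge0 => i _; case: (HC i).
move=> x xr; apply: le_trans (enorm_le_sum _) _; apply: ler_sum => i _.
by rewrite mxE; case: (HC i) => _; exact.
Qed.

Lemma ball_convex (r t : R) x y : `|x| <= r -> `|y| <= r -> 0 <= t <= 1 ->
  `|y + t *: (x - y)| <= r :> R.
Proof.
move=> xr yr /andP[t0 t1].
have -> : y + t *: (x - y) = (1 - t) *: y + t *: x.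
  by rewrite scalerBr scalerBl scale1r addrA addrAC.
apply: le_trans (ler_normD _ _) _.
rewrite !normrZ (ger0_norm t0) ger0_norm ?subr_ge0//.
have h1 : (1 - t) * `|y| <= (1 - t) * r by rewrite ler_wpM2l// subr_ge0.
have h2 : t * `|x| <= t * r by rewrite ler_wpM2l.
lra.
Qed.

(** A [C^2] function has bounds only on bounded sets, hence the ball. Its radius leaves a margin of
    one around [Omega], which settles the far points in [psi_le_edist]. *)
Lemma psi_bounds : exists r C : R, [/\ 0 <= C,
  forall x, Omega x -> `|x| <= r - 1,
  forall x y, `|x| <= r -> `|y| <= r -> `|psi x - psi y| <= C * enorm (x - y),
  forall x y, `|x| <= r -> `|y| <= r ->
    enorm (grad psi x - grad psi y) <= C * enorm (x - y) &
  forall x, Omega x -> psi x <= C].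
Proof.
have [M [_ HM]] := Omega_bdd.
pose r := `|M| + 2.
have Or x : Omega x -> `|x| <= r - 1.
  move=> Ox; rewrite /r (_ : `|M| + 2 - 1 = `|M| + 1); last by ring.
  by apply: HM => //; rewrite (le_lt_trans (ler_norm M))// ltrDl.
have r0 : 0 <= r by rewrite addr_ge0.
have [C1 C10 HC1] := C1_grad_bounded r psi_C2.1.
have bi (i : 'I_d) : exists C : R, 0 <= C /\ forall x, `|x| <= r ->
    enorm (grad (partial i psi) x) <= C.
  by have [C C0 HC] := C1_grad_bounded r (psi_C2.2 i); exists C.
have [C2 HC2] := choice bi.
have lip1 x y : `|x| <= r -> `|y| <= r -> `|psi x - psi y| <= C1 * enorm (x - y).
  move=> xr yr; apply: (lip_le_grad (S := [set z | `|z| <= r])) => //.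
    exact: psi_differentiable.
  by move=> t t01; exact: ball_convex.
have C2s : 0 <= \sum_i C2 i by apply: sumr_ge0 => i _; case: (HC2 i).
have dr : 0 <= C1 * (d%:R * r) by rewrite mulr_ge0// mulr_ge0.
exists r, (C1 + \sum_i C2 i + `|psi 0| + C1 * (d%:R * r)); split=> //.
- by rewrite !addr_ge0.
- move=> x y xr yr; apply: le_trans (lip1 x y xr yr) _.
  rewrite ler_wpM2r ?enorm_ge0//; have := normr_ge0 (psi 0); lra.
- move=> x y xr yr; apply: (@le_trans _ _ ((\sum_i C2 i) * enorm (x - y))).
    apply: le_trans (enorm_le_sum _) _; rewrite mulr_suml; apply: ler_sum => i _.
    rewrite !mxE; apply: (lip_le_grad (S := [set z | `|z| <= r])).
    + by case: (psi_C2.2 i).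
    + by move=> t t01; exact: ball_convex.
    + by move=> z zr; case: (HC2 i) => _; exact.
  rewrite ler_wpM2r ?enorm_ge0//; have := normr_ge0 (psi 0); lra.
- move=> x Ox; have xr : `|x| <= r by have := Or x Ox; lra.
  have := lip1 x 0 xr; rewrite normr0 subr0 => /(_ r0) /ler_normlP[_ h].
  have h2 : C1 * enorm x <= C1 * (d%:R * r).
    rewrite ler_wpM2l// (le_trans (enorm_le_mx _))// ler_wpM2l//.
  have := ler_norm (psi 0); lra.
Qed.

(** On the compact closure this continuous sum is positive, through [psi] inside and through the
    gradient on the boundary. Wherever [psi] is small, the gradient is thus bounded below. *)
Lemma psi_grad_pos : Omega !=set0 -> exists2 tau : R, 0 < tau &
  forall x, Omega x -> tau <= psi x + enorm (grad psi x) ^+ 2.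
Proof.
move=> [x0 Ox0].
pose F x := psi x + \sum_(i < d) partial i psi x * partial i psi x.
have FE x : F x = psi x + enorm (grad psi x) ^+ 2.
  by rewrite sqr_enorm /F; congr (_ + _); apply: eq_bigr => i _; rewrite !mxE.
have cF : continuous F.
  have cS : continuous (fun x => \sum_(i < d) partial i psi x * partial i psi x).
    elim: (index_enum _) => [|i s IH] x.
      under eq_fun do rewrite big_nil; exact: cst_continuous.
    rewrite (_ : (fun x => _) = (fun x => partial i psi x * partial i psi x +
      \sum_(j <- s) partial j psi x * partial j psi x)); last first.
      by apply/funext => y; rewrite big_cons.
    have ci := psi_C2.1.2 i x.
    exact: (continuousD (continuousM ci ci) (IH x)).
  by move=> x; exact: (continuousD (@psi_continuous x) (cS x)).
have [r [C [_ Or _ _ _]]] := psi_bounds.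
have cO : compact (closure Omega).
  apply: bounded_closed_compact; last exact: closed_closure.
  have sub : closure Omega `<=` [set x | `|x| <= r - 1].
    rewrite closureE; apply: smallest_sub => //.
    have -> : [set x : V | `|x| <= r - 1] = Num.norm @^-1` [set t | t <= r - 1] by [].
    by apply: closed_comp; [move=> y _; exact: norm_continuous | exact: closed_le].
  exists (r - 1); split; first exact: num_real.
  by move=> M rM x /sub /= xr; exact: le_trans xr (ltW rM).
have ne : closure Omega !=set0 by exists x0; exact: subset_closure.
have [|c] := compact_EVT_min ne cO (f := F).
  exact: continuous_subspaceT.
rewrite inE => cc cmin.
have psic : 0 <= psi c.
  have sub : closure Omega `<=` [set x | 0 <= psi x].
    rewrite closureE; apply: smallest_sub => //; last by move=> x /ltW.
    have -> : [set x : V | 0 <= psi x] = psi @^-1` [set t | 0 <= t] by [].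
    by apply: closed_comp; [move=> y _; exact: psi_continuous | exact: closed_ge].
  exact: sub.
exists (F c).
  rewrite FE; have [Oc|nOc] := pselect (Omega c).
    by rewrite ltr_pwDl ?sqr_ge0.
  have := psi_grad (conj cc (fun h => nOc (interior_subset h))) => g1.
  by rewrite ltr_wpDl// exprn_gt0// (lt_le_trans _ g1).
by move=> x Ox; rewrite -FE; apply: cmin; rewrite inE; exact: subset_closure.
Qed.

Lemma nonempty_compl : (~` Omega) !=set0.
Proof.
have [r [C [_ Or _ _ _]]] := psi_bounds.
pose e : V := const_mx (`|r| + 1).
exists e => Oe; have := Or e Oe.
have := coord_le_mx e (Ordinal d_ge1); rewrite mxE ger0_norm ?addr_ge0//.
have := ler_norm r; lra.
Qed.

Lemma psi_le_edist : exists2 C : R, 0 <= C &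
  forall x, Omega x -> psi x <= C * edist_to (~` Omega) x.
Proof.
have [r [C [C0 Or lip _ psiC]]] := psi_bounds.
exists (C + 1) => [|x Ox]; first by rewrite addr_ge0.
have C1 : 0 < C + 1 by lra.
rewrite -ler_pdivrMl// mulrC; apply: le_edist_to; first exact: nonempty_compl.
move=> y nOy; rewrite ler_pdivrMr//.
have e0 := enorm_ge0 (x - y).
have [yr|yr] := leP `|y| r.
  have xr : `|x| <= r by have := Or x Ox; lra.
  have /ler_normlP[_ h] := lip x y xr yr.
  have : psi y <= 0 by rewrite leNgt; apply/negP.
  lra.
have h1 : 1 <= enorm (x - y).
  apply: le_trans (mx_le_enorm _).
  have := Or x Ox; have := ler_normB x (x - y); rewrite subKr; lra.
have := psiC x Ox; nra.
Qed.

Lemma edist_bounded : exists2 C : R, 0 <= C &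
  forall x, edist_to (~` Omega) x <= C.
Proof.
have [r [C [C0 Or _ _ _]]] := psi_bounds.
have [y nOy] := nonempty_compl.
exists (d%:R * `|r| + enorm y) => [|x]; first by rewrite addr_ge0 ?mulr_ge0 ?enorm_ge0.
have [Ox|nOx] := pselect (Omega x); last first.
  by rewrite edist_to_eq0 ?addr_ge0 ?mulr_ge0 ?enorm_ge0//; exists y.
apply: le_trans (edist_to_le _ nOy) _.
apply: le_trans (ler_enormD _ _) _; rewrite enormN lerD2r.
apply: le_trans (enorm_le_mx _) _; rewrite ler_wpM2l//.
by have := Or x Ox; have := ler_norm r; lra.
Qed.

End DefiningFunction.

(** Replaces a derivative by a nearby difference quotient in a lower bound for squares. *)
Lemma half_sqr_le {R : realType} (D u e : R) : (u - D) ^+ 2 <= e ->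
  1 / 2 * D ^+ 2 - e <= u ^+ 2.
Proof. by move=> h; have := sqr_ge0 (2 * u - D); nra. Qed.

Section Barrier.
Context {R : realType} {d : nat} {I : finType} {A : Type}.
Local Notation V := 'rV[R]_d.
Variables (l : I -> V) (o : I -> I).
Variables (a b : A -> I -> V -> R) (c f : A -> V -> R) (delta K cl : R).
Hypotheses (oK : involutive o) (l_o : forall k, l (o k) = - l k)
  (l_le1 : forall k, enorm (l k) <= 1)
  (a_o : forall al k x, a al (o k) x = a al k x)
  (delta_gt0 : 0 < delta) (K_gt0 : 0 < K)
  (a_ge : forall al k x, delta <= a al k x)
  (c_ge : forall al x, delta <= c al x)
  (a_smooth : forall al k, smooth_bound K (a al k))
  (b_smooth : forall al k, smooth_bound K (b al k))
  (c_smooth : forall al, smooth_bound K (c al))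
  (f_smooth : forall al, smooth_bound K (f al))
  (cl_gt0 : 0 < cl)
  (elliptic : forall p, cl * enorm p ^+ 2 <= \sum_k dotr p (l k) ^+ 2).
Variable psi : V -> R.
Let Omega : set V := [set x | 0 < psi x].
Hypotheses (d_ge1 : (1 <= d)%N) (psi_C2 : is_C2 psi)
  (Omega_ne : Omega !=set0) (Omega_bdd : bounded_set Omega)
  (psi_grad : forall x, topo_boundary Omega x -> 1 <= enorm (grad psi x)).
Implicit Types (h : R) (al : A) (x y z : V).

Ltac linear := clear - oK l_o l_le1 a_o delta_gt0 K_gt0 a_ge c_ge a_smooth
  b_smooth c_smooth f_smooth cl_gt0 elliptic d_ge1 psi_C2 Omega_ne Omega_bdd
  psi_grad; lra.

Local Notation n := (#|I|%:R : R).
Local Notation rho := (edist_to (~` Omega)).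
Local Notation rate := (rate a b).

(* The barrier is the concave function [psi - (M/2) psi^2] of [psi], frozen above
   the level [1/(2M)]: near the boundary the square makes the generator negative,
   and above that level the term [c w] does. *)
Lemma barrier : exists (h0 sg C : R) (w : V -> R), [/\ 0 < h0 <= 1, 0 < sg, 0 <= C,
  forall x, 0 <= w x <= C * rho x & forall h x, 0 < h <= h0 -> K * h <= delta ->
    inner_domain Omega h x ->
    forall al, gen h l (rate h al x) w x - c al x * w x <= - sg].
Proof.
have K0 := K_gt0; have dl0 := delta_gt0; have cl0 := cl_gt0.
have [r [C [C0 Or lip glip psiC]]] := psi_bounds psi_C2 Omega_bdd.
have [tau tau0 Htau] := psi_grad_pos psi_C2 Omega_bdd psi_grad Omega_ne.
have [Cr Cr0 HCr] := psi_le_edist d_ge1 psi_C2 Omega_bdd.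
have n0 : 0 <= n by [].
pose C1 := 3 * n * K * C.
have C10 : 0 <= C1 by rewrite !mulr_ge0 ?(ltW K0).
(* Half of the ellipticity bound [cl * tau / 4]; the other half pays for replacing derivatives by
   differences. *)
pose c1 := cl * tau / 8.
have c10 : 0 < c1 by rewrite divr_gt0// mulr_gt0.
(* Large enough that the quadratic term beats the bound [C1] for the generator of [psi], and that
   [psi <= ts] forces the squared gradient above [tau / 2]. *)
pose M := 2 * (C1 + 1) / (delta * c1) + 2 / tau + 1.
have M1 : 0 <= 2 * (C1 + 1) / (delta * c1).
  by rewrite divr_ge0 ?mulr_ge0 ?(ltW dl0) ?(ltW c10)//; lra.
have M2 : 0 < 2 / tau by rewrite divr_gt0.
have M0 : 0 < M by rewrite /M; lra.
have Mc : C1 + 1 <= M / 2 * (delta * c1).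
  have : 2 * (C1 + 1) / (delta * c1) <= M by rewrite /M; lra.
  rewrite ler_pdivrMr ?mulr_gt0//; lra.
have Mtau : 1 / M <= tau / 2.
  have : 2 / tau <= M by rewrite /M; lra.
  rewrite !ler_pdivrMr//; lra.
pose ts := 1 / (2 * M).
have tsM : ts * M = 1 / 2 by rewrite /ts; field; rewrite gt_eqF.
have ts0 : 0 < ts by rewrite divr_gt0// mulr_gt0.
have tstau : ts <= tau / 2 by apply: le_trans Mtau; rewrite ler_pdivlMr//; lra.
pose G t := t - M / 2 * t ^+ 2.
have Ginc s t : 0 <= s -> s <= t -> t * M <= 1 -> G s <= G t.
  move=> s0 st tM; rewrite -subr_ge0.
  have -> : G t - G s = (t - s) * (1 - (t * M + s * M) / 2) by rewrite /G; field.
  have sM : s * M <= t * M by rewrite ler_pM2r.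
  by rewrite mulr_ge0//; lra.
have Gts : 0 < G ts.
  have -> : G ts = ts * (1 - (ts * M) / 2) by rewrite /G; field.
  by rewrite tsM mulr_gt0//; lra.
pose w x := if `[<Omega x>] then (if psi x <= ts then G (psi x) else G ts) else 0.
(* The second entry bounds the error of replacing derivatives by differences; with the third, a step
   from below the level [ts] keeps [psi] below [2 * ts = 1 / M], where [G] increases. *)
pose h0 := Num.min 1 (Num.min (c1 / (n * C ^+ 2 + 1)) (ts / (C + 1))).
have X0 : 0 < n * C ^+ 2 + 1 by rewrite ltr_wpDl// mulr_ge0// sqr_ge0.
have C1' : 0 < C + 1 by lra.
pose sg := Num.min 1 (delta * G ts).
have w0 x : 0 <= w x.
  rewrite /w; case: ifPn => // /asboolP Ox; case: ifPn => [le|_]; last exact: ltW.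
  have psi0 : 0 < psi x by [].
  rewrite (_ : 0 = G 0); last by rewrite /G expr0n mulr0 subr0.
  apply: Ginc => //; first exact: ltW.
  have : psi x * M <= ts * M by rewrite ler_pM2r.
  lra.
exists h0, sg, Cr, w; split => //.
- apply/andP; split.
    by rewrite !lt_min ltr01 (divr_gt0 c10 X0) (divr_gt0 ts0 C1').
  by rewrite ge_min lexx.
- by rewrite lt_min ltr01 (mulr_gt0 dl0 Gts).
- move=> x; rewrite w0/= /w; case: ifPn => [/asboolP Ox|_]; last first.
    by rewrite mulr_ge0// edist_to_ge0//; exact: (nonempty_compl d_ge1 psi_C2 Omega_bdd).
  have Gle t : G t <= t by rewrite gerBl mulr_ge0 ?sqr_ge0// divr_ge0// ltW.
  have le := HCr x Ox.
  case: ifPn => [le2|]; first exact: le_trans (Gle _) le.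
  rewrite -ltNge => gt; exact: le_trans (le_trans (Gle _) (ltW gt)) le.
move=> h x /andP[hp hh] Kh [Ox Oxh] al.
have := hh; rewrite !le_min => /and3P[h1 h2 h3].
have hn0 : h != 0 by rewrite gt_eqF.
have h01 : 0 < h <= 1 by rewrite hp.
have Oseg k (t : R) : -1 <= t <= 1 -> Omega (x + t *: (h *: l k)).
  move=> t1; apply: Oxh; exists (t *: l k).
    rewrite /unit_ball/= enormZ -[leRHS]mulr1 ler_pM ?enorm_ge0//.
    by rewrite ler_norml.
  by rewrite !scalerA mulrC.
have Oxk k : Omega (x + h *: l k).
  by have := Oseg k 1; rewrite scale1r; apply; rewrite lexx andbT; lra.
have inr y : Omega y -> `|y| <= r by move=> /Or; lra.
have q_ge k : delta / h ^+ 2 <= rate h al x k by exact: (rate_ge a_ge b_smooth).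
have q0 k : 0 <= rate h al x k by exact: (rate_ge0 delta_gt0 a_ge b_smooth).
have fd k : `|fdiff h (l k) psi x| <= C.
  rewrite /fdiff /shiftT normrM normfV (gtr0_norm hp) ler_pdivrMr//.
  apply: le_trans (lip _ _ (inr _ (Oxk k)) (inr _ Ox)) _.
  rewrite addrAC subrr add0r enormZ (gtr0_norm hp) ler_wpM2l//.
  by rewrite ler_piMr// ltW.
have fd2 k : `|fdiff2 h (l k) psi x| <= 2 * C.
  apply: (@le_trans _ _ (2 * C * enorm (l k) ^+ 2)).
    apply: (fdiff2_le_grad (S := [set y | `|y| <= r])) => //.
    - exact: psi_differentiable.
    - by move=> t t1; apply: inr; exact: Oseg.
  by rewrite ler_piMr// ?mulr_ge0// expr_le1// enorm_ge0.
have nb k : psi (x + h *: l k) <= psi x + ts.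
  rewrite (shift_fdiff (l k) psi x hn0) lerD2l.
  have /ler_normlP[_ fk] := fd k.
  have e1 : h * fdiff h (l k) psi x <= h * C by rewrite ler_pM2l.
  apply: le_trans e1 _; move: h3; rewrite ler_pdivlMr//; lra.
have wGs k : psi (x + h *: l k) * M <= 1 -> w (x + h *: l k) <= G (psi (x + h *: l k)).
  move=> le1; rewrite /w asboolT//; case: ifPn => //; rewrite -ltNge => gt.
  by apply: Ginc => //; exact: ltW.
have wle y : w y <= G ts.
  rewrite /w; case: ifPn => [/asboolP Oy|_]; last exact: ltW.
  case: ifPn => // le; apply: Ginc => //; first exact: ltW.
  by rewrite tsM; lra.
have cw : 0 <= c al x * w x by rewrite mulr_ge0// (le_trans (ltW dl0)).
have [le|gt] := leP (psi x) ts; last first.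
  have wx : w x = G ts by rewrite /w asboolT// leNgt gt.
  have g0 : gen h l (rate h al x) w x <= 0.
    by apply: sumr_le0 => k _; rewrite wx mulr_ge0_le0// subr_le0.
  have g1 : delta * G ts <= c al x * w x by rewrite wx ler_pM2r.
  have : sg <= delta * G ts by rewrite ge_min lexx orbT.
  by move: g0 g1; linear.
have wx : w x = G (psi x) by rewrite /w asboolT// le.
have psix : psi x * M <= 1 / 2 by rewrite -tsM ler_pM2r.
have psi0 : 0 <= psi x * M by rewrite mulr_ge0// ltW.
pose t k := psi (x + h *: l k) - psi x.
(* [G] is quadratic, so its second-order expansion at [psi x] is exact. *)
have gw : gen h l (rate h al x) w x <=
    (1 - psi x * M) * gen h l (rate h al x) psi x - M / 2 * \sum_k rate h al x k * t k ^+ 2.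
  rewrite /gen !mulr_sumr -sumrB; apply: ler_sum => k _.
  have -> : (1 - psi x * M) * (rate h al x k * (psi (x + h *: l k) - psi x)) -
    M / 2 * (rate h al x k * t k ^+ 2) =
    rate h al x k * (G (psi (x + h *: l k)) - G (psi x)) by rewrite /G /t; field.
  rewrite ler_wpM2l// wx lerD2r wGs//.
  have : psi (x + h *: l k) * M <= (psi x + ts) * M by rewrite ler_pM2r.
  by move: psix; rewrite mulrDl tsM; linear.
have gpsi : `|gen h l (rate h al x) psi x| <= C1.
  rewrite -(frozen_gen b oK l_o a_o)//; apply: le_trans (ler_normD _ _) _.
  have aK k : `|a al k x| <= K by case: (a_smooth al k).
  have bK k : `|b al k x| <= K by case: (b_smooth al k).
  have e1 : `|\sum_k a al k x * fdiff2 h (l k) psi x| <= K * (n * (2 * C)).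
    apply: le_trans (ler_sumM _ aK) _; rewrite ler_wpM2l ?(ltW K0)//.
    exact: ler_sum_const.
  have e2 : `|\sum_k b al k x * fdiff h (l k) psi x| <= K * (n * C).
    apply: le_trans (ler_sumM _ bK) _; rewrite ler_wpM2l ?(ltW K0)//.
    exact: ler_sum_const.
  by move: e1 e2; rewrite /C1; linear.
have qt : delta * \sum_k fdiff h (l k) psi x ^+ 2 <= \sum_k rate h al x k * t k ^+ 2.
  rewrite mulr_sumr; apply: ler_sum => k _.
  have -> : delta * fdiff h (l k) psi x ^+ 2 = delta / h ^+ 2 * t k ^+ 2.
    by rewrite /t /fdiff /shiftT; field.
  by rewrite ler_wpM2r// sqr_ge0.
have gpos : c1 <= \sum_k fdiff h (l k) psi x ^+ 2.
  have per k : 1 / 2 * dotr (grad psi x) (l k) ^+ 2 - C ^+ 2 * h <=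
      fdiff h (l k) psi x ^+ 2.
    have [s s01 E] := line_MVT x (h *: l k) (psi_differentiable psi_C2).
    pose p := x + s *: (h *: l k).
    have fE : fdiff h (l k) psi x = dotr (grad psi p) (l k).
      by rewrite /fdiff /shiftT E dotrC dotrZl dotrC; field.
    have pr : `|p| <= r by apply: inr; apply: Oseg; move: s01 => /andP[]; linear.
    have e1 : `|dotr (grad psi p - grad psi x) (l k)| <= C * h.
      apply: le_trans (dotr_le _ _) _; rewrite -[leRHS]mulr1.
      rewrite ler_pM ?enorm_ge0//; apply: le_trans (glip _ _ pr (inr _ Ox)) _.
      rewrite /p addrAC subrr add0r !enormZ (gtr0_norm hp) ler_wpM2l//.
      have /andP[s0 s1] := s01; rewrite (ger0_norm s0).
      have e2 : h * enorm (l k) <= h by rewrite ler_piMr// ltW.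
      by rewrite (le_trans _ e2)// ler_piMl// mulr_ge0 ?enorm_ge0// ltW.
    have e2 : (C * h) ^+ 2 <= C ^+ 2 * h.
      by rewrite exprMn ler_wpM2l ?sqr_ge0// expr2 ler_piMr// ltW.
    rewrite dotrBl in e1; rewrite fE.
    have e3 : (dotr (grad psi p) (l k) - dotr (grad psi x) (l k)) ^+ 2 <= (C * h) ^+ 2.
      rewrite -[leLHS]real_normK ?num_real// ler_pXn2r// nnegrE//.
      by rewrite mulr_ge0// ltW.
    exact: half_sqr_le (le_trans e3 e2).
  have e1 : \sum_k (1 / 2 * dotr (grad psi x) (l k) ^+ 2 - C ^+ 2 * h) <=
     \sum_k fdiff h (l k) psi x ^+ 2 by apply: ler_sum.
  apply: le_trans e1; rewrite sumrB -mulr_sumr sumr_constE.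
  have e2 := elliptic (grad psi x).
  have e3 : tau / 2 <= enorm (grad psi x) ^+ 2.
    by have := Htau x Ox; move: le tstau; linear.
  have e4 : cl * (tau / 2) <= cl * enorm (grad psi x) ^+ 2 by rewrite ler_pM2l.
  have e5 : n * (C ^+ 2 * h) <= c1.
    by move: h2 hp; rewrite ler_pdivlMr//; linear.
  by move: e2 e4 e5; rewrite /c1; linear.
have fin1 : (1 - psi x * M) * gen h l (rate h al x) psi x <= C1.
  have e1 : gen h l (rate h al x) psi x <= C1 by exact: le_trans (ler_norm _) gpsi.
  have e2 : 0 <= 1 - psi x * M by move: psix; linear.
  have := ler_wpM2l e2 e1; have : 0 <= psi x * M * C1 by rewrite mulr_ge0.
  by linear.
have fin2 : M / 2 * (delta * c1) <= M / 2 * \sum_k rate h al x k * t k ^+ 2.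
  rewrite ler_wpM2l ?divr_ge0 ?(ltW M0)//; apply: le_trans qt.
  by rewrite ler_pM2l.
have : sg <= 1 by rewrite ge_min lexx.
by move: gw fin1 fin2 Mc cw; linear.
Qed.

(** With [N * sg] equal to a bound for the residual of [g], the functions [g + N * w] and
    [g - N * w] are a super- and a subsolution; comparison puts [v] between them. *)
Lemma boundary_estimate (g : V -> R) (Mv : R) : smooth_bound K g -> 0 <= Mv ->
  exists h0 N : R, [/\ 0 < h0 <= 1, 0 <= N & forall h v, 0 < h <= h0 ->
    K * h <= delta -> solves l a b c f h (inner_domain Omega h) v ->
    (forall x, `|v x| <= Mv) -> (forall x, ~ inner_domain Omega h x -> v x = g x) ->
    forall x, `|v x - g x| <= N * rho x].
Proof.
have K0 := K_gt0; have dl0 := delta_gt0.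
move=> sg_g Mv0.
have [h0 [sg [C [w [h01 sg0 C0 wrho wsup]]]]] := barrier.
have [Cr Cr0 HCr] := edist_bounded d_ge1 psi_C2 Omega_bdd.
pose Cg := K * (n * K) + K * (n * K) + K * K + K.
have Cg0 : 0 <= Cg.
  have KnK : 0 <= K * (n * K) by rewrite !mulr_ge0// ltW.
  by have := mulr_gt0 K0 K0; rewrite /Cg; lra.
pose N := Cg / sg.
have N0 : 0 <= N by rewrite divr_ge0// ltW.
exists h0, (N * C); split => //; first by rewrite mulr_ge0.
move=> h v /andP[hp hh] Kh sol vM vg x; have [sub sup] := sol.
have h01' : 0 < h <= 1 by have /andP[_ ?] := h01; rewrite hp/=; lra.
have hn0 : h != 0 by rewrite gt_eqF.
have [gK _ g2] := sg_g.
have resg al y : `|res l a b c f h al g y| <= Cg.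
  rewrite /res /frozen; apply: le_trans (ler_normD _ _) _.
  apply: lerD; last by case: (f_smooth al).
  apply: le_trans (ler_normB _ _) _; apply: lerD; last first.
    by rewrite normrM ler_pM//; case: (c_smooth al).
  have aK k : `|a al k y| <= K by case: (a_smooth al k).
  have bK k : `|b al k y| <= K by case: (b_smooth al k).
  apply: le_trans (ler_normD _ _) _; apply: lerD.
    apply: le_trans (ler_sumM _ aK) _; rewrite ler_wpM2l ?(ltW K0)//.
    apply: ler_sum_const => k; apply: le_trans (g2 h (l k) y hp) _.
    by rewrite ler_piMr ?(ltW K0)// expr_le1// enorm_ge0.
  apply: le_trans (ler_sumM _ bK) _; rewrite ler_wpM2l ?(ltW K0)//.
  apply: ler_sum_const => k; apply: le_trans (fdiff_le (l k) y hp sg_g) _.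
  by rewrite ler_piMr ?(ltW K0).
have reslin al y (t : R) : res l a b c f h al (fun z => g z + t * w z) y =
   res l a b c f h al g y + t * (gen h l (rate h al y) w y - c al y * w y).
  by rewrite !(resE b c f oK l_o a_o)// genD genZ; ring.
have w0 y : 0 <= w y by have /andP[] := wrho y.
have wM y : w y <= C * Cr.
  by have /andP[_ h1] := wrho y; apply: le_trans h1 _; rewrite ler_wpM2l.
have Nw0 y : 0 <= N * w y := mulr_ge0 N0 (w0 y).
have NwM y : N * w y <= N * (C * Cr) by rewrite ler_wpM2l.
pose MM := Mv + K + N * (C * Cr).
have NCr : 0 <= N * (C * Cr) := mulr_ge0 N0 (mulr_ge0 C0 Cr0).
have vMM y : `|v y| <= MM by apply: le_trans (vM y) _; rewrite /MM; lra.
have NsgE : N * sg = Cg by rewrite divfK// gt_eqF.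
have up y : v y <= g y + N * w y.
  apply: (comparison oK l_o a_o delta_gt0 K_gt0 a_ge c_ge a_smooth b_smooth h01' Kh
    (f := f) (D := inner_domain Omega h) (M := MM) (w := fun z => g z + N * w z)) => //.
  - move=> z; have := NwM z; have := Nw0 z; have /ler_normlP[] := gK z => *.
    by rewrite ler_norml /MM; apply/andP; split; lra.
  - by move=> z nD; rewrite vg// lerDl.
  - move=> z Dz al; rewrite reslin.
    have h2 : 0 < h <= h0 by rewrite hp.
    have := ler_wpM2l N0 (wsup h z h2 Kh Dz al).
    by have := le_trans (ler_norm _) (resg al z); rewrite mulrN NsgE; lra.
have lo y : g y + - N * w y <= v y.
  apply: (comparison oK l_o a_o delta_gt0 K_gt0 a_ge c_ge a_smooth b_smooth h01' Kh
    (f := f) (D := inner_domain Omega h) (M := MM) (u := fun z => g z + - N * w z)) => //.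
  - move=> z; have := NwM z; have := Nw0 z; have /ler_normlP[] := gK z => *.
    by rewrite ler_norml /MM; apply/andP; split; lra.
  - by move=> z nD; rewrite vg// mulNr gerBl.
  - move=> z Dz eta eta0; have [al _] := sup z Dz eta eta0; exists al; rewrite reslin.
    have h2 : 0 < h <= h0 by rewrite hp.
    have := ler_wpM2l N0 (wsup h z h2 Kh Dz al).
    by have /ler_normlP[] := resg al z; rewrite mulrN NsgE mulNr; lra.
have /andP[_ wx] := wrho x.
have NwC : N * w x <= N * C * rho x by rewrite -mulrA ler_wpM2l.
by have := up x; have := lo x; rewrite mulNr => ? ?; rewrite ler_norml; apply/andP; split; lra.
Qed.

End Barrier.

(** * Lattice steps and mixed differences *)

Section Lipschitz.
Context {R : realType} {d : nat}.
Local Notation V := 'rV[R]_d.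
Variables (v : V -> R) (h N : R).
Hypotheses (h_gt0 : 0 < h) (N_ge0 : 0 <= N).

(** The length is cut into whole steps [h] and one shorter step, which is a step [h] along [r *: xi]
    with [0 <= r <= 1]. Hence the need for shortened directions, and the extra summand [h]. *)
Lemma dist_multiple (xi : V) (t : R) y :
  (forall s, 0 <= s <= 1 -> forall x, `|fdiff h (s *: xi) v x| <= N) ->
  `|v (y + t *: xi) - v y| <= N * (`|t| + h).
Proof.
move=> vN.
have step s x : 0 <= s <= 1 -> `|v (x + h *: (s *: xi)) - v x| <= N * h.
  move=> s01; have := vN s s01 x; rewrite /fdiff /shiftT normrM normfV.
  by rewrite (gtr0_norm h_gt0) ler_pdivrMr.
have steps m x : `|v (x + (m%:R * h) *: xi) - v x| <= N * (m%:R * h).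
  elim: m => [|m IH]; first by rewrite !mul0r scale0r addr0 subrr normr0 mulr0.
  have := step 1 (x + (m%:R * h) *: xi); rewrite ler01 lexx => /(_ isT).
  rewrite scale1r -addrA -scalerDl -[m.+1]addn1 natrD mulrDl mul1r => s1.
  rewrite (_ : v _ - v x = (v (x + (m%:R * h + h) *: xi) - v (x + (m%:R * h) *: xi))
     + (v (x + (m%:R * h) *: xi) - v x)); last by ring.
  by apply: le_trans (ler_normD _ _) _; rewrite mulrDr; lra.
have pos (s : R) x : 0 <= s -> `|v (x + s *: xi) - v x| <= N * (s + h).
  move=> s0; pose m := Num.truncn (s / h).
  have /andP[m1 m2] := truncn_itv (divr_ge0 s0 (ltW h_gt0)).
  rewrite -/m in m1 m2.
  pose r := s / h - m%:R.
  have r01 : 0 <= r <= 1 by rewrite /r; move: m2; rewrite -natr1 => ?; apply/andP; split; lra.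
  have sE : s = m%:R * h + h * r by rewrite /r; field; rewrite gt_eqF.
  have e1 := steps m x; have e2 := step r (x + (m%:R * h) *: xi) r01.
  rewrite scalerA -addrA -scalerDl -sE in e2.
  have mh : m%:R * h <= s by rewrite -ler_pdivlMr.
  have e3 : N * (m%:R * h) <= N * s by rewrite ler_wpM2l.
  rewrite (_ : v _ - v x = (v (x + s *: xi) - v (x + (m%:R * h) *: xi))
     + (v (x + (m%:R * h) *: xi) - v x)); last by ring.
  by apply: le_trans (ler_normD _ _) _; rewrite mulrDr; lra.
have [t0|t0] := leP 0 t; first by rewrite (ger0_norm t0) pos.
have := pos (- t) (y + t *: xi); rewrite oppr_ge0 => /(_ (ltW t0)).
by rewrite -addrA -scalerDl subrr scale0r addr0 distrC (ltr0_norm t0).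
Qed.

Lemma dist_combination (I : finType) (l : I -> V) (s : I -> R) y (B : R) :
  (forall k, `|s k| <= B) ->
  (forall k t, 0 <= t <= 1 -> forall x, `|fdiff h (t *: l k) v x| <= N) ->
  `|v (y + \sum_k s k *: l k) - v y| <= #|I|%:R * (N * (B + h)).
Proof.
move=> sB vN; rewrite -sumr_constE.
elim: (index_enum I) => [|k r IH]; first by rewrite !big_nil addr0 subrr normr0.
rewrite !big_cons [s k *: l k + _]addrC addrA.
set z := y + _ in IH *.
rewrite (_ : v _ - v y = (v (z + s k *: l k) - v z) + (v z - v y)); last by ring.
apply: le_trans (ler_normD _ _) _; apply: lerD => //.
apply: le_trans (dist_multiple _ _ (vN k)) _.
by rewrite ler_wpM2l// lerD2r.
Qed.

End Lipschitz.

Section MixedDifferences.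
Context {R : realType} {d d1 : nat}.
Local Notation V := 'rV[R]_d.
Variables (l : sidx d1 -> V) (v rho : V -> R) (h C : R).
Hypotheses (h_gt0 : 0 < h) (C_ge0 : 0 <= C)
  (l_le1 : forall k, enorm (l k) <= 1)
  (rho_shift : forall x xi, enorm xi <= 1 -> rho x - h <= rho (x + h *: xi))
  (pure : forall k x, rho x * `|fdiff2 h (l k) v x| <= C).
Implicit Types (x u w : V).

Lemma fdiffD (phi : V -> R) u w x :
  fdiff h (u + w) phi x = fdiff h u phi (x + h *: w) + fdiff h w phi x.
Proof.
rewrite /fdiff /shiftT scalerDr addrA -mulrDl [x + h *: u + _]addrAC.
by congr (_ / _); ring.
Qed.

Lemma fdiff_shiftD (phi1 phi2 : V -> R) u w x :
  fdiff h u (fun y => phi1 (y + w) + phi2 y) x =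
  fdiff h u phi1 (x + w) + fdiff h u phi2 x.
Proof.
by rewrite /fdiff /shiftT [x + h *: u + w]addrAC -mulrDl; congr (_ / _); ring.
Qed.

(** Discrete form of [2 D_u D_w = D_{u+w}^2 - D_u^2 - D_w^2], with shifted base points. *)
Lemma fdiff_polarization u w x :
  fdiff h u (fdiff h w v) x = (fdiff2 h (u + w) v (x + h *: u)
    - fdiff2 h u v (x + h *: w + h *: u) - fdiff2 h w v x) / 2.
Proof.
have hn0 : h != 0 by rewrite gt_eqF.
rewrite /fdiff2 /fdiff /shiftT !scalerN !scalerDr.
have -> : x + h *: u - (h *: u + h *: w) = x - h *: w.
  by rewrite opprD addrA addrK.
have -> : x + h *: u + (h *: u + h *: w) = x + h *: w + h *: u + h *: u.
  by rewrite [h *: u + h *: w]addrC addrA [x + h *: u + h *: w]addrAC.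
by rewrite addrK [x + h *: u + h *: w]addrAC; field.
Qed.

Lemma weighted_sum3 (q a1 a2 a3 : R) : q * `|a1| <= C -> q * `|a2| <= C ->
  q * `|a3| <= C -> q * `|(a1 - a2 - a3) / 2| <= 2 * C.
Proof.
move=> h1 h2 h3; have [q0|q0] := leP q 0.
  by apply: (@le_trans _ _ 0); rewrite ?mulr_ge0// mulr_le0_ge0.
have : `|(a1 - a2 - a3) / 2| <= (`|a1| + `|a2| + `|a3|) / 2.
  rewrite normrM [`|2^-1|]ger0_norm ?invr_ge0// ler_pM2r ?invr_gt0//.
  by rewrite (le_trans (ler_normB _ _))// lerD2r ler_normB.
by move=> /(ler_wpM2l (ltW q0)) le; apply: le_trans le _; have := C_ge0; lra.
Qed.

(** Polarization needs [u + w] among the directions, which holds for distinct [u] and [w]; equal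
    ones give a pure second difference. Base points are at most two steps from [x], hence the loss
    [2 * h]. *)
Lemma mixed_calL d0 u w x : direction_condition l d0 -> calL l d0 u -> calL l d0 w ->
  (rho x - 2 * h) * `|fdiff h u (fdiff h w v) x| <= 2 * C.
Proof.
move=> [_ _ sums] Lu Lw; have [ku _ ul] := Lu; have [kw _ wl] := Lw.
have h0 := h_gt0; have C0 := C_ge0.
have hn0 : h != 0 by rewrite gt_eqF.
have u1 : enorm u <= 1 by rewrite -ul.
have w1 : enorm w <= 1 by rewrite -wl.
have pureq (k : sidx d1) (y : V) (q : R) : q <= rho y -> q * `|fdiff2 h (l k) v y| <= C.
  by move=> qy; apply: le_trans (pure k y); rewrite ler_wpM2r.
have r1 := rho_shift x u1; have r2 := rho_shift x w1.
have r3 := rho_shift (x + h *: w) u1.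
have [uw|uw] := eqVneq u w.
  have -> : fdiff h u (fdiff h w v) x = fdiff2 h u v (x + h *: u).
    by rewrite -uw fdiff2_mixed// fdiffN opprK.
  by rewrite -ul; apply: (@le_trans _ _ C); [apply: pureq; rewrite ul|]; lra.
have [k _ kE] : Lambda l (u + w).
  by apply: sums; exists (u, w) => //; split.
rewrite fdiff_polarization -kE -ul -wl; apply: weighted_sum3; apply: pureq; rewrite ?ul ?wl; lra.
Qed.

(** Each direction is a sum of two elements of [calL], so the difference splits into four, based at
    most two steps away. With the loss in [mixed_calL] this uses [4 * h] of the [6 * h]. *)
Lemma mixed_bound d0 i j x : direction_condition l d0 ->
  (rho x - 6 * h) * `|fdiff h (l i) (fdiff h (l j) v) x| <= 8 * C.
Proof.
move=> dc; have [_ sub _] := dc; have h0 := h_gt0; have C0 := C_ge0.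
have [u1 Lu1 [u2 Lu2 iE]] : [set u + w | u in calL l d0 & w in calL l d0] (l i).
  by apply: sub; exists i.
have [w1 Lw1 [w2 Lw2 jE]] : [set u + w | u in calL l d0 & w in calL l d0] (l j).
  by apply: sub; exists j.
have le1 u : calL l d0 u -> enorm u <= 1 by move=> [k _ <-].
rewrite -iE -jE.
have -> : fdiff h (u1 + u2) (fdiff h (w1 + w2) v) x =
  fdiff h u1 (fdiff h w1 v) (x + h *: u2 + h *: w2)
  + fdiff h u2 (fdiff h w1 v) (x + h *: w2)
  + (fdiff h u1 (fdiff h w2 v) (x + h *: u2) + fdiff h u2 (fdiff h w2 v) x).
  rewrite (_ : fdiff h (w1 + w2) v =
      fun y => fdiff h w1 v (y + h *: w2) + fdiff h w2 v y); last first.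
    by apply/funext => y; exact: fdiffD.
  rewrite [LHS]fdiffD !fdiff_shiftD; ring.
have [q0|q0] := leP (rho x - 6 * h) 0.
  by apply: (@le_trans _ _ 0); rewrite ?mulr_ge0// mulr_le0_ge0.
have m u w y : calL l d0 u -> calL l d0 w -> rho x - 2 * h <= rho y ->
    (rho x - 6 * h) * `|fdiff h u (fdiff h w v) y| <= 2 * C.
  move=> Lu Lw xy; apply: le_trans (mixed_calL y dc Lu Lw).
  by rewrite ler_wpM2r//; lra.
have r1 := rho_shift x (le1 _ Lu2); have r2 := rho_shift x (le1 _ Lw2).
have r3 := rho_shift (x + h *: u2) (le1 _ Lw2).
have m1 := m _ _ (x + h *: u2 + h *: w2) Lu1 Lw1.
have m2 := m _ _ (x + h *: w2) Lu2 Lw1.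
have m3 := m _ _ (x + h *: u2) Lu1 Lw2.
have m4 := m _ _ x Lu2 Lw2.
set A1 := fdiff h u1 (fdiff h w1 v) _ in m1 *.
set A2 := fdiff h u2 (fdiff h w1 v) _ in m2 *.
set A3 := fdiff h u1 (fdiff h w2 v) _ in m3 *.
set A4 := fdiff h u2 (fdiff h w2 v) _ in m4 *.
have : `|A1 + A2 + (A3 + A4)| <= `|A1| + `|A2| + (`|A3| + `|A4|).
  by rewrite (le_trans (ler_normD _ _))// lerD// ler_normD.
move=> /(ler_wpM2l (ltW q0)) le; apply: le_trans le _.
have {}m1 : (rho x - 6 * h) * `|A1| <= 2 * C by apply: m1; lra.
have {}m2 : (rho x - 6 * h) * `|A2| <= 2 * C by apply: m2; lra.
have {}m3 : (rho x - 6 * h) * `|A3| <= 2 * C by apply: m3; lra.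
have {}m4 : (rho x - 6 * h) * `|A4| <= 2 * C by apply: m4; lra.
lra.
Qed.

End MixedDifferences.

(** * Existence, uniqueness and the uniform estimates on the bounded domain *)

Theorem theorem1p2 (R : realType) (d d1 : nat) (A : Type)
  (a b : A -> sidx d1 -> 'rV[R]_d -> R) (c f : A -> 'rV[R]_d -> R)
  (l : sidx d1 -> 'rV[R]_d) (g psi : 'rV[R]_d -> R) (delta K : R)
  (d_ge1 : (1 <= d)%N) (d1_ge1 : (1 <= d1)%N) (A_nonempty : inhabited A)
  (a_bdd : forall k x, exists M : R, forall alpha, `|a alpha k x| <= M)
  (b_bdd : forall k x, exists M : R, forall alpha, `|b alpha k x| <= M)
  (c_bdd : forall x, exists M : R, forall alpha, `|c alpha x| <= M)
  (f_bdd : forall x, exists M : R, forall alpha, `|f alpha x| <= M)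
  (l_ball : forall k, unit_ball (l k))
  (delta_gt0 : 0 < delta) (K_gt0 : 0 < K)
  (a_ge : forall alpha k x, delta <= a alpha k x)
  (c_ge : forall alpha x, delta <= c alpha x)
  (g_C11 : is_C11 g /\ (C11_norm g <= K%:E)%E)
  (a_C11 : forall alpha k, is_C11 (a alpha k) /\ (C11_norm (a alpha k) <= K%:E)%E)
  (b_C11 : forall alpha k, is_C11 (b alpha k) /\ (C11_norm (b alpha k) <= K%:E)%E)
  (c_C11 : forall alpha, is_C11 (c alpha) /\ (C11_norm (c alpha) <= K%:E)%E)
  (f_C11 : forall alpha, is_C11 (f alpha) /\ (C11_norm (f alpha) <= K%:E)%E)
  (l_opp : forall k, l k = - l (sidx_opp k))
  (a_opp : forall alpha k x, a alpha k x = a alpha (sidx_opp k) x)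
  (l_sums : exists d0 : nat, (1 <= d0 <= d1)%N /\ direction_condition l d0)
  (l_rat : forall k i, rational (l k 0 i))
  (l_span : spans_space l)
  (psi_C2 : is_C2 psi)
  (Omega_domain : is_domain [set x | 0 < psi x])
  (Omega_bdd : bounded_set [set x | 0 < psi x])
  (psi_grad : forall x, topo_boundary [set x | 0 < psi x] x ->
     1 <= enorm (grad psi x)) :
  let Omega := [set x | 0 < psi x] in
  let rho := edist_to (~` Omega) in
  exists N h0 : R, [/\ 0 <= N, 0 < h0 &
    forall h : R, 0 < h <= h0 ->
      exists vh : 'rV[R]_d -> R,
        unique (bounded_borel_solution l a b c f Omega g h) vh /\
        [/\ forall x, `|vh x - g x| <= N * rho x,
            forall i x, `|fdiff h (l i) vh x| <= N,
            forall i j x,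
              (rho x - 6 * h) * `|fdiff h (l i) (fdiff h (l j) vh) x| <= N &
            forall x y, `|vh x - vh y| <= N * (enorm (x - y) + h)]].
Proof.
move=> Omega rho.
pose K2 := 2 * K.
have K20 : 0 < K2 by rewrite mulr_gt0.
have sm (phi : 'rV[R]_d -> R) : is_C11 phi /\ (C11_norm phi <= K%:E)%E ->
    smooth_bound K2 phi by case; exact: C11_smooth_bound.
have sa al k := sm _ (a_C11 al k).
have sb al k := sm _ (b_C11 al k).
have sc al := sm _ (c_C11 al).
have sf al := sm _ (f_C11 al).
have sg := sm _ g_C11.
have oK : involutive (@sidx_opp d1) by case=> i s; rewrite /sidx_opp/= negbK.
have l_o k : l (sidx_opp k) = - l k by rewrite [in RHS]l_opp opprK.
have a_o al k x : a al (sidx_opp k) x = a al k x by [].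
have l1 k : enorm (l k) <= 1 := l_ball k.
have [d0 [_ dc]] := l_sums.
have [cl cl0 ell] := span_elliptic l_span.
have [T [s [T0 sE sT]]] := span_coef l_span.
have [oO _ One] := Omega_domain.
have C0 : (~` Omega) !=set0 := nonempty_compl d_ge1 psi_C2 Omega_bdd.
have [Rm Rm0 HRm] := edist_bounded d_ge1 psi_C2 Omega_bdd.
pose N0 := K2 + K2 / delta.
have N00 : 0 <= N0 by rewrite addr_ge0 ?divr_ge0 ?(ltW K20)// ltW.
have [hb [Nb [hb01 Nb0 Hb]]] := boundary_estimate oK l_o l1 a_o delta_gt0 K20 a_ge c_ge
  sa sb sc sf cl0 ell d_ge1 psi_C2 One Omega_bdd psi_grad sg N00.
(* Where [rho <= 2 * h], a neighbour has [rho <= 3 * h]: the boundary estimate gives [2 + 3]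
   multiples of [Nb], and [g] gives [K2]. *)
pose NB := 5 * Nb + K2.
have NB0 : 0 <= NB by rewrite /NB; lra.
have [N1 [N10 H1]] := first_diff_bound oK l_o l1 a_o delta_gt0 K20 a_ge
  sa sb sc sf N00 NB0.
have [Nv [Nv0 Hv]] := vector_diff_bound oK l_o l1 a_o delta_gt0 K20 a_ge c_ge
  sa sb sc sf N00 N10 NB0 ler01.
have [N2' [N20' H2]] := second_diff_bound oK l_o l1 a_o delta_gt0 K20 a_ge
  sa sb sc sf N00 N10 Rm0.
(* The first term comes from balls of radius [rho / 2], the second from the crude bound where
   [rho <= 8 * h]. *)
pose N2 := 2 * N2' + 16 * N1.
have N20 : 0 <= N2 by rewrite /N2; lra.
pose NL := N1 + Nv.
have NL0 : 0 <= NL by rewrite addr_ge0.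
pose n : R := #|sidx d1|%:R.
have n0 : 0 <= n by [].
have nL : 0 <= n * (NL * (T + 1)) by rewrite !mulr_ge0// addr_ge0.
exists (Nb + N1 + 8 * N2 + n * (NL * (T + 1))), (Num.min hb (delta / K2)).
have hb0 : 0 < hb by case/andP: hb01.
split; [lra | by rewrite lt_min hb0 divr_gt0 |].
move=> h /andP[h0]; rewrite le_min => /andP[hhb hdK].
have h01 : 0 < h <= 1 by rewrite h0/=; case/andP: hb01 => _; exact: le_trans.
have hhb' : 0 < h <= hb by rewrite h0.
have Kh : K2 * h <= delta by rewrite mulrC -ler_pdivlMr.
have hn0 : h != 0 by rewrite gt_eqF.
have bg : borel_fun g.
  by case: sg => _ lip _; apply: continuous_borel; exact: enorm_lipschitz_continuous lip.
have gK : forall x, `|g x| <= K2 by case: sg.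
pose D := inner_domain Omega h.
have [v [vM vB vD vg]] := exists_solution oK l_o a_o delta_gt0 K20 a_ge c_ge
  sa sb sc sf A_nonempty h01 Kh (open_inner h0 C0 oO) gK bg.
have sol := bell_solves oK l_o a_o delta_gt0 K20 a_ge sa sb sc sf A_nonempty
  h01 Kh vM vD.
exists v; split.
  split; first by split=> //; exists N0.
  move=> w [[M wM] _ wD wg].
  have wsol := bell_solves oK l_o a_o delta_gt0 K20 a_ge sa sb sc sf A_nonempty
    h01 Kh wM wD.
  pose MM := Num.max N0 M.
  have vMM x : `|v x| <= MM by rewrite le_max vM.
  have wMM x : `|w x| <= MM by rewrite le_max wM orbT.
  apply/funext => x; apply/le_anti/andP; split.
    apply: (comparison oK l_o a_o delta_gt0 K20 a_ge c_ge sa sb h01 Kh vMM wMM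
      _ sol.2 wsol.1) => y nDy.
    by rewrite vg// wg.
  apply: (comparison oK l_o a_o delta_gt0 K20 a_ge c_ge sa sb h01 Kh wMM vMM
    _ wsol.2 sol.1) => y nDy.
  by rewrite vg// wg.
have vb := Hb h v hhb' Kh sol vM vg.
have rho0 x : 0 <= rho x by exact: edist_to_ge0.
have near (xi : 'rV[R]_d) x : enorm xi <= 1 -> rho x <= 2 * h -> `|fdiff h xi v x| <= NB.
  move=> xi1 rx; rewrite /fdiff /shiftT normrM normfV (gtr0_norm h0) ler_pdivrMr//.
  have /andP[_ r2] := edist_to_shift x C0 h0 xi1.
  have e1 := vb (x + h *: xi); have e2 := vb x.
  have e3 : `|g (x + h *: xi) - g x| <= K2 * h.
    case: sg => _ /(_ (x + h *: xi) x) + _ => le; apply: le_trans le _.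
    by rewrite addrAC subrr add0r enormZ (gtr0_norm h0) ler_wpM2l ?(ltW K20)// ler_piMr// ltW.
  have e4 : Nb * rho x <= Nb * (2 * h) by rewrite ler_wpM2l.
  have r3 : rho (x + h *: xi) <= rho x + h := r2.
  have e5 : Nb * rho (x + h *: xi) <= Nb * (3 * h) by rewrite ler_wpM2l//; move: rx r3; clear; lra.
  rewrite (_ : v _ - v x = (v (x + h *: xi) - g (x + h *: xi)) - (v x - g x)
     + (g (x + h *: xi) - g x)); last by ring.
  apply: le_trans (ler_normD _ _) _; have := ler_normB (v (x + h *: xi) - g (x + h *: xi)) (v x - g x).
  by move: e1 e2 e3 e4 e5; rewrite /NB; clear; lra.
have deep (xi : 'rV[R]_d) x : enorm xi <= 1 -> ~ D (x + h *: xi) -> rho x <= 2 * h.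
  move=> xi1 /(not_inner_edist h0 C0) r1.
  have /andP[r2 _] := edist_to_shift x C0 h0 xi1.
  have r3 : rho x - h <= rho (x + h *: xi) := r2.
  have r4 : rho (x + h *: xi) <= h := r1.
  by move: r3 r4; clear; lra.
have deep0 x : ~ D x -> rho x <= 2 * h.
  move=> /(not_inner_edist h0 C0) r1; have r2 : rho x <= h := r1.
  by move: h0 r2; clear; lra.
have dich x : (D x /\ forall k, D (x + h *: l k)) \/ rho x <= 2 * h.
  have [?|] := pselect (D x /\ forall k, D (x + h *: l k)); first by left.
  move=> /not_andP[/deep0|/existsNP[k]/deep]; first by right.
  by move=> /(_ (l1 k)); right.
have v1 : forall k x, `|fdiff h (l k) v x| <= N1.
  apply: (H1 h D v h01 Kh sol vM) => x.
  by have [|r] := dich x; [left | right => k; exact: near].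
have vxi (xi : 'rV[R]_d) : enorm xi <= 1 -> forall x, - fdiff h xi v x <= Nv.
  move=> xi1; apply: (Hv h D v xi h01 Kh sol vM v1 xi1) => x.
  have nr : rho x <= 2 * h -> - fdiff h xi v x <= NB.
    by move=> /(near _ _ xi1)/ler_normlP[].
  have [[Dx Dxk]|r] := dich x; last by right; exact: nr.
  by have [Dxi|/(deep _ _ xi1)] := pselect (D (x + h *: xi)); [left | right; exact: nr].
have vxi' (xi : 'rV[R]_d) x : enorm xi <= 1 -> `|fdiff h xi v x| <= Nv.
  move=> xi1; apply/ler_normlP; split; first exact: vxi.
  by rewrite -[leLHS]opprK -fdiffN; apply: vxi; rewrite enormN.
have pure k x : rho x * `|fdiff2 h (l k) v x| <= N2.
  have [r8|r8] := leP (rho x) (8 * h).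
    have e1 : `|fdiff2 h (l k) v x| <= 2 * N1 / h.
      by apply: (fdiff2_le l_o) => // j; exact: v1.
    apply: (@le_trans _ _ (8 * h * (2 * N1 / h))); first by rewrite ler_pM.
    have -> : 8 * h * (2 * N1 / h) = 16 * N1 by field.
    by move: N20'; rewrite /N2; clear; lra.
  have r0 : 0 < rho x / 2 <= Rm.
    have r1 : rho x <= Rm := HRm x.
    by apply/andP; split; move: r8 h0 r1 (rho0 x); clear; lra.
  (* Such [y] has [rho y > 4 * h], which excludes the boundary layer [rho <= 2 * h]. *)
  have ball y : enorm (y - x) < rho x / 2 -> D y /\ forall k, D (y + h *: l k).
    move=> yx; have [//|ry] := dich y.
    have := edist_to_lip x y C0; rewrite enormB => r1.
    have r2 : rho x <= rho y + enorm (y - x) := r1.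
    by move: yx ry r8 h0 r2; clear; lra.
  have := H2 h D v x (rho x / 2) h01 Kh sol vM v1 r0 ball k.
  by move: N10; rewrite /N2; clear; lra.
split.
- move=> x; apply: le_trans (vb x) _; rewrite ler_wpM2r//.
  by move: N10 N20 nL; clear; lra.
- move=> i x; apply: le_trans (v1 i x) _; move: Nb0 N20 nL; clear; lra.
- move=> i j x.
  have rs y xi : enorm xi <= 1 -> rho y - h <= rho (y + h *: xi).
    by move=> xi1; have /andP[] := edist_to_shift y C0 h0 xi1.
  apply: le_trans (mixed_bound h0 N20 l1 rs pure i j x dc) _.
  by move: Nb0 N10 nL; clear; lra.
- move=> x y.
  have sB k : `|s (x - y) k| <= T * enorm (x - y) by [].
  (* Shortened directions leave the lattice; this is the purpose of [vector_diff_bound]. *)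
  have vNL k t : 0 <= t <= 1 -> forall z, `|fdiff h (t *: l k) v z| <= NL.
    move=> /andP[t0 t1] z; apply: (@le_trans _ _ Nv); last by rewrite lerDr.
    by apply: vxi'; rewrite enormZ (ger0_norm t0) mulr_ile1 ?enorm_ge0.
  have := dist_combination h0 NL0 y sB vNL.
  rewrite -sE [y + (x - y)]addrC subrK => le; apply: le_trans le _.
  have e0 := enorm_ge0 (x - y).
  have e1 : T * enorm (x - y) + h <= (T + 1) * (enorm (x - y) + h).
    have Th : 0 <= T * h by rewrite mulr_ge0// ltW.
    by rewrite mulrDr !mulrDl !mul1r; move: Th e0; clear; lra.
  have e2 := ler_wpM2l n0 (ler_wpM2l NL0 e1).
  apply: le_trans e2 _; rewrite -/n !mulrA ler_wpM2r//; last first.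
    by rewrite -!mulrA lerDr; move: Nb0 N10 N20; clear; lra.
  by rewrite addr_ge0// ltW.
Qed.
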